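(* Let $n\ge 1$ and $k\in\{1,\ldots,n\}$. Then for all $u\in S(\mathbb{R}^n_{k,+})$, $$\int_{\mathbb{R}^n_{k,+}}|\nabla u(x)|^2\,dx\;\int_{\mathbb{R}^n_{k,+}}|x|^2|u(x)|^2\,dx\;\ge\;\frac{(n+2k)^2}{4}\left(\int_{\mathbb{R}^n_{k,+}}|u(x)|^2\,dx\right)^2.$$ The constant $\frac{(n+2k)^2}{4}$ is sharp (it cannot be replaced by a larger one), and equality holds if and only if $u$ is of the form $u(x)=\Big(\prod_{i=n-k+1}^{n}x_i\Big)\alpha e^{-\beta|x|^2}$ for some constants $\alpha$ and $\beta$ with $\beta>0$.
   Context: $\mathbb{R}_{>0}=(0,\infty)$ and, for $k\in\{1,\ldots,n\}$, the orthant is $\mathbb{R}^n_{k,+}:=\mathbb{R}^{n-k}\times\mathbb{R}_{>0}^k$ (so the last $k$ coordinates are positive). $C_c^\infty(\mathbb{R}^n_{k,+})$ is the space of smooth functions with compact support in the open set $\mathbb{R}^n_{k,+}$. $S(\mathbb{R}^n_{k,+})$ is the completion of $C_c^\infty(\mathbb{R}^n_{k,+})$ under the norm $\left(\int_{\mathbb{R}^n_{k,+}}|\nabla u(x)|^2dx\right)^{1/2}+\left(\int_{\mathbb{R}^n_{k,+}}|x|^2|u(x)|^2dx\right)^{1/2}$. Functions are real-valued and constants are real. *)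

(* Defs.v *)
From HB Require Import structures.
From mathcomp Require Import all_boot all_order all_algebra.
From mathcomp Require Import all_classical all_reals all_analysis.

Set Implicit Arguments.
Unset Strict Implicit.
Unset Printing Implicit Defensive.

Import Order.TTheory GRing.Theory Num.Theory.
Import numFieldNormedType.Exports.

Local Open Scope classical_set_scope.
Local Open Scope ring_scope.

(* ['rV[R]_n] carries the sigma-algebra generated by the coordinates, which is
   the Borel sigma-algebra of R^n. *)
Definition rV_display : measure_display.
Proof. exact. Qed.

Section measurable_rV.
Context {R : realType} {n : nat}.

Let coors : 'I_n -> 'rV[R]_n -> R := fun i x => x ord0 i.

Let rV_set0 : g_sigma_preimage coors set0.
Proof. exact: sigma_algebra0. Qed.

Let rV_setC A : g_sigma_preimage coors A -> g_sigma_preimage coors (~` A).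
Proof. exact: sigma_algebraC. Qed.

Let rV_bigcup (F : (set 'rV[R]_n)^nat) :
  (forall i, g_sigma_preimage coors (F i)) ->
  g_sigma_preimage coors (\bigcup_i (F i)).
Proof. exact: sigma_algebra_bigcup. Qed.

HB.instance Definition _ := @isMeasurable.Build rV_display
  'rV[R]_n (g_sigma_preimage coors) rV_set0 rV_setC rV_bigcup.

End measurable_rV.

Lemma measurable_coord (R : realType) n (i : 'I_n) :
  measurable_fun [set: 'rV[R]_n] (fun x => x ord0 i).
Proof.
move=> _ Y mY; rewrite setTI; apply: sub_sigma_algebra => /=.
rewrite -bigcup_seq/=; exists i => /=; first by rewrite mem_index_enum.
by exists Y => //; rewrite setTI.
Qed.

Lemma measurable_fun_rVP d (T : measurableType d) (R : realType) n
    (f : T -> 'rV[R]_n) :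
  (forall i, measurable_fun [set: T] (fun x => f x ord0 i)) ->
  measurable_fun [set: T] f.
Proof.
move=> mf; apply: (@measurability _ _ _ _ setT f
  (\big[setU/set0]_(i < n) preimage_set_system setT
     (fun x : 'rV[R]_n => x ord0 i) measurable)) => //.
move=> _ [A + <-]; rewrite -bigcup_seq/= => -[i _ [B mB <-]].
by rewrite !setTI; have := mf i measurableT _ mB; rewrite setTI.
Qed.

Section cons_rV.
Context {R : realType} {n : nat}.

Definition cons_rV (p : R * 'rV[R]_n) : 'rV[R]_n.+1 :=
  \row_i oapp (p.2 ord0) p.1 (unlift ord0 i).

Definition uncons_rV (v : 'rV[R]_n.+1) : R * 'rV[R]_n :=
  (v ord0 ord0, \row_i v ord0 (lift ord0 i)).

Lemma cons_rVK : cancel cons_rV uncons_rV.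
Proof.
move=> [x v]; rewrite /uncons_rV /cons_rV mxE unlift_none/=; congr pair.
by apply/rowP => i; rewrite !mxE liftK.
Qed.

Lemma measurable_cons_rV : measurable_fun setT cons_rV.
Proof.
apply: measurable_fun_rVP => i.
case: (unliftP ord0 i) => [j|] ->.
  rewrite [X in measurable_fun _ X](_ : _ =
    (fun x : 'rV[R]_n => x ord0 j) \o snd).
    by apply: measurableT_comp => //; exact: measurable_coord.
  by apply/funext => p /=; rewrite mxE liftK.
rewrite [X in measurable_fun _ X](_ : _ = fst) //.
by apply/funext => p /=; rewrite mxE unlift_none.
Qed.

Lemma measurable_uncons_rV : measurable_fun setT uncons_rV.
Proof.
apply/measurable_fun_pair; first exact: measurable_coord.
apply: measurable_fun_rVP => i.
rewrite [X in measurable_fun _ X](_ : _ =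
    (fun v : 'rV[R]_n.+1 => v ord0 (lift ord0 i))).
  exact: measurable_coord.
by apply/funext => v; rewrite mxE.
Qed.

Variable m : {sigma_finite_measure set 'rV[R]_n -> \bar R}.

Definition cons_measure : set 'rV[R]_n.+1 -> \bar R :=
  pushforward (@lebesgue_measure R \x m)%E cons_rV.

Let measurable_preimage_cons_rV (A : set 'rV[R]_n.+1) :
  measurable A -> measurable (cons_rV @^-1` A).
Proof.
by move=> mA; rewrite -[X in measurable X]setTI; exact: measurable_cons_rV.
Qed.

Let cons_measure0 : cons_measure set0 = 0%E.
Proof. by rewrite /cons_measure /pushforward preimage_set0 measure0. Qed.

Let cons_measure_ge0 A : (0 <= cons_measure A)%E.
Proof. exact: (@measure_ge0 _ _ _ (@lebesgue_measure R \x m)%E). Qed.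

Let cons_measure_sigma_additive : semi_sigma_additive cons_measure.
Proof.
move=> F mF tF mUF; rewrite /cons_measure /pushforward preimage_bigcup.
apply: (@measure_semi_sigma_additive _ _ _ (@lebesgue_measure R \x m)%E).
- by move=> i; exact: measurable_preimage_cons_rV.
- apply/trivIsetP => /= i j _ _ ij; rewrite -preimage_setI.
  by move/trivIsetP : tF => /(_ _ _ _ _ ij) ->//; rewrite preimage_set0.
- by rewrite -preimage_bigcup; exact: measurable_preimage_cons_rV.
Qed.

HB.instance Definition _ := isMeasure.Build _ _ _ cons_measure
  cons_measure0 cons_measure_ge0 cons_measure_sigma_additive.

Let cons_measure_sigma_finite : sigma_finite setT cons_measure.
Proof.
have /sigma_finiteP[F [TF ndF Foo]] := sigma_finiteT (@lebesgue_measure R).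
have /sigma_finiteP[G [TG ndG Goo]] := sigma_finiteT m.
exists (fun k => uncons_rV @^-1` (F k `*` G k)).
  apply/esym; rewrite -subTset => v _.
  have [i _ Fi] : (\bigcup_i F i) (uncons_rV v).1 by rewrite -TF.
  have [j _ Gj] : (\bigcup_i G i) (uncons_rV v).2 by rewrite -TG.
  exists (maxn i j) => //; split.
  - by move: Fi; exact/subsetPset/ndF/leq_maxl.
  - by move: Gj; exact/subsetPset/ndG/leq_maxr.
move=> k; have [mF Fk] := Foo k; have [mG Gk] := Goo k; split.
  rewrite -[X in measurable X]setTI; apply: measurable_uncons_rV => //.
  exact: measurableX.
rewrite /cons_measure /pushforward.
rewrite (_ : cons_rV @^-1` _ = F k `*` G k); last first.
  by apply/seteqP; split => p; rewrite /preimage /mkset cons_rVK.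
by rewrite product_measure1E// lte_mul_pinfty// ge0_fin_numE.
Qed.

HB.instance Definition _ := Measure_isSigmaFinite.Build _ _ _ cons_measure
  cons_measure_sigma_finite.

End cons_rV.

(* n-dimensional Lebesgue measure, as an iterated product *)
Fixpoint lebesgue_rV (R : realType) (n : nat) :
    {sigma_finite_measure set 'rV[R]_n -> \bar R} :=
  match n with
  | 0 => @dirac _ 'rV[R]_0 0 R
  | n'.+1 => cons_measure (lebesgue_rV R n')
  end.

Lemma measurable_box_rV (R : realType) n (A : 'I_n -> set R) :
  (forall i, measurable (A i)) ->
  measurable [set x : 'rV[R]_n | forall i, A i (x ord0 i)].
Proof.
move=> mA.
rewrite [X in measurable X](_ : _ =
    \big[setI/setT]_(i < n) ((fun x : 'rV[R]_n => x ord0 i) @^-1` A i)).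
  apply: bigsetI_measurable => i _.
  by rewrite -[X in measurable X]setTI; exact: measurable_coord.
rewrite -bigcap_seq; apply/seteqP; split => x Ax i; first by move=> _; exact: Ax.
by apply: (Ax i); rewrite /= mem_index_enum.
Qed.

Lemma lebesgue_rV_box (R : realType) n (A : 'I_n -> set R) :
  (forall i, measurable (A i)) ->
  lebesgue_rV R n [set x : 'rV[R]_n | forall i, A i (x ord0 i)] =
  (\prod_(i < n) lebesgue_measure (A i))%E.
Proof.
elim: n A => [A mA|n IHn A mA].
  by rewrite big_ord0 /= diracE mem_set// => -[].
rewrite big_ord_recl -(IHn (fun i => A (lift ord0 i)))//.
have mB := measurable_box_rV (fun i => mA (lift ord0 i)).
transitivity ((@lebesgue_measure R \x lebesgue_rV R n)%E (A ord0 `*`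
    [set x : 'rV[R]_n | forall i, A (lift ord0 i) (x ord0 i)])); last first.
  by apply: (product_measure1E (@lebesgue_measure R) (lebesgue_rV R n) (mA ord0)).
rewrite [LHS]/= /cons_measure /pushforward; congr (_ _).
apply/seteqP; split => -[x v] /=.
- move=> H; split => [|i] /=; first by have := H ord0; rewrite mxE unlift_none.
  by have := H (lift ord0 i); rewrite mxE liftK.
- by move=> [Ax Av] i; rewrite mxE; case: unliftP => [j|] -> //=; exact: Av.
Qed.

Section orthant.
Context {R : realType} {n : nat}.
Implicit Types (f u : 'rV[R]_n -> R) (x : 'rV[R]_n).

(* The square of the Euclidean norm; the library's [`|x|] on ['rV[R]_n] is the
   sup norm. *)
Definition sqnorm x : R := \sum_i x ord0 i ^+ 2.

Definition orthant (k : nat) : set 'rV[R]_n :=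
  [set x | forall i : 'I_n, (n - k <= i)%N -> 0 < x ord0 i].

Definition partial (i : 'I_n) f : 'rV[R]_n -> R :=
  fun x => 'D_(delta_mx ord0 i) f x.

Definition gradient f : 'rV[R]_n -> 'rV[R]_n :=
  fun x => \row_i partial i f x.

(* All iterated partial derivatives, in any order, exist and are continuous. *)
Definition smooth f : Prop := forall s : seq 'I_n,
  continuous (foldr partial f s) /\
  forall i x, derivable (foldr partial f s) x (delta_mx ord0 i).

(* C_c^infty of the orthant; functions are extended by 0 to the whole space. *)
Definition test_function (k : nat) f : Prop :=
  let supp := closure [set x | f x != 0] in
  [/\ smooth f, compact supp & supp `<=` orthant k].

Lemma measurable_orthant k : measurable (orthant k).
Proof.
rewrite [X in measurable X](_ : _ = [set x : 'rV[R]_n | forall i : 'I_n,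
    (if (n - k <= i)%N then `]0, +oo[%classic else setT) (x ord0 i)]).
  apply: (measurable_box_rV (A := fun i : 'I_n =>
    if (n - k <= i)%N then `]0, +oo[%classic else setT)) => i.
  by case: ifP.
apply/seteqP; split => x /= H i; have := H i; case: ifP => //=.
- by rewrite in_itv/= andbT => _ ->.
- by rewrite in_itv/= andbT.
Qed.

Local Open Scope ereal_scope.

Definition int_orthant (k : nat) (g : 'rV[R]_n -> R) : \bar R :=
  \int[lebesgue_rV R n]_(x in orthant k) (g x)%:E.

(* [in_completion k u Du]: the function [u], with gradient [Du], belongs to the
   completion S of C_c^infty under the norm
   (\int |grad f|^2)^(1/2) + (\int |x|^2 |f|^2)^(1/2).
   As the spaces L^2(|x|^2 dx) and L^2(dx)^n are complete, S is the closure in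
   their product of the graph of the gradient on C_c^infty. An element of S is a
   limit (u, Du) of pairs (f, grad f); [Du] is then the weak gradient of [u] and
   hence is determined by [u] almost everywhere. *)
Definition in_completion (k : nat) u (Du : 'rV[R]_n -> 'rV[R]_n) : Prop :=
  [/\ measurable_fun (orthant k) u, measurable_fun (orthant k) Du &
    exists f : nat -> 'rV[R]_n -> R,
    [/\ forall m, test_function k (f m),
        int_orthant k (fun x => sqnorm (gradient (f m) x - Du x)%R)
          @[m --> \oo] --> 0 &
        int_orthant k (fun x => sqnorm x * (f m x - u x) ^+ 2)%R
          @[m --> \oo] --> 0]].

Definition gradient_term (k : nat) (Du : 'rV[R]_n -> 'rV[R]_n) : \bar R :=
  int_orthant k (fun x => sqnorm (Du x)).

Definition weight_term (k : nat) u : \bar R :=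
  int_orthant k (fun x => sqnorm x * u x ^+ 2)%R.

Definition mass_term (k : nat) u : \bar R :=
  int_orthant k (fun x => u x ^+ 2)%R.

Definition extremizer (k : nat) (alpha beta : R) : 'rV[R]_n -> R :=
  fun x => ((\prod_(i < n | (n - k <= i)%N) x ord0 i) *
            (alpha * expR (- beta * sqnorm x)))%R.

End orthant.

(* Main.v *)
Require Import Defs.
From mathcomp Require Import all_boot all_order all_algebra.
From mathcomp Require Import all_classical all_reals all_analysis.
From mathcomp Require Import measurable_realfun ring lra.
Set Implicit Arguments.
Unset Strict Implicit.
Unset Printing Implicit Defensive.
Import Order.TTheory GRing.Theory Num.Theory.
Import numFieldNormedType.Exports.
Local Open Scope classical_set_scope.
Local Open Scope ring_scope.


(* Write N = n + 2 k and let G be the extremizer with alpha = 1, beta = b. It is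
   positive in the orthant and lap G = (4 b^2 |x|^2 - 2 b N) G, so for a test
   function f the substitution f = g G gives
     int |grad f|^2 + 4 b^2 int |x|^2 f^2 - 2 b N int f^2 = int G^2 |grad g|^2 >= 0.
   This passes to the completion, and optimizing over b gives the inequality.
   If equality holds, then for the optimal b the right-hand side tends to 0 along
   an approximating sequence f_m, so by the Poincare inequality f_m / G converges
   to a constant on every box inside the orthant, and u is a multiple of G.
   Extremizers are limits of test functions: each one-dimensional factor is
   truncated by smooth cutoffs built from exp(-1/t), by dominated convergence. *)

(** * Square-integrable functions *)

(** The completion norm controls the gradient and |x| u but not u itself: the weight degenerates at
    the origin, and convergence in L^2 is not part of the definition. It is recovered from the
    inequality for test functions at b = 1/2, applied to the differences f_m - f_l. An element u of
    the completion need not be differentiable, so the remainder int G^2 |grad g|^2 is only ever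
    evaluated at test functions; its limit is read off the left-hand side of the identity. The
    number N collects second derivatives: each factor exp(- b t^2) contributes - 2 b, and a factor t
    in front of it a further - 4 b, in all - 2 b (n + 2 k). As G vanishes on the boundary of the
    orthant, f / G is smooth because the support of f is compact inside the open orthant. That
    extremizers give equality needs no Gaussian moments: A + t^2 B - t C, with A, B the gradient and
    weight integrals and C = N int u^2, is nonnegative for all t and vanishes at t = 2 b, so its
    derivative vanishes there too. *)

Lemma cvg_dist_sqr_le (R : realType) (a b : nat -> R) l :
  (forall m, (a m - l) ^+ 2 <= b m) -> b @ \oo --> 0 -> a @ \oo --> l.
Proof.
move=> ab b0; apply/cvgrPdist_lt => e e0.
have : \forall m \near \oo, b m < e ^+ 2.
  by apply: (cvgr_lt _ b0); rewrite exprn_gt0.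
apply: filterS => m bm; rewrite distrC -(ltr_pXn2r (n:=2)) ?nnegrE//; last exact: ltW.
by rewrite real_normK ?num_real//; exact: le_lt_trans bm.
Qed.

Lemma cvg0_squeeze (R : realType) (a b : nat -> R) :
  (forall m, 0 <= a m <= b m) -> b @ \oo --> 0 -> a @ \oo --> 0.
Proof.
by move=> ab b0; apply: (squeeze_cvgr _ (cvg_cst _) b0); near=> m; exact: ab.
Unshelve. all: by end_near. Qed.

Section L2fun.
Context d (T : measurableType d) (R : realType).
Variables (mu : {measure set T -> \bar R}) (D : set T).
Hypothesis mD : measurable D.
Implicit Types f g h : T -> R.

Definition L2fun f := measurable_fun D f /\ mu.-integrable D (EFin \o (fun x => f x ^+ 2)).

(** A total real-valued form: [Rintegral] returns 0 when the integral is infinite, which is why the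
    algebraic rules below ask for [L2fun]. *)
Definition iprod f g : R := (\int[mu]_(x in D) (f x * g x))%R.

Lemma L2_fin f : measurable_fun D f ->
  (\int[mu]_(x in D) (f x ^+ 2)%:E < +oo)%E -> L2fun f.
Proof.
move=> mf fin; split=> //; apply/integrableP; split.
  by apply/measurable_EFinP; apply: measurable_funX.
rewrite (eq_integral (fun x => (f x ^+ 2)%:E))// => x _ /=.
by rewrite ger0_norm ?sqr_ge0.
Qed.

Lemma L2M f g : L2fun f -> L2fun g -> mu.-integrable D (EFin \o (fun x => f x * g x)).
Proof.
move=> [mf intf] [mg intg].
have mfg : measurable_fun D (fun x => f x * g x) by apply: measurable_funM.
apply: (le_integrable mD _ _ (integrableD mD intf intg)).
  exact/measurable_EFinP.
move=> x Dx /=; rewrite lee_fin ler_norml [`|_ + _|]ger0_norm ?addr_ge0 ?sqr_ge0//.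
by apply/andP; split; nra.
Qed.

Lemma L2D f g : L2fun f -> L2fun g -> L2fun (fun x => f x + g x).
Proof.
move=> Lf Lg; split; first by apply: measurable_funD; [case: Lf|case: Lg].
have [[[_ If] [_ Ig]] Ifg] := (Lf, Lg, L2M Lf Lg).
apply: eq_integrable (integrableD mD (integrableD mD If (integrableD mD Ifg Ifg)) Ig) => //= x _.
by rewrite -!EFinD; congr EFin; ring.
Qed.

Lemma L2Z c f : L2fun f -> L2fun (fun x => c * f x).
Proof.
move=> [mf If]; split; first exact: measurable_funM.
rewrite (_ : _ \o _ = (fun x => (c ^+ 2)%:E * (f x ^+ 2)%:E)%E).
  exact: integrableZl.
by apply/funext => x /=; rewrite -!EFinM; congr EFin; ring.
Qed.

Lemma L2B f g : L2fun f -> L2fun g -> L2fun (fun x => f x - g x).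
Proof.
move=> Lf /(L2Z (-1)) Lg; have := L2D Lf Lg.
by under eq_fun do rewrite mulN1r.
Qed.

Lemma ipC f g : iprod f g = iprod g f.
Proof. by congr Rintegral; apply/funext => x; rewrite mulrC. Qed.

Lemma ipZl c f g : L2fun f -> L2fun g -> iprod (fun x => c * f x) g = c * iprod f g.
Proof.
move=> Lf Lg; rewrite /iprod -RintegralZl//; last exact: L2M.
by congr Rintegral; apply/funext => x; rewrite mulrA.
Qed.

Lemma ipDl f g h : L2fun f -> L2fun g -> L2fun h ->
  iprod (fun x => f x + g x) h = iprod f h + iprod g h.
Proof.
move=> Lf Lg Lh; rewrite /iprod -RintegralD//; [|exact: L2M..].
by congr Rintegral; apply/funext => x; rewrite mulrDl.
Qed.

Lemma ipBl f g h : L2fun f -> L2fun g -> L2fun h ->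
  iprod (fun x => f x - g x) h = iprod f h - iprod g h.
Proof.
move=> Lf Lg Lh; rewrite /iprod -RintegralB//; [|exact: L2M..].
by congr Rintegral; apply/funext => x; rewrite mulrBl.
Qed.

Lemma ipZr c f g : L2fun f -> L2fun g -> iprod f (fun x => c * g x) = c * iprod f g.
Proof. by move=> Lf Lg; rewrite ipC ipZl// ipC. Qed.

Lemma ipDr f g h : L2fun f -> L2fun g -> L2fun h ->
  iprod h (fun x => f x + g x) = iprod h f + iprod h g.
Proof. by move=> Lf Lg Lh; rewrite ipC ipDl// !(ipC h). Qed.

Lemma ipBr f g h : L2fun f -> L2fun g -> L2fun h ->
  iprod h (fun x => f x - g x) = iprod h f - iprod h g.
Proof. by move=> Lf Lg Lh; rewrite ipC ipBl// !(ipC h). Qed.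

Lemma ip_ge0 f : 0 <= iprod f f.
Proof. by apply: Rintegral_ge0 => x _; rewrite -expr2 sqr_ge0. Qed.

Lemma eq_ip f f' g g' : {in D, f =1 f'} -> {in D, g =1 g'} -> iprod f g = iprod f' g'.
Proof. by move=> ff gg; apply: eq_Rintegral => x Dx; rewrite ff// gg. Qed.

Lemma ip_integral f : L2fun f -> (iprod f f)%:E = (\int[mu]_(x in D) (f x ^+ 2)%:E)%E.
Proof.
move=> [_ If]; rewrite /iprod /Rintegral fineK; first by under eq_fun do rewrite -expr2.
by under eq_fun do rewrite -expr2; exact: integrable_fin_num.
Qed.

Lemma ip_sqrB f g : L2fun f -> L2fun g ->
  iprod (fun x => f x - g x) (fun x => f x - g x) = iprod f f - 2 * iprod f g + iprod g g.
Proof.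
move=> Lf Lg; have Lfg := L2B Lf Lg.
by rewrite ipBl// !ipBr// (ipC g f); ring.
Qed.

Lemma ip_sqrD f g : L2fun f -> L2fun g ->
  iprod (fun x => f x + g x) (fun x => f x + g x) = iprod f f + 2 * iprod f g + iprod g g.
Proof.
move=> Lf Lg; have Lfg := L2D Lf Lg.
by rewrite ipDl// !ipDr// (ipC g f); ring.
Qed.

Lemma ip_sqrD_le f g : L2fun f -> L2fun g ->
  iprod (fun x => f x + g x) (fun x => f x + g x) <= 2 * iprod f f + 2 * iprod g g.
Proof.
move=> Lf Lg; have := ip_ge0 (fun x => f x - g x).
rewrite ip_sqrB// ip_sqrD//; lra.
Qed.

(** The square norm of s f - t g is nonnegative for all s and t; no division is required when s =
    <g, g> and t = <f, g>. *)
Lemma cauchy_schwarz f g : L2fun f -> L2fun g -> iprod f g ^+ 2 <= iprod f f * iprod g g.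
Proof.
move=> Lf Lg.
have H s t : 0 <= s ^+ 2 * iprod f f - 2 * s * t * iprod f g + t ^+ 2 * iprod g g.
  have := ip_ge0 (fun x => s * f x - t * g x).
  have [Ls Lt] := (L2Z s Lf, L2Z t Lg).
  by rewrite ip_sqrB// !ipZl// !ipZr//; nra.
have [Z|NZ] := eqVneq (iprod g g) 0.
  rewrite Z mulr0; have [->|b0] := eqVneq (iprod f g) 0; first by rewrite expr0n.
  (* If <g, g> = 0 the form is affine in t, and this t makes it equal to -1. *)
  have := H 1 ((iprod f f + 1) / (2 * iprod f g)); rewrite Z.
  rewrite (_ : _ + _ = -1); last by field.
  by rewrite oppr_ge0 ler10.
have := H (iprod g g) (iprod f g); have := ip_ge0 g.
rewrite le_eqVlt eq_sym (negbTE NZ)/= => g0.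
rewrite (_ : _ + _ = iprod g g * (iprod f f * iprod g g - iprod f g ^+ 2)); last ring.
by rewrite pmulr_rge0// subr_ge0.
Qed.

Definition L2lim (f_ : nat -> T -> R) f :=
  iprod (fun x => f_ m x - f x) (fun x => f_ m x - f x) @[m --> \oo] --> 0.

Lemma ip_cvg (f_ g_ : nat -> T -> R) f g :
  (forall m, L2fun (f_ m)) -> L2fun f -> (forall m, L2fun (g_ m)) -> L2fun g ->
  L2lim f_ f -> L2lim g_ g -> iprod (f_ m) (g_ m) @[m --> \oo] --> iprod f g.
Proof.
move=> Lf_ Lf Lg_ Lg cf cg.
have Lfm m : L2fun (fun x => f_ m x - f x) by exact: L2B.
have Lgm m : L2fun (fun x => g_ m x - g x) by exact: L2B.
pose a m := iprod (fun x => f_ m x - f x) (fun x => f_ m x - f x).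
pose b m := iprod (fun x => g_ m x - g x) (fun x => g_ m x - g x).
apply: (@cvg_dist_sqr_le _ (fun m => iprod (f_ m) (g_ m))
  (fun m => 3 * (a m * b m + a m * iprod g g + iprod f f * b m))).
  move=> m.
  (* Bilinear expansion around the limits; Cauchy-Schwarz bounds each of the three terms, and the
     factor 3 comes from (p + q + r)^2 <= 3 (p^2 + q^2 + r^2). *)
  rewrite (_ : _ - _ = iprod (fun x => f_ m x - f x) (fun x => g_ m x - g x) +
    iprod (fun x => f_ m x - f x) g + iprod f (fun x => g_ m x - g x)); last first.
    by rewrite !ipBl// !ipBr//; ring.
  have := cauchy_schwarz (Lfm m) (Lgm m).
  have := cauchy_schwarz (Lfm m) Lg.
  have := cauchy_schwarz Lf (Lgm m).
  rewrite -/(a m) -/(b m).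
  move: (iprod f (fun x => _ - _)) (iprod (fun x => _ - _) g) (iprod (fun x => _ - _) (fun x => _ - _)) => p q r H1 H2 H3.
  have H : (r + q + p) ^+ 2 <= 3 * (r ^+ 2 + q ^+ 2 + p ^+ 2).
    by have := sqr_ge0 (r - q); have := sqr_ge0 (r - p); have := sqr_ge0 (q - p); nra.
  by apply: (le_trans H); lra.
rewrite -(mulr0 3); apply: cvgMl_tmp.
rewrite [X in _ --> X](_ : _ = 0 * 0 + 0 * iprod g g + iprod f f * 0); last by ring.
by apply: cvgD; [apply: cvgD; [exact: cvgM|exact: cvgMr_tmp]|exact: cvgMl_tmp].
Qed.

Lemma L2cvgD (f_ g_ : nat -> T -> R) f g :
  (forall m, L2fun (f_ m)) -> L2fun f -> (forall m, L2fun (g_ m)) -> L2fun g ->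
  L2lim f_ f -> L2lim g_ g -> L2lim (fun m x => f_ m x + g_ m x) (fun x => f x + g x).
Proof.
move=> Lf_ Lf Lg_ Lg cf cg.
apply: (@cvg0_squeeze _ _ (fun m =>
  2 * iprod (fun x => f_ m x - f x) (fun x => f_ m x - f x) +
  2 * iprod (fun x => g_ m x - g x) (fun x => g_ m x - g x))) => [m|]; last first.
  rewrite [X in _ --> X](_ : _ = 2 * 0 + 2 * 0); last by ring.
  by apply: cvgD; exact: cvgMl_tmp.
rewrite ip_ge0/= [leLHS](_ : _ = iprod (fun x => (f_ m x - f x) + (g_ m x - g x))
  (fun x => (f_ m x - f x) + (g_ m x - g x))).
  by apply: ip_sqrD_le; exact: L2B.
by congr iprod; apply/funext => x; ring.
Qed.

Lemma L2cvgZ (f_ : nat -> T -> R) f c : (forall m, L2fun (f_ m)) -> L2fun f ->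
  L2lim f_ f -> L2lim (fun m x => c * f_ m x) (fun x => c * f x).
Proof.
move=> Lf_ Lf cf; rewrite /L2lim -[X in _ --> X](mulr0 (c ^+ 2)).
rewrite (_ : (fun m => iprod _ _) = fun m =>
  c ^+ 2 * iprod (fun x => f_ m x - f x) (fun x => f_ m x - f x)); first exact: cvgMl_tmp.
apply/funext => m; have Lfm : L2fun (fun x => f_ m x - f x) by exact: L2B.
rewrite expr2 -mulrA -ipZr// -ipZl//; last exact: L2Z.
by congr iprod; apply/funext => x; ring.
Qed.

Lemma L2cvgB (f_ g_ : nat -> T -> R) f g :
  (forall m, L2fun (f_ m)) -> L2fun f -> (forall m, L2fun (g_ m)) -> L2fun g ->
  L2lim f_ f -> L2lim g_ g -> L2lim (fun m x => f_ m x - g_ m x) (fun x => f x - g x).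
Proof.
move=> Lf_ Lf Lg_ Lg cf /(L2cvgZ (-1) Lg_ Lg) cg.
have := L2cvgD Lf_ Lf (fun m => L2Z (-1) (Lg_ m)) (L2Z (-1) Lg) cf cg.
rewrite (_ : (fun x => f x + -1 * g x) = fun x => f x - g x); last first.
  by apply/funext => x; rewrite mulN1r.
rewrite (_ : (fun m x => f_ m x + -1 * g_ m x) = fun m x => f_ m x - g_ m x)//.
by apply/funext => m; apply/funext => x; rewrite mulN1r.
Qed.

Lemma L2cvg_cst f : L2lim (fun=> f) f.
Proof.
rewrite /L2lim (_ : (fun=> _) = (fun=> 0)); first exact: cvg_cst.
apply/funext => _; rewrite /iprod; under eq_Rintegral do rewrite subrr mul0r.
by rewrite /Rintegral integral0.
Qed.

Lemma ip_eq0 f : L2fun f -> iprod f f = 0 -> {ae mu, forall x, D x -> f x = 0}.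
Proof.
move=> Lf f0; have mf : measurable_fun D (fun x => (f x ^+ 2)%:E).
  by apply/measurable_EFinP/measurable_funX; case: Lf.
have := (ae_eq_integral_abs mu mD mf).1; case.
  rewrite (eq_integral (fun x => (f x ^+ 2)%:E)) -?ip_integral ?f0// => x _ /=.
  by rewrite ger0_norm ?sqr_ge0.
move=> N [mN N0 sN]; exists N; split=> // x /= nx; apply: sN => /= H; apply: nx.
by move=> Dx; have /= := H Dx; move=> [] /eqP; rewrite sqrf_eq0 => /eqP.
Qed.

End L2fun.

Section L2_sub.
Context d (T : measurableType d) (R : realType).
Variables (mu : {measure set T -> \bar R}) (D : set T).
Hypothesis mD : measurable D.
Implicit Types f g h : T -> R.

Lemma L2S (E : set T) f : measurable E -> E `<=` D -> L2fun mu D f -> L2fun mu E f.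
Proof.
move=> mE ED [mf If]; split; first exact: measurable_funS mf.
exact: integrableS If.
Qed.

Lemma ipS_le (E : set T) f : measurable E -> E `<=` D -> L2fun mu D f ->
  iprod mu E f f <= iprod mu D f f.
Proof.
move=> mE ED Lf; rewrite -lee_fin !ip_integral//; last exact: L2S Lf.
apply: ge0_subset_integral => //; last by move=> x _; rewrite lee_fin sqr_ge0.
by apply/measurable_EFinP/measurable_funX; case: Lf.
Qed.

(** Monotone convergence. It turns bounds on sets that avoid the origin, uniform in the set, into
    square integrability on the whole orthant. *)
Lemma L2_exhaust (F : (set T)^nat) f M : nondecreasing_seq F ->
  (forall j, measurable (F j)) -> D = \bigcup_j F j -> measurable_fun D f ->
  (forall j, L2fun mu (F j) f) -> (forall j, iprod mu (F j) f f <= M) ->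
  L2fun mu D f /\ iprod mu D f f <= M.
Proof.
move=> ndF mF DF mf LF leM.
have cF : (\int[mu]_(x in F i) (f x ^+ 2)%:E @[i --> \oo] -->
    \int[mu]_(x in D) (f x ^+ 2)%:E)%E.
  rewrite DF; apply: ge0_nondecreasing_set_cvg_integral => //.
    by move=> i; apply/measurable_EFinP/measurable_funX; case: (LF i).
  by move=> i x _; rewrite lee_fin sqr_ge0.
have leME : (\int[mu]_(x in D) (f x ^+ 2)%:E <= M%:E)%E.
  apply: (cvge_to_le cF).
  by near=> i; rewrite -ip_integral// lee_fin.
have Lf : L2fun mu D f by apply: L2_fin => //; exact: le_lt_trans leME (ltry _).
by split=> //; rewrite -lee_fin ip_integral.
Unshelve. all: by end_near. Qed.

End L2_sub.

(** * Iterated derivatives *)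

Lemma open_measurable_rV (R : realType) n (U : set 'rV[R]_n) :
  open U -> measurable U.
Proof.
move=> oU.
pose B (p : 'rV[rat]_n * nat) : set 'rV[R]_n :=
  [set y | forall i, ball (ratr (p.1 ord0 i) : R) p.2.+1%:R^-1 (y ord0 i)].
pose F k : set 'rV[R]_n := if unpickle k is Some p then
  (if pselect (B p `<=` U) then B p else set0) else set0.
rewrite (_ : U = \bigcup_k F k).
  apply: bigcupT_measurable => k; rewrite /F; case: unpickle => // p.
  case: pselect => /= _; last exact: measurable0.
  apply: (measurable_box_rV (A := fun i => ball (ratr (p.1 ord0 i) : R) p.2.+1%:R^-1)).
  by move=> i; exact: measurable_ball.
apply/seteqP; split => [x Ux|x [k _]]; last first.
  by rewrite /F; case: unpickle => // p; case: pselect => //= BU Bx; exact: BU.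
have /nbhs_ballP[e /= e0 xeU] : nbhs x U by exact: open_nbhs_nbhs.
have e20 : 0 < e / 2 by rewrite divr_gt0.
have [N _ /(_ N (leqnn N))/= Ne] := near_infty_natSinv_lt (PosNum e20).
have N0 : 0 < N.+1%:R^-1 :> R by rewrite invr_gt0.
have /choice[q qx] (i : 'I_n) : exists q : rat, ball (ratr q : R) N.+1%:R^-1 (x ord0 i).
  have : x ord0 i - N.+1%:R^-1 < x ord0 i + N.+1%:R^-1.
    by rewrite ltrD2l gtrN.
  move=> /rat_in_itvoo[q]; rewrite in_itv/= => /andP[q1 q2]; exists q.
  by rewrite /ball/= ltr_distlC ltrBlDr q2/= -ltrBlDr.
exists (pickle (\row_i q i, N)) => //; rewrite /F pickleK; case: pselect.
  by move=> _ i /=; rewrite mxE; exact: qx.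
case; move=> y By; apply: xeU; split=> // i j; rewrite (ord1 i).
have := qx j; have := By j; rewrite /= mxE => Bj qj.
rewrite (splitr e); apply: (@ball_triangle _ _ (ratr (q j) : R)).
  by apply: ball_sym; apply: le_ball qj; exact: ltW.
by apply: le_ball Bj; exact: ltW.
Qed.

Lemma continuous_measurable_rV (R : realType) n (f : 'rV[R]_n -> R) (D : set 'rV[R]_n) :
  continuous f -> measurable_fun D f.
Proof.
move=> cf; apply: measurable_funTS.
apply: (measurability _ (RGenOpens.measurableE R)) => _ [_ [a [b ->] <-]].
rewrite setTI; apply: open_measurable_rV; move/continuousP: cf; apply.
exact: interval_open.
Qed.

Section derive_line.
Context {R : realType} {V W U : normedModType R}.

(** A directional derivative depends only on the restriction to a line. This moves derivatives
    between R^n, its slices and functions of one real variable. *)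
Lemma derive_line (f : V -> U) (g : W -> U) x v y w :
  (forall h : R, f (h *: v + x) = g (h *: w + y)) -> 'D_v f x = 'D_w g y.
Proof.
move=> fg; rewrite /derive; set d1 := fun h => h^-1 *: _.
set d2 := fun h => h^-1 *: _; suff -> : d1 = d2 by []; apply/funext => h.
rewrite /d1 /d2 /=.
by rewrite fg; have := fg 0; rewrite !scale0r !add0r => ->.
Qed.

Lemma derivable_line (f : V -> U) (g : W -> U) x v y w :
  (forall h : R, f (h *: v + x) = g (h *: w + y)) ->
  derivable f x v -> derivable g y w.
Proof.
move=> fg; rewrite /derivable; set d1 := fun h => h^-1 *: _.
set d2 := fun h => h^-1 *: _; suff -> : d1 = d2 by []; apply/funext => h.
rewrite /d1 /d2 /=.
by rewrite fg; have := fg 0; rewrite !scale0r !add0r => ->.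
Qed.

End derive_line.

(** * Functions of class C^N *)

Section Ck.
Context {R : realType} {n : nat}.
Implicit Types (f g : 'rV[R]_n -> R) (i j : 'I_n).

(** [smooth] quantifies over lists of indices; recursion on the order lets products and quotients be
    treated by induction. *)
Fixpoint Ck (N : nat) f : Prop := continuous f /\
  if N is N'.+1 then forall i, (forall x, derivable f x (delta_mx ord0 i)) /\
    Ck N' (partial i f) else True.

Lemma CkS N f : Ck N.+1 f -> Ck N f.
Proof.
elim: N f => [f [//]|N IHN f [cf Hf]]; split=> // i.
by have [df /IHN] := Hf i.
Qed.

Lemma Ck_continuous N f : Ck N f -> continuous f.
Proof. by case: N => [|N] []. Qed.

Lemma Ck_partial N f i : Ck N.+1 f ->
  (forall x, derivable f x (delta_mx ord0 i)) /\ Ck N (partial i f).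
Proof. by case=> _ /(_ i). Qed.

Lemma smoothCk f : smooth f <-> forall N, Ck N f.
Proof.
split.
  move=> sf N; elim: N f sf => [|N IHN] f sf; have [cf df] := sf [::]; split=> // i.
  split=> [x|]; first exact: df.
  (* [foldr] differentiates first along the last index of the list, so lists are peeled from the
     right. *)
  by apply: IHN => s; have := sf (rcons s i); rewrite foldr_rcons.
move=> Cf s; elim/last_ind: s f Cf => [|s i IHs] f Cf.
  by have [cf df] := Cf 1; split=> // i x; have [+ _] := df i; exact.
rewrite foldr_rcons; apply: IHs => N.
by have [_ /(_ i)[]] := Cf N.+1.
Qed.

Lemma partialD i f g : (forall x, derivable f x (delta_mx ord0 i)) ->
  (forall x, derivable g x (delta_mx ord0 i)) ->
  partial i (fun x => f x + g x) = fun x => partial i f x + partial i g x.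
Proof. by move=> df dg; apply/funext => x; exact: deriveD. Qed.

Lemma partialM i f g : (forall x, derivable f x (delta_mx ord0 i)) ->
  (forall x, derivable g x (delta_mx ord0 i)) ->
  partial i (fun x => f x * g x) = fun x => f x * partial i g x + g x * partial i f x.
Proof. by move=> df dg; apply/funext => x; exact: deriveM. Qed.

Lemma CkD N f g : Ck N f -> Ck N g -> Ck N (fun x => f x + g x).
Proof.
elim: N f g => [|N IHN] f g [cf Hf] [cg Hg].
  by split=> // x; apply: continuousD; [exact: cf|exact: cg].
split=> [x|i]; first by apply: continuousD; [exact: cf|exact: cg].
have [[df Cf] [dg Cg]] := (Hf i, Hg i); split; first by move=> x; exact: derivableD.
by rewrite partialD//; exact: IHN.
Qed.

Lemma CkM N f g : Ck N f -> Ck N g -> Ck N (fun x => f x * g x).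
Proof.
elim: N f g => [|N IHN] f g Cf Cg.
  by split=> // x; apply: continuousM; [exact: Cf.1|exact: Cg.1].
split=> [x|i]; first by apply: continuousM; [exact: Cf.1|exact: Cg.1].
have [[_ /(_ i)[df pf]] [_ /(_ i)[dg pg]]] := (Cf, Cg).
split; first by move=> x; exact: derivableM.
by rewrite partialM//; apply: CkD; apply: IHN => //; exact: CkS.
Qed.

Lemma partial_cst i (c : R) : partial i (fun=> c) = fun=> 0.
Proof. by apply/funext => x; exact: derive_cst. Qed.

Lemma partialZ i (a : R) f : (forall x, derivable f x (delta_mx ord0 i)) ->
  partial i (fun x => a * f x) = fun x => a * partial i f x.
Proof.
move=> df; rewrite (partialM (f := fun=> a) _ df); last by move=> x; exact: derivable_cst.
by rewrite partial_cst; apply/funext => x; rewrite mulr0 addr0.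
Qed.

Lemma Ck_cst N (c : R) : Ck N (fun=> c).
Proof.
elim: N c => [|N IHN] c; split; [exact: cst_continuous|by []|exact: cst_continuous|].
move=> i; split=> [x|]; first exact: derivable_cst.
by rewrite partial_cst.
Qed.

Lemma CkN N f : Ck N f -> Ck N (fun x => - f x).
Proof. by move=> Cf; under eq_fun do rewrite -mulN1r; apply: CkM => //; exact: Ck_cst. Qed.

Lemma CkB N f g : Ck N f -> Ck N g -> Ck N (fun x => f x - g x).
Proof. by move=> Cf Cg; apply: CkD => //; exact: CkN. Qed.

Lemma partialB i f g : (forall x, derivable f x (delta_mx ord0 i)) ->
  (forall x, derivable g x (delta_mx ord0 i)) ->
  partial i (fun x => f x - g x) = fun x => partial i f x - partial i g x.
Proof. by move=> df dg; apply/funext => x; exact: deriveB. Qed.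

Lemma Ck_prod N (I : Type) (r : seq I) (P : pred I) (F : I -> 'rV[R]_n -> R) :
  (forall a, Ck N (F a)) -> Ck N (fun x => \prod_(a <- r | P a) F a x).
Proof.
move=> CF; elim: r => [|a r IHr].
  by under eq_fun do rewrite big_nil; exact: Ck_cst.
by under eq_fun do rewrite big_cons; case: (P a) => //; exact: CkM.
Qed.

End Ck.


Section Ck1.
Context {R : realType}.
Implicit Types p q : R -> R.

Fixpoint Ck1 (N : nat) p : Prop := continuous p /\
  if N is N'.+1 then (forall t, derivable p t 1) /\ Ck1 N' (derive1 p) else True.

Lemma Ck1S N p : Ck1 N.+1 p -> Ck1 N p.
Proof.
elim: N p => [p [//]|N IHN p [cp [dp Cp]]].
by split=> //; split=> //; exact: IHN.
Qed.

Lemma Ck1_cst N (c : R) : Ck1 N (fun=> c).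
Proof.
elim: N c => [|N IHN] c; split; [exact: cst_continuous|by []|exact: cst_continuous|].
split=> [x|]; first exact: derivable_cst.
rewrite (_ : derive1 _ = (fun=> 0 : R))//; apply/funext => x; exact: derive1_cst.
Qed.

Lemma Ck1_id N : Ck1 N (@id R).
Proof.
case: N => [|N]; split=> //; try by move=> x; exact: cvg_id.
split=> [x|]; first exact: derivable_id.
rewrite (_ : derive1 _ = (fun=> 1 : R)); first exact: Ck1_cst.
by apply/funext => x; rewrite derive1E derive_id.
Qed.

Lemma derive1D p q : (forall t, derivable p t 1) -> (forall t, derivable q t 1) ->
  derive1 (fun t => p t + q t) = fun t => (derive1 p) t + (derive1 q) t.
Proof. by move=> dp dq; apply/funext => t; rewrite !derive1E; exact: deriveD. Qed.

Lemma derive1M p q : (forall t, derivable p t 1) -> (forall t, derivable q t 1) ->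
  derive1 (fun t => p t * q t) = fun t => p t * (derive1 q) t + q t * (derive1 p) t.
Proof. by move=> dp dq; apply/funext => t; rewrite !derive1E; exact: deriveM. Qed.

Lemma Ck1D N p q : Ck1 N p -> Ck1 N q -> Ck1 N (fun t => p t + q t).
Proof.
elim: N p q => [|N IHN] p q [cp Hp] [cq Hq].
  by split=> // x; apply: continuousD; [exact: cp|exact: cq].
split=> [x|]; first by apply: continuousD; [exact: cp|exact: cq].
have [[dp Cp] [dq Cq]] := (Hp, Hq); split; first by move=> x; exact: derivableD.
by rewrite derive1D//; exact: IHN.
Qed.

Lemma Ck1M N p q : Ck1 N p -> Ck1 N q -> Ck1 N (fun t => p t * q t).
Proof.
elim: N p q => [|N IHN] p q Cp Cq.
  by split=> // x; apply: continuousM; [exact: Cp.1|exact: Cq.1].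
split=> [x|]; first by apply: continuousM; [exact: Cp.1|exact: Cq.1].
have [[_ [dp pp]] [_ [dq pq]]] := (Cp, Cq).
split; first by move=> x; exact: derivableM.
by rewrite derive1M//; apply: Ck1D; apply: IHN => //; exact: Ck1S.
Qed.

Lemma Ck1_comp N p q : Ck1 N p -> Ck1 N q -> Ck1 N (fun t => p (q t)).
Proof.
elim: N p q => [|N IHN] p q Cp Cq.
  by split=> // x; apply: (@continuous_comp _ _ _ q p); [exact: Cq.1|exact: Cp.1].
split=> [x|].
  by apply: (@continuous_comp _ _ _ q p); [exact: Cq.1|exact: Cp.1].
have [[_ [dp pp]] [_ [dq pq]]] := (Cp, Cq).
split=> [x|].
  apply/derivable1_diffP; apply: (@differentiable_comp _ _ _ _ q p);
    exact/derivable1_diffP.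
rewrite (_ : derive1 _ = fun t => (derive1 p) (q t) * (derive1 q) t).
  by apply: Ck1M => //; apply: IHN => //; exact: Ck1S.
by apply/funext => t; exact: (@derive1_comp _ q p).
Qed.

Lemma Ck1_expR N : Ck1 N (@expR R).
Proof.
elim: N => [|N IHN]; split; try by move=> x; exact: continuous_expR.
- by [].
- split=> [x|]; first exact: derivable_expR.
  rewrite (_ : derive1 _ = expR)//; apply/funext => x.
  by rewrite derive1E derive_val.
Qed.

Lemma Ck1X N p k : Ck1 N p -> Ck1 N (fun t => p t ^+ k).
Proof.
move=> Cp; elim: k => [|k IHk]; first exact: Ck1_cst.
by under eq_fun do rewrite exprS; exact: Ck1M.
Qed.

Lemma derivable_coord n (i j : 'I_n) p (x : 'rV[R]_n) : derivable p (x ord0 i) 1 ->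
  derivable (fun x : 'rV[R]_n => p (x ord0 i)) x (delta_mx ord0 j).
Proof.
have [->|ij] := eqVneq i j => dp.
  apply: derivable_line dp => h.
  by rewrite !mxE !eqxx/= mulr1 [h *: 1]mulr1.
apply: (@derivable_line R R 'rV[R]_n R (cst (p (x ord0 i))) _ (0 : R) (0 : R)) => [h|].
  by rewrite !mxE eqxx/= (negbTE ij) mulr0 add0r.
exact: derivable_cst.
Qed.

Lemma partial_coord n (i j : 'I_n) p :
  partial j (fun x : 'rV[R]_n => p (x ord0 i)) =
  fun x => (i == j)%:R * (derive1 p) (x ord0 i).
Proof.
apply/funext => x; rewrite /partial; have [->|ij] := eqVneq i j.
  rewrite mul1r derive1E; apply: derive_line => h.
  by rewrite !mxE !eqxx/= mulr1 [h *: 1]mulr1.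
rewrite mul0r -(derive_cst (W := R) (p (x ord0 i)) (0 : R) (0 : R)).
apply: derive_line => h.
by rewrite !mxE eqxx/= (negbTE ij) mulr0 add0r.
Qed.

Lemma Ck_coord n N (i : 'I_n) p :
  Ck1 N p -> Ck N (fun x : 'rV[R]_n => p (x ord0 i)).
Proof.
elim: N p => [|N IHN] p Cp.
  split=> // x; apply: (@continuous_comp _ _ _ (fun x : 'rV[R]_n => x ord0 i) p).
    exact: coord_continuous.
  exact: Cp.1.
split=> [x|j].
  apply: (@continuous_comp _ _ _ (fun x : 'rV[R]_n => x ord0 i) p).
    exact: coord_continuous.
  exact: Cp.1.
split=> [x|]; first by apply: derivable_coord; exact: Cp.2.1.
rewrite partial_coord; apply: CkM; first exact: Ck_cst.
by apply: IHN; exact: Cp.2.2.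
Qed.

End Ck1.

(** * Integration on R^n *)

Section support.
Context {R : realType} {n : nat}.
Implicit Types (f g G : 'rV[R]_n -> R) (K : set 'rV[R]_n).

Lemma partial_off K i f : closed K -> (forall x, ~ K x -> f x = 0) ->
  forall x, ~ K x -> partial i f x = 0.
Proof.
move=> cK f0 x nKx; rewrite /partial.
rewrite (@near_eq_derive _ _ _ f (cst 0)) ?derive_cst//.
near=> y; apply: f0; near: y.
by apply: open_nbhs_nbhs; split=> //; exact: closed_openC.
Unshelve. all: by end_near. Qed.

(** Off K, which is closed, the quotient is locally 0; on K the quotient rule applies. The
    derivative is a sum of two quotients whose numerators again vanish off K, over G and over G^2,
    and the induction is on the order for arbitrary numerators and denominators. *)
Lemma Ck_div N K f G : closed K -> (forall x, ~ K x -> f x = 0) ->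
  (forall x, K x -> G x != 0) -> Ck N f -> Ck N G -> Ck N (fun x => f x / G x).
Proof.
move=> cK.
have near0 g H x : (forall x, ~ K x -> g x = 0) -> ~ K x ->
    \forall y \near x, (cst 0 : _ -> R) y = g y / H y.
  move=> g0 nKx; near=> y; rewrite g0 ?mul0r//; near: y.
  by apply: open_nbhs_nbhs; split=> //; exact: closed_openC.
elim: N f G => [|N IHN] f G f0 G0 Cf CG.
  split=> // x; have [Kx|nKx] := pselect (K x).
    apply: (@continuousM _ _ f (fun y => (G y)^-1) x); first exact: Cf.1.
    by apply: continuousV; [exact: G0|exact: CG.1].
  rewrite /continuous_at f0// mul0r.
  exact: cvg_trans (near_eq_cvg (near0 f G x f0 nKx)) (@cst_continuous _ _ (0 : R) x).
have /Ck_continuous cfG := IHN f G f0 G0 (CkS Cf) (CkS CG).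
split=> // i; have [[_ /(_ i)[df Cdf]] [_ /(_ i)[dG CdG]]] := (Cf, CG).
split=> [x|].
  have [Kx|nKx] := pselect (K x).
    by apply: derivableM => //; apply: derivableV => //; exact: G0.
  by apply: near_eq_derivable (near0 f G x f0 nKx) _; exact: derivable_cst.
rewrite (_ : partial i _ = fun x => partial i f x / G x
    + (- (f x * partial i G x)) / (G x * G x)).
  have [CfN CGN] := (CkS Cf, CkS CG).
  apply: CkD; apply: IHN.
  - exact: partial_off cK f0.
  - exact: G0.
  - exact: Cdf.
  - exact: CGN.
  - by move=> x nKx; rewrite f0// mul0r oppr0.
  - by move=> x Kx; rewrite mulf_neq0// G0.
  - exact: CkN (CkM CfN CdG).
  - exact: (CkM CGN CGN).
apply/funext => x; have [Kx|nKx] := pselect (K x).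
  rewrite /partial (@deriveM _ _ f (fun x => (G x)^-1))//; last first.
    by apply: derivableV => //; exact: G0.
  rewrite deriveV//; last exact: G0.
  have := G0 _ Kx; rewrite /GRing.scale/=; set Gx := G x => Gx0.
  by field.
rewrite (partial_off i cK)//; last by move=> y nKy; rewrite f0// mul0r.
by rewrite f0// (partial_off i cK f0)// !mul0r oppr0 mul0r addr0.
Unshelve. all: by end_near. Qed.

End support.

(** * Tonelli and Fubini theorems splitting off the first coordinate *)

Section fubini_rV.
Context {R : realType} {n : nat}.
Local Notation mu := (@lebesgue_measure R).
Local Notation muS := (lebesgue_rV R n.+1).
Implicit Types (h : 'rV[R]_n.+1 -> \bar R).
Local Open Scope ereal_scope.

(* [lebesgue_measure] lives on [measurableTypeR R], whose measurable sets are
   those of [R] but whose display differs. *)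
Let mcons : @measurable_fun _ _ (measurableTypeR R * 'rV[R]_n)%type _ setT
  (@cons_rV R n) := @measurable_cons_rV R n.

Let mcomp h : measurable_fun setT h ->
  @measurable_fun _ _ (measurableTypeR R * 'rV[R]_n)%type _ setT (h \o @cons_rV R n).
Proof. by move=> mh; apply: measurableT_comp => //; exact: mcons. Qed.

Lemma ge0_integral_rVS h : measurable_fun setT h -> (forall x, 0 <= h x) ->
  \int[muS]_x h x = \int[mu]_s \int[lebesgue_rV R n]_p h (cons_rV (s, p)).
Proof.
move=> mh h0.
transitivity (\int[mu \x lebesgue_rV R n]_z h (cons_rV z)).
  have /= -> := ge0_integral_pushforward mcons (mu \x lebesgue_rV R n)%E
    measurableT mh (fun x _ => h0 x).
  by rewrite preimage_setT.
exact: (@fubini_tonelli1 _ _ (measurableTypeR R) 'rV[R]_n R mu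
  (lebesgue_rV R n) (h \o cons_rV) (mcomp mh) (fun x => h0 _)).
Qed.

Lemma ge0_integral_rVSC h : measurable_fun setT h -> (forall x, 0 <= h x) ->
  \int[muS]_x h x = \int[lebesgue_rV R n]_p \int[mu]_s h (cons_rV (s, p)).
Proof.
move=> mh h0; rewrite ge0_integral_rVS//.
exact: (@fubini_tonelli _ _ (measurableTypeR R) 'rV[R]_n R mu
  (lebesgue_rV R n) (h \o cons_rV) (mcomp mh) (fun x => h0 _)).
Qed.

Lemma integrable_cons_rV h : muS.-integrable setT h ->
  (mu \x lebesgue_rV R n).-integrable setT (h \o cons_rV).
Proof.
move=> /integrableP[mh ih]; apply/integrableP; split.
  exact: (mcomp mh).
have mah : measurable_fun setT (fun x => `|h x|) by exact: measurableT_comp.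
have := ge0_integral_pushforward mcons (mu \x lebesgue_rV R n)%E
  measurableT mah (fun x _ => abse_ge0 (h x)).
by rewrite preimage_setT => /= <-.
Qed.

Lemma integral_rVS h : muS.-integrable setT h ->
  \int[muS]_x h x = \int[mu]_s \int[lebesgue_rV R n]_p h (cons_rV (s, p)).
Proof.
move=> ih; have ic := integrable_cons_rV ih; have /integrableP[mh _] := ih.
have /= -> := integral_pushforward mcons mh ic measurableT.
rewrite preimage_setT.
by rewrite -(@integral12_prod_meas1 _ _ (measurableTypeR R) 'rV[R]_n R mu
  (lebesgue_rV R n) (h \o cons_rV)).
Qed.

Lemma integral_rVSC h : muS.-integrable setT h ->
  \int[muS]_x h x = \int[lebesgue_rV R n]_p \int[mu]_s h (cons_rV (s, p)).
Proof.
move=> ih; rewrite integral_rVS//.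
by apply: (@Fubini _ _ (measurableTypeR R) 'rV[R]_n R mu
  (lebesgue_rV R n) (h \o cons_rV)) => //; exact: integrable_cons_rV.
Qed.

End fubini_rV.

Section cbox.
Context {R : realType} {n : nat}.
Implicit Types (l r : 'I_n -> R).

Definition cbox l r : set 'rV[R]_n :=
  [set x | forall i, `[l i, r i]%classic (x ord0 i)].

Lemma compact_cbox l r : compact (cbox l r).
Proof.
by apply: (@rV_compact R n (fun i => `[l i, r i]%classic)) => i; exact: segment_compact.
Qed.

Lemma measurable_cbox l r : measurable (cbox l r).
Proof. exact: (measurable_box_rV (A := fun i => `[l i, r i]%classic)). Qed.

Lemma cbox_prod l r :
  lebesgue_rV R n (cbox l r) = (\prod_i lebesgue_measure `[l i, r i])%E.
Proof. exact: (lebesgue_rV_box (A := fun i => `[l i, r i]%classic)). Qed.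

Lemma cbox_fin l r : (lebesgue_rV R n (cbox l r) < +oo)%E.
Proof.
rewrite cbox_prod -ge0_fin_numE ?prode_ge0// prode_fin_num// => i _.
by rewrite lebesgue_measure_itv/=; case: ifP.
Qed.

Lemma cbox_gt0 l r : (forall i, l i < r i) -> (0 < lebesgue_rV R n (cbox l r))%E.
Proof.
move=> lr; rewrite cbox_prod; elim/big_ind : _ => [|x y x0 y0|i _].
- exact: lte01.
- exact: mule_gt0.
- by rewrite lebesgue_measure_itv/= lte_fin lr -EFinB lte_fin subr_gt0.
Qed.

Lemma compact_sub_cbox (K : set 'rV[R]_n) : compact K ->
  exists M, K `<=` cbox (fun=> - M) (fun=> M).
Proof.
move=> /compact_bounded[M [_ /(_ (`|M| + 1))]].
rewrite ltr_pwDr ?ler_norm// => /(_ isT) KM; exists (`|M| + 1) => x Kx i.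
rewrite /= in_itv/= -ler_norml; apply: le_trans (KM _ Kx).
rewrite /Num.Def.normr/= mx_normrE.
by apply: (le_trans _ (le_bigmax _ _ (ord0, i))).
Qed.

Lemma cs_integrable (K : set 'rV[R]_n) (f : 'rV[R]_n -> R) : compact K ->
  (forall x, ~ K x -> f x = 0) -> continuous f ->
  (lebesgue_rV R n).-integrable setT (EFin \o f).
Proof.
move=> /compact_sub_cbox[M KM] f0 cf; set B := cbox _ _ in KM.
rewrite (_ : EFin \o f = (EFin \o f) \_ B); last first.
  apply/funext => x; rewrite patchE; case: ifPn => //; rewrite notin_setE => nBx.
  by rewrite /= f0// => /KM.
apply: (iffLR (integrable_mkcond _ (measurable_cbox _ _))).
apply: measurable_bounded_integrable.
- exact (measurable_cbox _ _).
- exact: cbox_fin.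
- exact: continuous_measurable_rV.
have /compact_bounded[N [_ Nf]] : compact (f @` B).
  by apply: continuous_compact; [exact: continuous_subspaceT|exact: compact_cbox].
exists N; split; first exact: num_real.
by move=> y Ny x Bx; apply: Nf => //; exists x.
Qed.

End cbox.

Section cons_slice.
Context {R : realType} {n : nat}.
Implicit Types (g : 'rV[R]_n.+1 -> R).

Lemma cons_rV_lift s (p : 'rV[R]_n) j : cons_rV (s, p) ord0 (lift ord0 j) = p ord0 j.
Proof. by rewrite mxE liftK. Qed.

Lemma cons_rV0 s (p : 'rV[R]_n) : cons_rV (s, p) ord0 ord0 = s.
Proof. by rewrite mxE unlift_none. Qed.

Lemma cons_line_lift h s (p : 'rV[R]_n) j :
  h *: delta_mx ord0 (lift ord0 j) + cons_rV (s, p) =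
  cons_rV (s, h *: delta_mx ord0 j + p).
Proof.
apply/rowP => k; rewrite !mxE; case: unliftP => [k'|] -> /=.
  by rewrite (inj_eq lift_inj) !mxE.
by rewrite mulr0 add0r.
Qed.

Lemma cons_line0 h s (p : 'rV[R]_n) :
  h *: delta_mx ord0 ord0 + cons_rV (s, p) = cons_rV (h *: 1 + s, p).
Proof.
apply/rowP => k; rewrite !mxE; case: unliftP => [k'|] -> /=.
  by rewrite mulr0 add0r.
by [].
Qed.

Lemma continuous_cons_r s : continuous (fun p : 'rV[R]_n => cons_rV (s, p)).
Proof.
move=> p A /nbhs_ballP[e /= e0 eA]; apply/nbhs_ballP; exists e => //= q [_ pq].
apply: eA; split=> // i j; rewrite !(ord1 i) !mxE.
by case: unliftP => [k|] _ /=; [exact: pq|exact: ballxx].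
Qed.

Lemma continuous_cons_l (p : 'rV[R]_n) : continuous (fun s : R => cons_rV (s, p)).
Proof.
move=> s A /nbhs_ballP[e /= e0 eA]; apply/nbhs_ballP; exists e => //= t st.
apply: eA; split=> // i j; rewrite !(ord1 i) !mxE.
by case: unliftP => [k|] _ //=; exact: ballxx.
Qed.

Lemma partial_cons g s j :
  partial j (fun p => g (cons_rV (s, p))) = fun p => partial (lift ord0 j) g (cons_rV (s, p)).
Proof.
by apply/funext => p; apply: derive_line => h; rewrite cons_line_lift.
Qed.

Lemma derive1_cons g (p : 'rV[R]_n) :
  derive1 (fun s => g (cons_rV (s, p))) = fun s => partial ord0 g (cons_rV (s, p)).
Proof.
by apply/funext => s; rewrite derive1E; apply: derive_line => h; rewrite cons_line0.
Qed.

Lemma derivable_cons_r g s (p : 'rV[R]_n) j :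
  derivable g (cons_rV (s, p)) (delta_mx ord0 (lift ord0 j)) ->
  derivable (fun p => g (cons_rV (s, p))) p (delta_mx ord0 j).
Proof. by apply: derivable_line => h; rewrite cons_line_lift. Qed.

Lemma derivable_cons_l g s (p : 'rV[R]_n) :
  derivable g (cons_rV (s, p)) (delta_mx ord0 ord0) ->
  derivable (fun s => g (cons_rV (s, p))) s 1.
Proof. by apply: derivable_line => h; rewrite cons_line0. Qed.

End cons_slice.

(** * The integral of a derivative of a compactly supported function *)

Section integral_partial.
Context {R : realType}.
Local Notation mu := (@lebesgue_measure R).

Lemma FTC2 (p : R -> R) a b : (forall t, derivable p t 1) -> continuous (derive1 p) ->
  a < b -> (\int[mu]_(t in `[a, b]) (derive1 p t)%:E = (p b - p a)%:E)%E.
Proof.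
move=> dp cp ab.
have cpp : continuous p.
  by move=> t; apply/differentiable_continuous/derivable1_diffP.
rewrite EFinB; apply: (@continuous_FTC2 R (derive1 p) p a b ab).
- exact: continuous_subspaceT.
- split=> [t _| |]; first exact: dp.
    by apply: cvg_at_right_filter; exact: cpp.
  by apply: cvg_at_left_filter; exact: cpp.
- by [].
Qed.

Lemma integral_derive1_eq0 (p : R -> R) (M : R) : (forall t, derivable p t 1) ->
  continuous (derive1 p) -> (forall t, M < `|t| -> p t = 0) ->
  (\int[mu]_t (derive1 p t)%:E = 0)%E.
Proof.
(* M may be negative; N exceeds both M and 0, so that p vanishes at both ends of [- N, N]. *)
move=> dp cp p0; pose N := `|M| + 1.
have MN : M < N by rewrite ltr_pwDr ?ler_norm.
have N0 : 0 < N by rewrite /N; have := normr_ge0 M; lra.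
transitivity (\int[mu]_(t in `[(- N)%R, N]) (derive1 p t)%:E)%E.
  rewrite [RHS]integral_mkcond; apply: eq_integral => t _; rewrite patchE.
  case: ifPn => //; rewrite notin_setE/= in_itv/= -ler_norml => /negP.
  rewrite -ltNge => Nt; congr EFin; rewrite derive1E.
  rewrite (@near_eq_derive _ _ _ p (cst 0)) ?derive_cst//.
  near=> s; apply: p0; apply: lt_trans MN _.
  by near: s; apply: (cvgr_gt `|t|) => //; exact: cvg_norm.
rewrite FTC2//; last by lra.
by rewrite !p0 ?subrr ?normrN// gtr0_norm.
Unshelve. all: by end_near. Qed.

(** By Fubini, with the order chosen by i: along the first coordinate the inner integral is
    one-dimensional and vanishes; along another coordinate the first one is frozen and the induction
    hypothesis applies to the slice. *)
Lemma integral_partial_eq0 n i (g : 'rV[R]_n -> R) (M : R) :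
  (forall x, derivable g x (delta_mx ord0 i)) -> continuous (partial i g) ->
  (forall x : 'rV[R]_n, (exists j, M < `|x ord0 j|) -> g x = 0) ->
  (\int[lebesgue_rV R n]_x (partial i g x)%:E = 0)%E.
Proof.
elim: n i g => [[]//|n IHn] i g dg cg g0.
have ig : (lebesgue_rV R n.+1).-integrable setT (EFin \o partial i g).
  apply: (@cs_integrable _ _ (cbox (fun=> - M) (fun=> M))) => //.
    exact: compact_cbox.
  apply: partial_off.
    by apply: compact_closed; [exact: norm_hausdorff|exact: compact_cbox].
  move=> x /existsNP[j]; rewrite /= in_itv/= -ler_norml => /negP.
  by rewrite -ltNge => Mj; apply: g0; exists j.
case: (unliftP ord0 i) => [j|] ij.
  rewrite (integral_rVS ig)/=; rewrite integral0_eq// => s _.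
  rewrite -[RHS](IHn j (fun p => g (cons_rV (s, p)))).
  - by rewrite partial_cons ij.
  - by move=> p; apply: derivable_cons_r; rewrite -ij.
  - rewrite partial_cons => p.
    apply: (@continuous_comp _ _ _ (fun p => cons_rV (s, p)) (partial (lift ord0 j) g)).
      exact: continuous_cons_r.
    by rewrite -ij; exact: cg.
  - move=> p [k Mk]; apply: g0; exists (lift ord0 k).
    by rewrite cons_rV_lift.
rewrite (integral_rVSC ig)/=; rewrite integral0_eq// => p _.
rewrite -[RHS](@integral_derive1_eq0 (fun s => g (cons_rV (s, p))) M).
- by rewrite derive1_cons ij.
- by move=> s; apply: derivable_cons_l; rewrite -ij.
- rewrite derive1_cons => s.
  apply: (@continuous_comp _ _ _ (fun s => cons_rV (s, p)) (partial ord0 g)).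
    exact: continuous_cons_l.
  by rewrite -ij; exact: cg.
- by move=> s Ms; apply: g0; exists ord0; rewrite cons_rV0.
Qed.

End integral_partial.

(** * Tensor products *)

Section tensor.
Context {R : realType} {n : nat}.
Implicit Types (p : 'I_n -> R -> R) (i : 'I_n) (x : 'rV[R]_n).

Definition tensor p x : R := \prod_i p i (x ord0 i).

Definition tensor_deriv i p : 'I_n -> R -> R :=
  fun j => if j == i then derive1 (p j) else p j.

Lemma Ck_tensor N p : (forall i, Ck1 N (p i)) -> Ck N (tensor p).
Proof. by move=> Cp; apply: Ck_prod => i; exact: Ck_coord. Qed.

Lemma partial_tensor i p : (forall t, derivable (p i) t 1) ->
  partial i (tensor p) = tensor (tensor_deriv i p).
Proof.
move=> dp; apply/funext => x; rewrite /tensor (bigD1 i)//= /tensor_deriv eqxx.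
set c := \prod_(j | j != i) _.
have Ec : c = \prod_(j | j != i) p j (x ord0 j).
  by apply: eq_bigr => j /negbTE ->.
rewrite /partial (@derive_line _ _ _ _ _ (fun t => p i t * c) x _ (x ord0 i) 1).
  by rewrite (@deriveMr _ _ (p i))// derive1E mulrC.
move=> h; rewrite (bigD1 i)//= !mxE !eqxx/= mulr1; congr (_ * _).
  by rewrite [h *: 1]mulr1.
rewrite Ec; apply: eq_bigr => j ji.
by rewrite !mxE eqxx (negbTE ji)/= mulr0 add0r.
Qed.

End tensor.

(** * Derivatives of the extremizer *)

Section extremizer.
Context {R : realType} {n : nat} (k : nat).
Implicit Types (i : 'I_n) (b t : R).

Definition extr1 b i t : R := (if (n - k <= i)%N then t else 1) * expR (- b * t ^+ 2).

Lemma extremizerE al b : @extremizer R n k al b = fun x => al * tensor (extr1 b) x.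
Proof.
apply/funext => x; rewrite /extremizer /tensor /extr1 big_split/= -big_mkcond/=.
rewrite -expR_sum -mulr_sumr -/(sqnorm x); ring.
Qed.

Lemma Ck1_gauss N b : Ck1 N (fun t : R => expR (- b * t ^+ 2)).
Proof.
apply: (@Ck1_comp _ _ expR); first exact: Ck1_expR.
by apply: Ck1M; [exact: Ck1_cst|apply: Ck1X; exact: Ck1_id].
Qed.

Lemma Ck1_extr1 N b i : Ck1 N (extr1 b i).
Proof.
rewrite /extr1; apply: Ck1M; last exact: Ck1_gauss.
by case: (n - k <= i)%N; [exact: Ck1_id|exact: Ck1_cst].
Qed.

Lemma is_derive_gauss b t :
  is_derive t 1 (fun t : R => expR (- b * t ^+ 2)) (- 2 * b * t * expR (- b * t ^+ 2)).
Proof.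
have dq : is_derive t 1 (fun t : R => - b * t ^+ 2) (- b * (2 * t)).
  have := is_deriveZ (- b) (is_deriveX 2 (is_derive_id t (1 : R))).
  by rewrite /GRing.scale/= expr1 mulr1.
have H := @is_derive1_comp _ expR (fun t => - b * t ^+ 2) _ _ _
  (is_derive_expR (- b * t ^+ 2)) dq.
by refine (eq_rect _ (is_derive t 1 _) H _ _); ring.
Qed.

Lemma derive1_gauss b :
  derive1 (fun t : R => expR (- b * t ^+ 2)) = fun t => (- 2 * b * t) * expR (- b * t ^+ 2).
Proof. by apply/funext => t; rewrite derive1E; have [_ ->] := is_derive_gauss b t. Qed.

Lemma Ck1_derivable N (p : R -> R) : Ck1 N.+1 p -> forall t, derivable p t 1.
Proof. by move=> [_ []]. Qed.

Lemma derive1_mul_gauss (p : R -> R) b : (forall t, derivable p t 1) ->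
  derive1 (fun t => p t * expR (- b * t ^+ 2)) =
  fun t => (derive1 p t - 2 * b * t * p t) * expR (- b * t ^+ 2).
Proof.
move=> dp; rewrite (derive1M (q := fun t => expR (- b * t ^+ 2))); last 2 first.
- exact: dp.
- exact (Ck1_derivable (Ck1_gauss 1 b)).
by rewrite derive1_gauss; apply/funext => t; ring.
Qed.

Lemma Ck1_quad N (c0 c1 c2 : R) : Ck1 N (fun t : R => c0 + c1 * t + c2 * t ^+ 2).
Proof.
exact: (Ck1D (Ck1D (Ck1_cst _ _) (Ck1M (Ck1_cst _ _) (Ck1_id _)))
  (Ck1M (Ck1_cst _ _) (Ck1X 2 (Ck1_id _)))).
Qed.

Lemma derive1_quad (c0 c1 c2 : R) :
  derive1 (fun t : R => c0 + c1 * t + c2 * t ^+ 2) = fun t => c1 + 2 * c2 * t.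
Proof.
apply/funext => t; rewrite derive1E.
have d1 := is_deriveZ c1 (is_derive_id t (1 : R)).
have d2 := is_deriveZ c2 (is_deriveX 2 (is_derive_id t (1 : R))).
have [_] := is_deriveD (is_deriveD (is_derive_cst c0 t (1 : R)) d1) d2.
by rewrite /GRing.scale/= => ->; rewrite expr1; ring.
Qed.

(** Differentiation maps p(t) exp(- b t^2) to (p' - 2 b t p) exp(- b t^2). The formula [Q] for
    quadratic p is used twice, as the first derivative is again a quadratic times the Gaussian. The
    constant is - 2 b on a full-line factor and - 6 b on a half-line factor. *)
Lemma derive2_extr1 b i : derive1 (derive1 (extr1 b i)) =
  fun t => (4 * b ^+ 2 * t ^+ 2 - 2 * b - 4 * b * (n - k <= i)%N%:R) * extr1 b i t.
Proof.
have Q c0 c1 c2 : derive1 (fun t : R => (c0 + c1 * t + c2 * t ^+ 2) * expR (- b * t ^+ 2)) =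
    fun t => (c1 + 2 * c2 * t - 2 * b * t * (c0 + c1 * t + c2 * t ^+ 2)) * expR (- b * t ^+ 2).
  by rewrite derive1_mul_gauss ?derive1_quad//; exact: (Ck1_derivable (Ck1_quad 1 c0 c1 c2)).
rewrite /extr1; case: (n - k <= i)%N.
  rewrite (_ : (fun t => t * expR (- b * t ^+ 2)) = fun t : R => (0 + 1 * t + 0 * t ^+ 2) * expR (- b * t ^+ 2)); last first.
    by apply/funext => t; ring.
  rewrite Q (_ : (fun t => (1 + 2 * 0 * t - 2 * b * t * (0 + 1 * t + 0 * t ^+ 2)) * expR (- b * t ^+ 2)) =
    fun t : R => (1 + 0 * t + (- (2 * b)) * t ^+ 2) * expR (- b * t ^+ 2)); last first.
    by apply/funext => t; ring.
  by rewrite Q; apply/funext => t /=; ring.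
rewrite (_ : (fun t => 1 * expR (- b * t ^+ 2)) = fun t : R => (1 + 0 * t + 0 * t ^+ 2) * expR (- b * t ^+ 2)); last first.
  by apply/funext => t; ring.
rewrite Q (_ : (fun t => (0 + 2 * 0 * t - 2 * b * t * (1 + 0 * t + 0 * t ^+ 2)) * expR (- b * t ^+ 2)) =
  fun t : R => (0 + (- (2 * b)) * t + 0 * t ^+ 2) * expR (- b * t ^+ 2)); last first.
  by apply/funext => t; ring.
by rewrite Q; apply/funext => t /=; ring.
Qed.

Definition extr b : 'rV[R]_n -> R := tensor (extr1 b).

Lemma Ck_extr N b : Ck N (extr b).
Proof. by apply: Ck_tensor => i; exact: Ck1_extr1. Qed.

Lemma extr_gt0 b x : orthant k x -> 0 < extr b x.
Proof.
move=> Ox; apply: prodr_gt0 => i _; rewrite mulr_gt0 ?expR_gt0//.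
by case: ifP => // /Ox.
Qed.

Lemma partial2_extr b i : partial i (partial i (extr b)) = fun x =>
  (4 * b ^+ 2 * x ord0 i ^+ 2 - 2 * b - 4 * b * (n - k <= i)%N%:R) * extr b x.
Proof.
have d1 t : derivable (extr1 b i) t 1 by have [_ []] := Ck1_extr1 1 b i.
rewrite partial_tensor// partial_tensor; last first.
  by move=> t; rewrite /tensor_deriv eqxx; have [_ [_ [_ []]]] := Ck1_extr1 2 b i.
apply/funext => x; rewrite /extr /tensor (bigD1 i)//= [in RHS](bigD1 i)//= mulrA.
congr (_ * _); first by rewrite /tensor_deriv !eqxx derive2_extr1.
by apply: eq_bigr => j /negbTE ji; rewrite /tensor_deriv ji.
Qed.

Lemma sum_orthant_index : (k <= n)%N -> \sum_(i < n) (n - k <= i)%N%:R = k%:R :> R.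
Proof.
move=> kn; rewrite -natr_sum; congr (_%:R).
rewrite -(big_mkord xpredT (fun j => nat_of_bool (n - k <= j)%N)).
rewrite (@big_cat_nat _ _ _ (n - k)) ?leq_subr//=.
rewrite big_nat big1 => [|i /andP[_ ]]; last by rewrite ltnNge => /negbTE ->.
rewrite add0n big_nat (eq_bigr (fun=> 1%N)) => [|i /andP[-> _]//].
by rewrite -big_nat sum_nat_const_nat muln1 subKn.
Qed.

End extremizer.

(** * The ground state substitution *)

Section orthant.
Context {R : realType} {n : nat} (k : nat).
Local Notation Om := (@orthant R n k).
Local Notation mu := (lebesgue_rV R n).
Local Notation ip := (iprod mu Om).
Local Notation L2 := (L2fun mu Om).
Implicit Types (f g : 'rV[R]_n -> R) (K : set 'rV[R]_n) (i : 'I_n) (x : 'rV[R]_n).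

Let mOm : measurable Om := measurable_orthant k.

(** K is any compact set off which f vanishes, not the support itself, so that derivatives and
    products keep the same K. *)
Definition csupp K f := [/\ compact K, K `<=` Om & forall x, ~ K x -> f x = 0].

Lemma csupp_closed K f : csupp K f -> closed K.
Proof. by case=> cK _ _; apply: compact_closed => //; exact: norm_hausdorff. Qed.

Lemma csupp_partial K f i : csupp K f -> csupp K (partial i f).
Proof.
move=> sf; have clK := csupp_closed sf; case: sf => cK KO f0.
by split=> //; exact: partial_off.
Qed.

Lemma csuppMl K f g : csupp K f -> csupp K (fun x => f x * g x).
Proof. by case=> cK KO f0; split=> // x /f0 ->; rewrite mul0r. Qed.

Lemma csuppMr K f g : csupp K f -> csupp K (fun x => g x * f x).
Proof. by case=> cK KO f0; split=> // x /f0 ->; rewrite mulr0. Qed.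

Lemma csuppU K K' f f' : csupp K f -> csupp K' f' ->
  csupp (K `|` K') f /\ csupp (K `|` K') f'.
Proof.
move=> [cK KO f0] [cK' KO' f0']; have cKK : compact (K `|` K') by exact: compactU.
have KKO : K `|` K' `<=` Om by move=> x [/KO|/KO'].
by split; split=> // x /not_orP[nK nK']; [exact: f0|exact: f0'].
Qed.

Lemma csupp_integrable K f : csupp K f -> continuous f -> mu.-integrable Om (EFin \o f).
Proof.
move=> [cK KO f0] cf; apply: (@integrableS _ _ _ _ setT) => //.
exact: cs_integrable cK f0 cf.
Qed.

Lemma csupp_L2 K f : csupp K f -> continuous f -> L2 f.
Proof.
move=> sf cf; split; first exact: continuous_measurable_rV.
apply: (@csupp_integrable K); first exact: csuppMl.
by move=> x; apply: continuousM; exact: cf.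
Qed.

Lemma Rintegral_partial_eq0 K f i : csupp K f -> Ck 1 f ->
  (\int[mu]_(x in Om) partial i f x)%R = 0.
Proof.
move=> sf Cf; have [df Cdf] := Ck_partial i Cf.
have [cK KO f0] := sf; have [_ _ pf0] := csupp_partial i sf.
have [M KM] := compact_sub_cbox cK.
rewrite /Rintegral (_ : \int[mu]_(x in Om) _ = 0)%E//.
rewrite -[RHS](@integral_partial_eq0 R n i f M df)//.
- rewrite integral_mkcond; apply: eq_integral => x _; rewrite patchE.
  by case: ifPn => //; rewrite notin_setE => nO; rewrite pf0// => /KO.
- exact: Ck_continuous Cdf.
- move=> x [j Mj]; apply: f0 => /KM /(_ j); rewrite /= in_itv/= -ler_norml.
  by move=> /(lt_le_trans Mj); rewrite ltxx.
Qed.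

(** The integral of the i-th derivative of f g vanishes. Only f has compact support, so that g may
    be an extremizer. *)
Lemma ip_partial K f g i : csupp K f -> Ck 1 f -> Ck 1 g ->
  ip (partial i f) g = - ip f (partial i g).
Proof.
move=> sf Cf Cg; have [df /Ck_continuous Cdf] := Ck_partial i Cf.
have [dg /Ck_continuous Cdg] := Ck_partial i Cg.
have := Rintegral_partial_eq0 i (csuppMl g sf) (CkM Cf Cg).
rewrite partialM// RintegralD//; last 2 first.
- apply: (@csupp_integrable K); first exact: csuppMl.
  by move=> x; apply: continuousM; [exact: Ck_continuous Cf _|exact: Cdg].
- apply: (@csupp_integrable K); first exact/csuppMr/csupp_partial.
  by move=> x; apply: continuousM; [exact: Ck_continuous Cg _|exact: Cdf].
rewrite addrC => /eqP; rewrite addr_eq0 => /eqP <-.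
by apply: eq_Rintegral => x _; rewrite mulrC.
Qed.

Definition test f := exists2 K, csupp K f & forall N, Ck N f.

Lemma test_function_test f : test_function k f -> test f.
Proof.
move=> [sf cK KO]; exists (closure [set x | f x != 0]); last exact/smoothCk.
split=> // x nK; apply/eqP/negP => f0; apply: nK; apply: subset_closure.
exact/negP.
Qed.

Lemma testB f g : test f -> test g -> test (fun x => f x - g x).
Proof.
move=> [K sf Cf] [K' sg Cg]; have [[cK KO f0] [_ _ g0]] := csuppU sf sg.
exists (K `|` K'); last by move=> N; exact: CkB.
by split=> // x nK; rewrite f0// g0// subr0.
Qed.

Lemma test_L2 f : test f -> L2 f.
Proof. by move=> [K sf Cf]; apply: csupp_L2 sf _; exact: Ck_continuous (Cf 0). Qed.

Lemma test_partial f i : test f -> test (partial i f).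
Proof.
move=> [K sf Cf]; exists K; first exact: csupp_partial.
by move=> N; have [] := Ck_partial i (Cf N.+1).
Qed.

Lemma Ck_coord_id N i : Ck N (fun x : 'rV[R]_n => x ord0 i).
Proof. exact: (Ck_coord i (Ck1_id N)). Qed.

Lemma test_coord f i : test f -> test (fun x => x ord0 i * f x).
Proof.
move=> [K sf Cf]; exists K; first exact: csuppMr.
by move=> N; apply: CkM => //; exact: Ck_coord_id.
Qed.

(* The pointwise identity behind this is
   (d_i f)^2 = G^2 (d_i g)^2 + d_i (g^2 G d_i G) - g^2 G d_i^2 G, with f = g G. *)
Lemma ip_partial_ground f b i : test f ->
  ip (partial i f) (partial i f) =
  ip (fun x => extr k b x * partial i (fun x => f x / extr k b x) x)
     (fun x => extr k b x * partial i (fun x => f x / extr k b x) x)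
  - (4 * b ^+ 2 * ip (fun x => x ord0 i * f x) (fun x => x ord0 i * f x)
     - (2 * b + 4 * b * (n - k <= i)%N%:R) * ip f f).
Proof.
move=> tf; have [K sf Cf] := tf; have [cK KO f0] := sf.
set G := extr k b; set g := fun x => f x / G x; set c := 2 * b + _.
have CG N : Ck N G := Ck_extr k N b.
have G0 x : K x -> G x != 0 by move=> /KO /(extr_gt0 b) /gt_eqF ->.
have Cg N : Ck N g by exact: Ck_div (csupp_closed sf) f0 G0 (Cf N) (CG N).
have sg : csupp K g by split=> // x /f0; rewrite /g => ->; rewrite mul0r.
have fE : f = fun x => g x * G x.
  apply/funext => x; rewrite /g; have [Kx|/f0 ->] := pselect (K x).
    by rewrite divfK// G0.
  by rewrite !mul0r.
have der (h : 'rV[R]_n -> R) : (forall N, Ck N h) ->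
    (forall x, derivable h x (delta_mx ord0 i)) /\ forall N, Ck N (partial i h).
  move=> Ch; have [dh _] := Ck_partial i (Ch 1); split=> // N.
  by have [] := Ck_partial i (Ch N.+1).
have [[dg Cdg] [dG CdG]] := (der _ Cg, der _ CG); have [ddG _] := der _ CdG.
pose V x := (g x * g x) * (G x * partial i G x).
have CV N : Ck N V by apply: CkM; apply: CkM.
have sV : csupp K V by apply: csuppMl; exact: csuppMl.
have V0 := Rintegral_partial_eq0 i sV (CV 1).
have dM (u v : 'rV[R]_n -> R) : (forall x, derivable u x (delta_mx ord0 i)) ->
    (forall x, derivable v x (delta_mx ord0 i)) ->
    forall x, derivable (fun x => u x * v x) x (delta_mx ord0 i).
  by move=> du dv x; exact: derivableM (du x) (dv x).
have VE x : partial i V x = 2 * (g x * partial i g x) * (G x * partial i G x) +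
    g x * g x * (partial i G x ^+ 2 + G x * ((4 * b ^+ 2 * x ord0 i ^+ 2 - c) * G x)).
  rewrite /V (partialM (dM _ _ dg dg) (dM _ _ dG ddG)) (partialM dg dg) (partialM dG ddG).
  by rewrite partial2_extr -/G /c; ring.
have fx x : f x = g x * G x by rewrite fE.
have fiE x : partial i f x = g x * partial i G x + G x * partial i g x.
  by rewrite [in LHS]fE (partialM dg dG).
have tg : test g by exists K.
have [Lf Lxf] := (test_L2 tf, test_L2 (test_coord i tf)).
have LGg : L2 (fun x => G x * partial i g x).
  apply: test_L2; exists K; first exact/csuppMr/csupp_partial.
  by move=> N; exact: CkM.
have IV : mu.-integrable Om (EFin \o partial i V).
  apply: (csupp_integrable (csupp_partial i sV)).
  by have [_ /Ck_continuous] := Ck_partial i (CV 1).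
have [[I1 I2] I3] := (L2M mOm LGg LGg, L2M mOm Lxf Lxf, L2M mOm Lf Lf).
have I2' := integrableZl mOm (4 * b ^+ 2) I2; have I3' := integrableZl mOm c I3.
rewrite -(RintegralZl (4 * b ^+ 2) mOm I2) -(RintegralZl c mOm I3).
(* The vanishing integral of [partial i V] is inserted, which turns the claim into an identity
   between integrands. *)
rewrite -RintegralB// -[X in X - _]addr0 -V0 -RintegralD// -RintegralB//.
- by apply: eq_Rintegral => x _; rewrite fiE VE fx; ring.
- exact: (integrableD mOm I1 IV).
- exact: (integrableB mOm I2' I3').
Qed.

End orthant.

(** * Quadratic forms on test functions, and the mass away from the origin *)

Section completion.
Context {R : realType} {n : nat} (k : nat).
Hypotheses (k_gt0 : (0 < k)%N) (kn : (k <= n)%N).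
Local Notation Om := (@orthant R n k).
Local Notation mu := (lebesgue_rV R n).
Local Notation ip := (iprod mu Om).
Local Notation L2 := (L2fun mu Om).
Local Notation L2cvg := (L2lim mu Om).
Local Notation N := ((n + 2 * k)%:R : R).
Implicit Types (f g u : 'rV[R]_n -> R) (Du : 'rV[R]_n -> 'rV[R]_n).

Let mOm : measurable Om := measurable_orthant k.

Definition grad_sq Du : R := \sum_i ip (fun x => Du x ord0 i) (fun x => Du x ord0 i).

Definition weight_sq u : R :=
  \sum_i ip (fun x => x ord0 i * u x) (fun x => x ord0 i * u x).

Definition ground_sq b f : R :=
  \sum_i ip (fun x => extr k b x * partial i (fun x => f x / extr k b x) x)
            (fun x => extr k b x * partial i (fun x => f x / extr k b x) x).

Lemma weight_sq_ge0 u : 0 <= weight_sq u.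
Proof. by apply: sumr_ge0 => i _; exact: ip_ge0. Qed.

Lemma grad_sq_ge0 Du : 0 <= grad_sq Du.
Proof. by apply: sumr_ge0 => i _; exact: ip_ge0. Qed.

Lemma gradientE f i : (fun x => gradient f x ord0 i) = partial i f.
Proof. by apply/funext => x; rewrite mxE. Qed.

Lemma ground_identity f b : test k f ->
  grad_sq (gradient f) + 4 * b ^+ 2 * weight_sq f - 2 * b * N * ip f f = ground_sq b f.
Proof.
move=> tf; rewrite /grad_sq /ground_sq.
under eq_bigr do rewrite gradientE (ip_partial_ground b)//.
rewrite sumrB sumrB -mulr_sumr -mulr_suml big_split/= sumr_const card_ord -[\sum_(_ < _) _ * _%:R]mulr_sumr.
rewrite sum_orthant_index// -/(weight_sq f) -mulr_natl natrD natrM; ring.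
Qed.

Lemma ground_sq_ge0 b f : 0 <= ground_sq b f.
Proof. by apply: sumr_ge0 => i _; exact: ip_ge0. Qed.

(** The ground state identity at b = 1/2, where 4 b^2 = 2 b = 1. It bounds the mass by the squares
    of the completion norm and so makes sequences that are Cauchy for that norm Cauchy in L^2. *)
Lemma test_mass_le f : test k f -> N * ip f f <= grad_sq (gradient f) + weight_sq f.
Proof.
move=> tf; have := ground_sq_ge0 (1/2) f; rewrite -ground_identity// subr_ge0.
rewrite (_ : 4 * _ ^+ 2 = 1); last by field.
by rewrite mul1r (_ : 2 * _ = 1) ?mul1r//; field.
Qed.

Record approx u Du (f_ : nat -> 'rV[R]_n -> R) := Approx {
  approx_test : forall m, test k (f_ m);
  approx_L2 : L2 u;
  approx_cvg : L2cvg f_ u;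
  approx_grad_L2 : forall i, L2 (fun x => Du x ord0 i);
  approx_grad : forall i, L2cvg (fun m => partial i (f_ m)) (fun x => Du x ord0 i);
  approx_weight_L2 : forall i, L2 (fun x => x ord0 i * u x);
  approx_weight : forall i,
    L2cvg (fun m x => x ord0 i * f_ m x) (fun x => x ord0 i * u x) }.

(** The limit h is only known to be measurable. Once E m < 1 the difference h_ m - h is square
    integrable, and then so is h. *)
Lemma L2_of_cvg (h_ : nat -> 'rV[R]_n -> R) (h : 'rV[R]_n -> R) (E : nat -> \bar R) :
  (forall m, L2 (h_ m)) -> measurable_fun Om h ->
  (forall m, (\int[mu]_(x in Om) ((h_ m x - h x) ^+ 2)%:E <= E m)%E) ->
  E @ \oo --> 0%E -> L2 h /\ L2cvg h_ h.
Proof.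
move=> Lh_ mh hE E0.
have ev e : 0 < e -> \forall m \near \oo, (E m < e%:E)%E.
  move=> e0; have e0' : (0 < e%:E)%E by rewrite lte_fin.
  exact: E0 _ (open_ereal_lt' e0').
have md m : measurable_fun Om (fun x => h_ m x - h x).
  by apply: measurable_funB => //; case: (Lh_ m).
have Lh : L2 h.
  have [m _ /(_ m (leqnn m)) Em] := ev 1 ltr01.
  have Ld : L2 (fun x => h_ m x - h x).
    by apply: L2_fin => //; apply: le_lt_trans (hE m) (lt_trans Em (ltry _)).
  have := L2B mOm (Lh_ m) Ld; congr (L2fun _ _ _).
  by apply/funext => x; rewrite subKr.
split=> //; apply/cvgrPdist_lt => e e0; apply: filterS (ev e e0) => m Em.
rewrite sub0r normrN ger0_norm ?ip_ge0// -lte_fin ip_integral//; last exact: L2B.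
exact: le_lt_trans (hE m) Em.
Qed.

Lemma sqnorm_orthant_gt0 x : Om x -> 0 < sqnorm x.
Proof.
case: n k_gt0 kn x => [|n'] k0 kn' x; first by rewrite leqn0 (gtn_eqF k0) in kn'.
move=> Ox; rewrite /sqnorm big_ord_recr/= ltr_wpDl//.
  by apply: sumr_ge0 => i _; exact: sqr_ge0.
by rewrite exprn_gt0// Ox//= leq_subLR -add1n leq_add2r.
Qed.

Lemma measurable_sqnorm D : measurable_fun D (@sqnorm R n).
Proof.
apply: measurable_sum => i; apply: measurable_funX.
exact: measurable_funTS (measurable_coord i).
Qed.

(** The part of the orthant where |x|^2 is bounded below; it is unbounded outwards. There the
    weighted norm controls the plain one, and these sets exhaust the orthant because x <> 0 on it
    when k > 0. *)
Definition annulus j : set 'rV[R]_n := Om `&` [set x | j.+1%:R^-1 <= sqnorm x].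

Lemma measurable_annulus j : measurable (annulus j).
Proof.
apply: measurableI => //; rewrite -[X in measurable X]setTI.
rewrite (_ : [set x | _] = (@sqnorm R n) @^-1` `[j.+1%:R^-1, +oo[); last first.
  by apply/seteqP; split => x /=; rewrite in_itv/= andbT.
exact: measurable_sqnorm.
Qed.

Lemma annulus_ndecr : nondecreasing_seq annulus.
Proof.
move=> i j ij; apply/subsetPset => x [Ox] /= ix; split=> //=.
by apply: le_trans ix; rewrite lef_pV2 ?posrE// ler_nat ltnS.
Qed.

Lemma bigcup_annulus : Om = \bigcup_j annulus j.
Proof.
apply/seteqP; split=> [x Ox|x [j _ []//]].
have [j _ /(_ j (leqnn j)) /= jx] := near_infty_natSinv_lt (PosNum (sqnorm_orthant_gt0 Ox)).
by exists j => //; split=> //; exact: ltW.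
Qed.

Lemma annulus_L2 j u : measurable_fun Om u -> (forall i, L2 (fun x => x ord0 i * u x)) ->
  L2fun mu (annulus j) u /\ iprod mu (annulus j) u u <= j.+1%:R * weight_sq u.
Proof.
move=> mu_ Lxu; have mu' : measurable_fun (annulus j) u.
  by apply: measurable_funS mu_ => //; exact: subIsetl.
suff H : (\int[mu]_(x in annulus j) (u x ^+ 2)%:E <= (j.+1%:R * weight_sq u)%:E)%E.
  have Lu : L2fun mu (annulus j) u.
    by apply: L2_fin => //; apply: le_lt_trans H (ltry _).
  split=> //; rewrite -lee_fin ip_integral//; exact: measurable_annulus.
have mx i : measurable_fun Om (fun x => ((x ord0 i * u x) ^+ 2)%:E).
  by apply/measurable_EFinP; apply: measurable_funX; case: (Lxu i).
rewrite EFinM /weight_sq -sumEFin.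
under eq_bigr do rewrite ip_integral//.
rewrite -ge0_integral_sum//=; last by move=> i x _; rewrite lee_fin sqr_ge0.
have mS : measurable_fun Om (fun x => \sum_(i < n) ((x ord0 i * u x) ^+ 2)%:E)%E.
  exact: emeasurable_sum.
rewrite -ge0_integralZl//; last first.
  by move=> x _; apply: sume_ge0 => i _; rewrite lee_fin sqr_ge0.
apply: (@le_trans _ _ (\int[mu]_(x in annulus j)
    (j.+1%:R%:E * \sum_(i < n) ((x ord0 i * u x) ^+ 2)%:E))%E).
  apply: ge0_le_integral => //.
  - exact: measurable_annulus.
  - by move=> x _; rewrite lee_fin sqr_ge0.
  - exact/measurable_EFinP/measurable_funX.
  - apply: emeasurable_funM => //.
    by apply: measurable_funS mS => //; exact: subIsetl.
  - move=> x [Ox /= jx]; rewrite sumEFin -EFinM lee_fin.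
    under eq_bigr do rewrite exprMn.
    (* On the annulus 1 <= (j + 1) |x|^2, hence u^2 <= (j + 1) |x|^2 u^2. *)
    rewrite -mulr_suml -/(sqnorm x) mulrA ler_peMl ?sqr_ge0//.
    by rewrite -(ler_pM2l (x := j.+1%:R^-1)) ?invr_gt0// mulr1 mulrA mulVf ?mul1r.
apply: ge0_subset_integral => //.
- exact: measurable_annulus.
- by apply: emeasurable_funM.
- move=> x _; apply: mule_ge0; first by rewrite lee_fin.
  by apply: sume_ge0 => i _; rewrite lee_fin sqr_ge0.
- exact: subIsetl.
Qed.

End completion.

(** * The completion *)

Section approximation.
Context {R : realType} {n : nat} (k : nat).
Hypotheses (k_gt0 : (0 < k)%N) (kn : (k <= n)%N).
Local Notation Om := (@orthant R n k).
Local Notation mu := (lebesgue_rV R n).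
Local Notation ip := (iprod mu Om).
Local Notation L2 := (L2fun mu Om).
Local Notation L2cvg := (L2lim mu Om).
Local Notation N := ((n + 2 * k)%:R : R).
Implicit Types (f g u : 'rV[R]_n -> R) (Du : 'rV[R]_n -> 'rV[R]_n).

Let mOm : measurable Om := measurable_orthant k.

Let N_gt0 : 0 < N.
Proof. by rewrite ltr0n addn_gt0 muln_gt0 k_gt0 orbT. Qed.

Lemma int_orthant_ge_term i (h : 'I_n -> 'rV[R]_n -> R) (H : 'rV[R]_n -> R) :
  (forall j, measurable_fun Om (h j)) -> (forall x, H x = \sum_j h j x ^+ 2) ->
  (\int[mu]_(x in Om) (h i x ^+ 2)%:E <= int_orthant k H)%E.
Proof.
move=> mh HE; rewrite /int_orthant; apply: ge0_le_integral => //.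
- by move=> x _; rewrite lee_fin sqr_ge0.
- exact/measurable_EFinP/measurable_funX.
- apply/measurable_EFinP; rewrite (_ : H = fun x => \sum_j h j x ^+ 2); last exact/funext.
  by apply: measurable_sum => j; exact: measurable_funX.
- move=> x _; rewrite lee_fin HE (bigD1 i)//= lerDl.
  by apply: sumr_ge0 => j _; exact: sqr_ge0.
Qed.

Lemma int_orthant_sum (h : 'I_n -> 'rV[R]_n -> R) (H : 'rV[R]_n -> R) :
  (forall j, L2 (h j)) -> (forall x, H x = \sum_j h j x ^+ 2) ->
  int_orthant k H = (\sum_j ip (h j) (h j))%:E.
Proof.
move=> Lh HE; rewrite /int_orthant -sumEFin.
under eq_bigr do rewrite ip_integral//.
rewrite -ge0_integral_sum//.
- by apply: eq_integral => x _; rewrite HE sumEFin.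
- by move=> i; apply/measurable_EFinP; apply: measurable_funX; case: (Lh i).
- by move=> i x _; rewrite lee_fin sqr_ge0.
Qed.

Lemma cvg_sum (a : 'I_n -> nat -> R) (l : 'I_n -> R) :
  (forall i, a i @ \oo --> l i) -> (fun m => \sum_i a i m) @ \oo --> \sum_i l i.
Proof.
move=> al; elim: (index_enum _) => [|i r IHr].
  by under eq_fun do rewrite big_nil; rewrite big_nil; exact: cvg_cst.
by under eq_fun do rewrite big_cons; rewrite big_cons; exact: cvgD.
Qed.

(** The new point is convergence of f_m to u in L^2. By [test_mass_le] the mass of f_m - f_l is at
    most its squared completion norm over N. On an annulus l may tend to infinity, since f_l tends
    to u there; the resulting bound does not depend on the annulus, so it holds on the orthant. *)
Lemma in_completion_approx u Du : in_completion k u Du -> 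
  exists f_ : nat -> 'rV[R]_n -> R, approx k u Du f_.
Proof.
move=> [mu_ mDu [f_ [tf_ cg cw]]].
have tf m : test k (f_ m) by exact: test_function_test.
have td m i x : derivable (f_ m) x (delta_mx ord0 i).
  by have [_ _ Cf] := tf m; have [] := Ck_partial i (Cf 1).
have mDui i : measurable_fun Om (fun x => Du x ord0 i).
  exact: measurableT_comp (measurable_coord i) mDu.
have mx i : measurable_fun Om (fun x : 'rV[R]_n => x ord0 i).
  exact: measurable_funTS (measurable_coord i).
have mf m : measurable_fun Om (f_ m) by case: (test_L2 (tf m)).
have Lg m i : L2 (partial i (f_ m)) by exact/test_L2/test_partial.
have Lw m i : L2 (fun x => x ord0 i * f_ m x) by exact/test_L2/test_coord.
have mxu i : measurable_fun Om (fun x => x ord0 i * u x) by exact: measurable_funM.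
have Hg i : L2 (fun x => Du x ord0 i) /\
    L2cvg (fun m => partial i (f_ m)) (fun x => Du x ord0 i).
  apply: (L2_of_cvg _ (mDui i) _ cg) => // m.
  apply: (@int_orthant_ge_term i (fun j x => partial j (f_ m) x - Du x ord0 j)).
    by move=> j; apply: measurable_funB => //; case: (Lg m j).
  by move=> x; apply: eq_bigr => j _; rewrite !mxE.
have Hw i : L2 (fun x => x ord0 i * u x) /\
    L2cvg (fun m x => x ord0 i * f_ m x) (fun x => x ord0 i * u x).
  apply: (L2_of_cvg _ (mxu i) _ cw) => // m.
  apply: (@int_orthant_ge_term i (fun j x => x ord0 j * f_ m x - x ord0 j * u x)).
    by move=> j; apply: measurable_funB => //; case: (Lw m j).
  by move=> x; rewrite /sqnorm mulr_suml; apply: eq_bigr => j _; ring.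
(* The squared distance from f_m to (u, Du), with gradient and weight parts added. *)
pose D m := \sum_i ip (fun x => partial i (f_ m) x - Du x ord0 i)
                      (fun x => partial i (f_ m) x - Du x ord0 i) +
            \sum_i ip (fun x => x ord0 i * f_ m x - x ord0 i * u x)
                      (fun x => x ord0 i * f_ m x - x ord0 i * u x).
have D0 : D @ \oo --> 0.
  rewrite [X in _ --> X](_ : _ = \sum_(i < n) 0 + \sum_(i < n) 0); last by rewrite !big1 ?addr0.
  by apply: cvgD; apply: cvg_sum => i; [case: (Hg i)|case: (Hw i)].
have mfu m : measurable_fun Om (fun x => f_ m x - u x) by exact: measurable_funB.
have Lxfu m i : L2 (fun x => x ord0 i * (f_ m x - u x)).
  have := L2B mOm (Lw m i) (Hw i).1; congr (L2fun _ _ _).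
  by apply/funext => x; rewrite mulrBr.
have key m : L2 (fun x => f_ m x - u x) /\
    ip (fun x => f_ m x - u x) (fun x => f_ m x - u x) <= D m / N.
  apply: (@L2_exhaust _ _ _ mu Om mOm (annulus k) _ (D m / N)) => //.
  - exact: annulus_ndecr.
  - exact: measurable_annulus.
  - exact: bigcup_annulus.
  - by move=> j; have [] := annulus_L2 j (mfu m) (Lxfu m).
  move=> j; pose ipj := iprod mu (annulus k j); have mA := @measurable_annulus R n k j.
  have Aj : annulus k j `<=` Om by exact: subIsetl.
  have LA h (Lh : L2 h) : L2fun mu (annulus k j) h := L2S mOm mA Aj Lh.
  have Lfl l : L2fun mu (annulus k j) (fun x => f_ m x - f_ l x).
    by apply/LA/L2B => //; exact/test_L2.
  have [Lfu _] := annulus_L2 j (mfu m) (Lxfu m).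
  have c1 : ipj (fun x => f_ m x - f_ l x) (fun x => f_ m x - f_ l x) @[l --> \oo] -->
      ipj (fun x => f_ m x - u x) (fun x => f_ m x - u x).
    have H : L2lim mu (annulus k j) (fun l x => f_ m x - f_ l x) (fun x => f_ m x - u x).
      apply: (@cvg0_squeeze _ _ (fun l => j.+1%:R * weight_sq k (fun x => f_ l x - u x))).
        move=> l; rewrite ip_ge0/=; have [_] := annulus_L2 j (mfu l) (Lxfu l).
        apply: le_trans; rewrite le_eqVlt; apply/orP; left; apply/eqP.
        by apply: eq_Rintegral => x _; ring.
      rewrite [X in _ --> X](_ : _ = j.+1%:R * \sum_(i < n) 0); last by rewrite big1 ?mulr0.
      apply: cvgMl_tmp; apply: cvg_sum => i; have := (Hw i).2.
      by rewrite /L2cvg; under eq_fun do under eq_fun do rewrite -mulrBr.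
    exact: ip_cvg.
  have c2 : (grad_sq k (gradient (fun x => f_ m x - f_ l x)) +
      weight_sq k (fun x => f_ m x - f_ l x)) / N @[l --> \oo] --> D m / N.
    apply: cvgMr_tmp; apply: cvgD; apply: cvg_sum => i.
      have c : L2cvg (fun l x => partial i (f_ m) x - partial i (f_ l) x)
          (fun x => partial i (f_ m) x - Du x ord0 i).
        by apply: L2cvgB => //; [exact: (Hg i).1|exact: L2cvg_cst|exact: (Hg i).2].
      rewrite [X in X @ _ --> _](_ : _ = fun l =>
          ip (fun x => partial i (f_ m) x - partial i (f_ l) x)
             (fun x => partial i (f_ m) x - partial i (f_ l) x)).
        by apply: ip_cvg => //; try (move=> l; exact: L2B); apply: L2B => //; exact: (Hg i).1.
      by apply/funext => l; rewrite gradientE (partialB (td _ _) (td _ _)).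
    have c : L2cvg (fun l x => x ord0 i * f_ m x - x ord0 i * f_ l x)
        (fun x => x ord0 i * f_ m x - x ord0 i * u x).
      by apply: L2cvgB => //; [exact: (Hw i).1|exact: L2cvg_cst|exact: (Hw i).2].
    rewrite [X in X @ _ --> _](_ : _ = fun l =>
        ip (fun x => x ord0 i * f_ m x - x ord0 i * f_ l x)
           (fun x => x ord0 i * f_ m x - x ord0 i * f_ l x)).
      by apply: ip_cvg => //; try (move=> l; exact: L2B); apply: L2B => //; exact: (Hw i).1.
    by apply/funext => l; apply: eq_Rintegral => x _; rewrite mulrBr.
  (* The inequality is passed to the limit in l with m fixed. *)
  apply: ler_cvg_to c1 c2 _; near=> l.
  apply: (@le_trans _ _ (ip (fun x => f_ m x - f_ l x) (fun x => f_ m x - f_ l x))).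
    by apply: ipS_le => //; apply: L2B => //; exact: test_L2.
  by rewrite ler_pdivlMr// mulrC; apply: test_mass_le => //; exact: testB.
have Lu : L2 u.
  have := L2B mOm (test_L2 (tf 0)) (key 0%N).1; congr (L2fun _ _ _).
  by apply/funext => x; rewrite subKr.
exists f_; split=> //.
- apply: (@cvg0_squeeze _ _ (fun m => D m / N)) => [m|].
    by rewrite ip_ge0 (key m).2.
  by rewrite -[X in _ --> X](mul0r N^-1); exact: cvgMr_tmp.
- by move=> i; exact: (Hg i).1.
- by move=> i; exact: (Hg i).2.
- by move=> i; exact: (Hw i).1.
- by move=> i; exact: (Hw i).2.
Unshelve. all: by end_near. Qed.

End approximation.

(** * The inequality *)

Section uncertainty.
Context {R : realType} {n : nat} (k : nat).
Hypotheses (k_gt0 : (0 < k)%N) (kn : (k <= n)%N).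
Local Notation Om := (@orthant R n k).
Local Notation mu := (lebesgue_rV R n).
Local Notation ip := (iprod mu Om).
Local Notation L2 := (L2fun mu Om).
Local Notation L2cvg := (L2lim mu Om).
Local Notation N := ((n + 2 * k)%:R : R).

Let mOm : measurable Om := measurable_orthant k.

Section approx.
Variables (u : 'rV[R]_n -> R) (Du : 'rV[R]_n -> 'rV[R]_n) (f_ : nat -> 'rV[R]_n -> R).
Hypothesis H : approx k u Du f_.

Let tf m : test k (f_ m) := approx_test H m.

Lemma gradient_termE : gradient_term k Du = (grad_sq k Du)%:E.
Proof. by apply: int_orthant_sum => // i; exact: approx_grad_L2 H i. Qed.

Lemma weight_termE : weight_term k u = (weight_sq k u)%:E.
Proof.
apply: int_orthant_sum => [i|x]; first exact: approx_weight_L2 H i.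
by rewrite /sqnorm mulr_suml; apply: eq_bigr => i _; rewrite exprMn.
Qed.

Lemma mass_termE : mass_term k u = (ip u u)%:E.
Proof. by rewrite ip_integral//; exact: approx_L2 H. Qed.

Lemma grad_sq_cvg : grad_sq k (gradient (f_ m)) @[m --> \oo] --> grad_sq k Du.
Proof.
apply: cvg_sum => i; under eq_fun do rewrite gradientE.
apply: ip_cvg => //; try exact: approx_grad_L2 H i; try exact: approx_grad H i.
- by move=> m; exact/test_L2/test_partial.
- by move=> m; exact/test_L2/test_partial.
Qed.

Lemma weight_sq_cvg : weight_sq k (f_ m) @[m --> \oo] --> weight_sq k u.
Proof.
apply: cvg_sum => i.
apply: (@ip_cvg _ _ _ mu Om mOm (fun m x => x ord0 i * f_ m x)
   (fun m x => x ord0 i * f_ m x)).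
- by move=> m; exact/test_L2/test_coord.
- exact: approx_weight_L2 H i.
- by move=> m; exact/test_L2/test_coord.
- exact: approx_weight_L2 H i.
- exact: approx_weight H i.
- exact: approx_weight H i.
Qed.

Lemma mass_cvg : ip (f_ m) (f_ m) @[m --> \oo] --> ip u u.
Proof.
by apply: ip_cvg => //; try exact: approx_L2 H; try exact: approx_cvg H;
  move=> m; exact: test_L2.
Qed.

(** Each term on the left of [ground_identity] converges, so the remainder has a limit although
    [ground_sq] need not make sense for u. *)
Lemma ground_sq_cvg b : ground_sq k b (f_ m) @[m --> \oo] -->
  grad_sq k Du + 4 * b ^+ 2 * weight_sq k u - 2 * b * N * ip u u.
Proof.
under eq_fun do rewrite -ground_identity//.
apply: cvgB; last by apply: cvgMl_tmp; exact: mass_cvg.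
by apply: cvgD; [exact: grad_sq_cvg|apply: cvgMl_tmp; exact: weight_sq_cvg].
Qed.

(** With t = 2 b the limit identity is a quadratic polynomial in t, nonnegative on the whole real
    line. *)
Lemma ground_ge0 t : 0 <= grad_sq k Du + t ^+ 2 * weight_sq k u - t * N * ip u u.
Proof.
have := cvgr_to_ge (ground_sq_cvg (b := t / 2)) (b := 0).
rewrite (_ : 4 * _ ^+ 2 = t ^+ 2); last by field.
rewrite (_ : 2 * (t / 2) = t); last by field.
by apply; near=> m; exact: ground_sq_ge0.
Unshelve. all: by end_near. Qed.

Lemma mass_sq_le : (N * ip u u) ^+ 2 <= 4 * (grad_sq k Du * weight_sq k u).
Proof.
have := weight_sq_ge0 k u; set B := weight_sq k u; set A := grad_sq k Du.
rewrite le_eqVlt => /predU1P[B0|B0].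
  have [->|C0] := eqVneq (N * ip u u) 0; first by rewrite expr0n/= -B0 !mulr0.
  (* When B = 0 the polynomial is affine, and it takes the value -1 at this t unless the mass
     vanishes. *)
  have := ground_ge0 ((A + 1) / (N * ip u u)); rewrite -/A -/B -B0 mulr0 addr0.
  by rewrite -mulrA divfK// opprD addrA subrr sub0r oppr_ge0 ler10.
(* The minimizer of A + t^2 B - t C, with C = N <u, u>. *)
have := ground_ge0 (N * ip u u / (2 * B)); rewrite -/A -/B.
rewrite (_ : _ - _ = (4 * (A * B) - (N * ip u u) ^+ 2) / (4 * B)); last first.
  by field; rewrite gt_eqF.
by rewrite pmulr_lge0 ?subr_ge0// invr_gt0 mulr_gt0.
Qed.

(** Integration by parts against f_l, followed by l tending to infinity: [Du] is thus seen to be the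
    weak gradient of u, tested on the derivatives of f_m. *)
Lemma weak_laplacian i m : ip (partial i (f_ m)) (fun x => Du x ord0 i) =
  - ip (partial i (partial i (f_ m))) u.
Proof.
have [K sf Cf] := tf m.
have C1 l N : Ck N (partial i (f_ l)) by have [K' _ /(_ N)] := test_partial i (tf l).
have E l : ip (partial i (f_ m)) (partial i (f_ l)) =
    - ip (partial i (partial i (f_ m))) (f_ l).
  rewrite (ip_partial i (csupp_partial i sf) (C1 m 1)) ?opprK//.
  by have [K' _ ] := tf l.
have L1 l : L2 (partial i (f_ l)) by exact/test_L2/test_partial.
have c1 : ip (partial i (f_ m)) (partial i (f_ l)) @[l --> \oo] -->
    ip (partial i (f_ m)) (fun x => Du x ord0 i).
  apply: (ip_cvg mOm (fun=> L1 m) (L1 m) L1 (approx_grad_L2 H i) _ (approx_grad H i)).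
  exact: L2cvg_cst.
have c2 : - ip (partial i (partial i (f_ m))) (f_ l) @[l --> \oo] -->
    - ip (partial i (partial i (f_ m))) u.
  have Ldd : L2 (partial i (partial i (f_ m))) by exact/test_L2/test_partial/test_partial.
  apply: cvgN; apply: (ip_cvg mOm (fun=> Ldd) Ldd (fun l => test_L2 (tf l))
    (approx_L2 H) _ (approx_cvg H)).
  exact: L2cvg_cst.
apply: (cvg_unique (@norm_hausdorff R R) c1).
by rewrite (funext E).
Qed.

Lemma ae_ip g v : measurable_fun Om g -> measurable_fun Om v ->
  u = v %[ae mu in Om] -> ip g u = ip g v.
Proof.
move=> mg mv uv; congr fine; apply: ae_eq_integral => //.
- apply/measurable_EFinP; apply: measurable_funM => //; by case: (approx_L2 H).
- by apply/measurable_EFinP; exact: measurable_funM.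
- by apply: filterS uv => x ux Dx /=; rewrite ux.
Qed.

(* [Du] is only known as a limit of gradients, so that its norm is computed from
   <grad f_m, Du> = - <lap f_m, u> = - <f_m, lap u>, where lap u is explicit. *)
Lemma grad_sq_extremizer al b : u = extremizer k al b %[ae mu in Om] ->
  grad_sq k Du = 2 * b * N * ip u u - 4 * b ^+ 2 * weight_sq k u.
Proof.
rewrite extremizerE -/(extr k b) => uG.
pose c i := 2 * b + 4 * b * (n - k <= i)%N%:R : R.
have Lu := approx_L2 H; have Lxu := approx_weight_L2 H.
have Lf m : L2 (f_ m) by exact: test_L2.
have Lxf m i : L2 (fun x => x ord0 i * f_ m x) by exact/test_L2/test_coord.
pose v (x : 'rV[R]_n) := al * extr k b x.
have Cv M : Ck M v by apply: CkM; [exact: Ck_cst|exact: Ck_extr].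
have mv : measurable_fun Om v.
  by apply: continuous_measurable_rV; exact: (Ck_continuous (Cv 0)).
pose q i (x : 'rV[R]_n) := 4 * b ^+ 2 * x ord0 i ^+ 2 - c i.
have ddv i : partial i (partial i v) = fun x => q i x * v x.
  have [dG /(Ck_partial i)[ddG _]] := Ck_partial i (Ck_extr (R := R) (n := n) k 2 b).
  rewrite /v (partialZ al dG) (partialZ al ddG) partial2_extr.
  by apply/funext => x; rewrite /q /c; ring.
have E i m : ip (partial i (f_ m)) (fun x => Du x ord0 i) = c i * ip (f_ m) u -
    4 * b ^+ 2 * ip (fun x => x ord0 i * f_ m x) (fun x => x ord0 i * u x).
  have [K sf Cf] := tf m; have [_ Cdf] := Ck_partial i (Cf 2).
  have [_ Cdv] := Ck_partial i (Cv 2).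
  have mq : measurable_fun Om (fun x => q i x * f_ m x).
    apply: continuous_measurable_rV; apply: (Ck_continuous (N := 0)); apply: CkM => //.
    apply: CkB; last exact: Ck_cst.
    apply: CkM; first exact: Ck_cst.
    exact: (Ck_coord i (Ck1X 2 (Ck1_id 0))).
  rewrite weak_laplacian (ae_ip _ mv)//; last first.
    by have [] := test_L2 (test_partial i (test_partial i (tf m))).
  rewrite (ip_partial i (csupp_partial i sf) Cdf (Cv 1)) opprK.
  rewrite (ip_partial i sf (Cf 1) Cdv) ddv.
  rewrite (_ : ip _ _ = ip (fun x => q i x * f_ m x) v); last first.
    by apply: eq_Rintegral => x _; ring.
  rewrite -(ae_ip mq mv uG).
  have [I1 I2] := (L2M mOm (Lxf m i) (Lxu i), L2M mOm (Lf m) Lu).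
  rewrite (_ : ip _ u = 4 * b ^+ 2 * ip (fun x => x ord0 i * f_ m x)
      (fun x => x ord0 i * u x) - c i * ip (f_ m) u) ?opprB//.
  rewrite -(RintegralZl (4 * b ^+ 2) mOm I1) -(RintegralZl (c i) mOm I2).
  rewrite -RintegralB//.
  - by apply: eq_Rintegral => x _; rewrite /q; ring.
  - exact: (integrableZl mOm (4 * b ^+ 2) I1).
  - exact: (integrableZl mOm (c i) I2).
(* The limit of [E] as m tends to infinity, f_m tending to u and its derivative to the i-th
   component of Du. *)
have Ei i : ip (fun x => Du x ord0 i) (fun x => Du x ord0 i) = c i * ip u u -
    4 * b ^+ 2 * ip (fun x => x ord0 i * u x) (fun x => x ord0 i * u x).
  have c1 : ip (partial i (f_ m)) (fun x => Du x ord0 i) @[m --> \oo] -->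
      ip (fun x => Du x ord0 i) (fun x => Du x ord0 i).
    apply: (ip_cvg mOm _ (approx_grad_L2 H i) (fun=> approx_grad_L2 H i)
      (approx_grad_L2 H i) (approx_grad H i)); last exact: L2cvg_cst.
    by move=> m; exact/test_L2/test_partial.
  apply: (cvg_unique (@norm_hausdorff R R) c1); rewrite (funext (E i)).
  apply: cvgB; apply: cvgMl_tmp.
    by apply: (ip_cvg mOm Lf Lu (fun=> Lu) Lu (approx_cvg H)); exact: L2cvg_cst.
  apply: (ip_cvg mOm (Lxf^~ i) (Lxu i) (fun=> Lxu i) (Lxu i) (approx_weight H i)).
  exact: L2cvg_cst.
rewrite /grad_sq; under eq_bigr do rewrite Ei.
rewrite sumrB -mulr_sumr -mulr_suml /c big_split/= sumr_const card_ord.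
rewrite -[\sum_(_ < _) _ * _%:R]mulr_sumr sum_orthant_index// -/(weight_sq k u).
by rewrite -mulr_natl natrD natrM; ring.
Qed.

(** By [grad_sq_extremizer] the nonnegative polynomial A + t^2 B - t C vanishes at t = 2 b. Its
    derivative 4 b B - C is therefore 0, and then A = C^2 / (4 B) in the form 4 A B = C^2. *)
Lemma extremizer_equality al b : u = extremizer k al b %[ae mu in Om] ->
  4 * (grad_sq k Du * weight_sq k u) = (N * ip u u) ^+ 2.
Proof.
move=> /grad_sq_extremizer EA.
have := weight_sq_ge0 k u; have := ground_ge0; rewrite EA.
set B := weight_sq k u; set C := N * ip u u => ge0 B0.
have s0 : C = 4 * b * B.
  (* s is the derivative at 2 b. A step of length s / (B + 1) against it gives the value - (s / (B +
     1))^2; the 1 avoids division by 0. *)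
  pose s := 4 * b * B - C; have := ge0 (2 * b - s / (B + 1)).
  have B1 : B + 1 != 0 by rewrite gt_eqF// ltr_wpDl.
  rewrite -[2 * b * N * _]mulrA -[_ * N * _]mulrA -/C.
  rewrite (_ : _ - _ = - (s / (B + 1)) ^+ 2); last by rewrite /s; field.
  rewrite oppr_ge0 le_eqVlt ltNge sqr_ge0 orbF sqrf_eq0 mulf_eq0 invr_eq0 (negbTE B1) orbF.
  by rewrite subr_eq0 => /eqP.
by rewrite -[2 * b * N * _]mulrA -/C s0; ring.
Qed.

End approx.

End uncertainty.

(** * The Poincare inequality on boxes *)

Section slices.
Context {R : realType} {n : nat} (l r : 'I_n.+1 -> R).
Local Notation mu := (@lebesgue_measure R).
Local Notation I := `[l ord0, r ord0]%classic.
Local Notation K' := (cbox (l \o lift ord0) (r \o lift ord0)).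
Implicit Types (f : 'rV[R]_n.+1 -> R).

Lemma cbox_cons s p : cbox l r (cons_rV (s, p)) <-> I s /\ K' p.
Proof.
split=> [H|[Is Kp] i].
  split=> [|i]; first by have := H ord0; rewrite cons_rV0.
  by have := H (lift ord0 i); rewrite cons_rV_lift.
by case: (unliftP ord0 i) => [j|] ->; rewrite ?cons_rV0// cons_rV_lift; exact: Kp.
Qed.

Let patch_cons (f : 'rV[R]_n.+1 -> R) s p : ((EFin \o f) \_ (cbox l r)) (cons_rV (s, p)) =
  if s \in I then ((fun p => (f (cons_rV (s, p)))%:E) \_ K') p else 0%E.
Proof.
rewrite !patchE; case: (boolP (s \in I)); rewrite ?(inE, notin_setE) => Is.
  case: (boolP (p \in K')); rewrite ?(inE, notin_setE) => Kp.
    by rewrite mem_set//; apply/cbox_cons.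
  by rewrite memNset// => /cbox_cons[].
by rewrite memNset// => /cbox_cons[].
Qed.

Let mpatch f : measurable_fun setT f -> measurable_fun setT ((EFin \o f) \_ (cbox l r)).
Proof.
move=> mf; have : measurable_fun (cbox l r) (EFin \o f).
  by apply/measurable_EFinP; exact: measurable_funTS.
by move/(measurable_restrictT _ (measurable_cbox l r)).
Qed.

Let patch_ge0 f x : (forall x, 0 <= f x) -> (0 <= ((EFin \o f) \_ (cbox l r)) x)%E.
Proof. by move=> f0; apply: erestrict_ge0 => y _; rewrite lee_fin. Qed.

Lemma ge0_integral_cbox f : measurable_fun setT f -> (forall x, 0 <= f x) ->
  (\int[lebesgue_rV R n.+1]_(x in cbox l r) (f x)%:E =
   \int[mu]_(s in I) \int[lebesgue_rV R n]_(p in K') (f (cons_rV (s, p)))%:E)%E.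
Proof.
move=> mf f0; rewrite integral_mkcond ge0_integral_rVS; last 2 first.
- exact: mpatch.
- by move=> x; exact: patch_ge0.
rewrite [RHS]integral_mkcond; apply: eq_integral => s _.
rewrite [RHS]patchE; case: ifPn => sI.
  rewrite [RHS]integral_mkcond; apply: eq_integral => p _.
  by rewrite patch_cons sI.
by apply: integral0_eq => p _; rewrite patch_cons (negbTE sI).
Qed.

Lemma ge0_integral_cboxC f : measurable_fun setT f -> (forall x, 0 <= f x) ->
  (\int[lebesgue_rV R n.+1]_(x in cbox l r) (f x)%:E =
   \int[lebesgue_rV R n]_(p in K') \int[mu]_(s in I) (f (cons_rV (s, p)))%:E)%E.
Proof.
move=> mf f0; rewrite integral_mkcond ge0_integral_rVSC; last 2 first.
- exact: mpatch.
- by move=> x; exact: patch_ge0.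
rewrite [RHS]integral_mkcond; apply: eq_integral => p _.
rewrite [RHS]patchE; case: ifPn => pK.
  rewrite [RHS]integral_mkcond; apply: eq_integral => s _.
  by rewrite patch_cons !patchE pK.
by apply: integral0_eq => s _; rewrite patch_cons !patchE (negbTE pK) if_same.
Qed.

Lemma measurable_slice_integral f : measurable_fun setT f -> (forall x, 0 <= f x) ->
  measurable_fun I (fun s => \int[lebesgue_rV R n]_(p in K') (f (cons_rV (s, p)))%:E)%E.
Proof.
move=> mf f0.
pose h := ((EFin \o f) \_ (cbox l r)) \o @cons_rV R n.
have mh : @measurable_fun _ _ (measurableTypeR R * 'rV[R]_n)%type _ setT h.
  by apply: measurableT_comp; [exact: mpatch|exact: measurable_cons_rV].
have h0 x : (0 <= h x)%E by exact: patch_ge0.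
have H := @measurable_fun_fubini_tonelli_F _ _ (measurableTypeR R) _ _
  (lebesgue_rV R n) h mh h0.
apply: (eq_measurable_fun _ _ (measurable_funTS H)) => s sI.
rewrite /fubini_F [RHS]integral_mkcond; apply: eq_integral => p _.
by rewrite /h /= patch_cons sI.
Qed.

Lemma measurable_slice_integralC f : measurable_fun setT f -> (forall x, 0 <= f x) ->
  measurable_fun K' (fun p => \int[mu]_(s in I) (f (cons_rV (s, p)))%:E)%E.
Proof.
move=> mf f0.
pose h := ((EFin \o f) \_ (cbox l r)) \o @cons_rV R n.
have mh : @measurable_fun _ _ (measurableTypeR R * 'rV[R]_n)%type _ setT h.
  by apply: measurableT_comp; [exact: mpatch|exact: measurable_cons_rV].
have h0 x : (0 <= h x)%E by exact: patch_ge0.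
have H := @measurable_fun_fubini_tonelli_G _ _ (measurableTypeR R) _ _
  mu h mh h0.
apply: (eq_measurable_fun _ _ (measurable_funTS H)) => p pK.
rewrite /fubini_G [RHS]integral_mkcond; apply: eq_integral => s _.
by rewrite /h /= patch_cons !patchE pK.
Qed.

End slices.

Section poincare.
Context {R : realType}.
Local Notation mu := (@lebesgue_measure R).

(** The fundamental theorem of calculus and Cauchy-Schwarz against the constant 1 on [t, s], then
    enlargement of the interval to [a, b]. *)
Lemma sqr_increment_le (p : R -> R) a b s t : (forall t, derivable p t 1) ->
  continuous (derive1 p) -> a <= b -> s \in `[a, b]%R -> t \in `[a, b]%R ->
  (((p s - p t) ^+ 2)%:E <= (b - a)%:E * \int[mu]_(x in `[a, b]) (derive1 p x ^+ 2)%:E)%E.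
Proof.
move=> dp cp ab; wlog ts : s t / t <= s.
  move=> W sab tab; have [ts|/ltW st] := leP t s; first exact: W.
  by rewrite -sqrrN opprB; exact: W.
move=> sab tab; move: ts; rewrite le_eqVlt => /predU1P[->|ts].
  rewrite subrr expr0n/=; apply: mule_ge0; first by rewrite lee_fin subr_ge0.
  by apply: integral_ge0 => x _; rewrite lee_fin sqr_ge0.
have L2p c e (h : R -> R) : continuous h -> L2fun mu `[c, e]%classic h.
  move=> ch; split.
    by apply: subspace_continuous_measurable_fun => //; exact: continuous_subspaceT.
  apply: continuous_compact_integrable; first exact: segment_compact.
  by apply: continuous_subspaceT => x; exact: (continuousM (ch x) (ch x)).
have m1 c e : measurable (`[c, e]%classic : set (measurableTypeR R)) by exact: measurable_itv.
have := cauchy_schwarz (m1 t s) (L2p t s _ (@cst_continuous R R 1)) (L2p t s _ cp).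
have -> : iprod mu `[t, s]%classic (cst 1) (derive1 p) = p s - p t.
  rewrite /iprod; under eq_Rintegral do rewrite mul1r.
  by rewrite /Rintegral FTC2.
have -> : iprod mu `[t, s]%classic (cst 1) (cst 1) = s - t.
  rewrite /iprod; under eq_Rintegral do rewrite mul1r.
  by rewrite Rintegral_cst//= lebesgue_measure_itv/= lte_fin ts mul1r.
move=> H; rewrite -ip_integral; last exact: L2p.
rewrite -EFinM lee_fin; apply: (le_trans H).
move: sab tab; rewrite !in_itv/= => /andP[as_ sb] /andP[at_ tb].
apply: ler_pM; [by rewrite subr_ge0 ltW|exact: ip_ge0|lra|].
apply: (ipS_le (m1 a b)) => //; last exact: L2p.
move=> x /=; rewrite !in_itv/= => /andP[tx xs].
by rewrite (le_trans at_ tx) (le_trans xs sb).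
exact: m1.
Qed.

Lemma cbox_L2 n (l r : 'I_n -> R) f : continuous f -> L2fun (lebesgue_rV R n) (cbox l r) f.
Proof.
move=> cf; split; first exact: continuous_measurable_rV.
apply: measurable_bounded_integrable.
- exact: measurable_cbox.
- exact: cbox_fin.
- by apply: measurable_funX; exact: continuous_measurable_rV.
have /compact_bounded[N [_ Nf]] : compact ((fun x => f x ^+ 2) @` cbox l r).
  apply: continuous_compact; last exact: compact_cbox.
  by apply: continuous_subspaceT => x; exact: (continuousM (cf x) (cf x)).
exists N; split; first exact: num_real.
by move=> y Ny x Bx; apply: Nf => //; exists x.
Qed.

Lemma Ck_slice n N (g : 'rV[R]_n.+1 -> R) s :
  Ck N g -> Ck N (fun p : 'rV[R]_n => g (cons_rV (s, p))).
Proof.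
have cs (h : 'rV[R]_n.+1 -> R) : continuous h ->
    continuous (fun p : 'rV[R]_n => h (cons_rV (s, p))).
  move=> ch p; apply: (@continuous_comp _ _ _ (fun p => cons_rV (s, p)) h).
    exact: continuous_cons_r.
  exact: ch.
elim: N g => [|N IHN] g Cg; split; try exact/cs/(Ck_continuous Cg).
  by [].
move=> i; have [dg Cdg] := Ck_partial (lift ord0 i) Cg.
split=> [p|]; first exact: derivable_cons_r.
by rewrite partial_cons; exact: IHN.
Qed.

(** Some slice is no worse than the average up to d: otherwise F would be at least (T + d) / (b - a)
    everywhere, with an integral of at least T + d > T. *)
Lemma good_slice (F : R -> \bar R) (a b d : R) : a < b -> 0 < d ->
  measurable_fun `[a, b]%classic F -> (forall s, 0 <= F s)%E ->
  (\int[mu]_(s in `[a, b]) F s < +oo)%E ->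
  exists2 s, s \in `[a, b]%R &
    ((b - a)%:E * F s <= \int[mu]_(t in `[a, b]) F t + d%:E)%E.
Proof.
move=> ab d0 mF F0 fin; apply: contrapT => nex.
pose T := fine (\int[mu]_(t in `[a, b]) F t).
have TE : T%:E = (\int[mu]_(t in `[a, b]) F t)%E.
  by rewrite fineK// ge0_fin_numE//; apply: integral_ge0.
have ba0 : 0 < b - a by rewrite subr_gt0.
have lb s : s \in `[a, b]%R -> (((T + d) / (b - a))%:E <= F s)%E.
  move=> sab; rewrite leNgt; apply/negP => Fs; apply: nex; exists s => //.
  rewrite -TE -EFinD; move: (F0 s) Fs; case: (F s) => // x x0.
  rewrite lte_fin -EFinM lee_fin => /ltW; by rewrite ler_pdivlMr// mulrC.
have T0 : 0 <= T by rewrite -lee_fin TE; apply: integral_ge0.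
have : (\int[mu]_(s in `[a, b]) ((T + d) / (b - a))%:E <= T%:E)%E.
  rewrite TE; apply: ge0_le_integral => //.
  by move=> x _; rewrite lee_fin; apply: divr_ge0; [apply: addr_ge0 => //|]; exact: ltW.
rewrite integral_cst//= lebesgue_measure_itv/= lte_fin ab -EFinB -EFinM lee_fin.
by rewrite divfK ?gt_eqF// gerDl leNgt d0.
Qed.

Lemma continuous_freeze n (g : 'rV[R]_n.+1 -> R) s : continuous g ->
  continuous (fun x => g (cons_rV (s, (uncons_rV x).2))).
Proof.
move=> cg x; apply: (@continuous_comp _ _ _ (fun x => cons_rV (s, (uncons_rV x).2)) g);
  last exact: cg.
move=> A /nbhs_ballP[e /= e0 eA]; apply/nbhs_ballP; exists e => //= y [_ xy].
apply: eA; split=> // i j; rewrite !(ord1 i) !mxE.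
by case: unliftP => [m|] _ /=; [rewrite !mxE; exact: xy|exact: ballxx].
Qed.

Section slice_ip.
Context {n : nat} (l r : 'I_n.+1 -> R).
Local Notation K := (cbox l r).
Local Notation K' := (cbox (l \o lift ord0) (r \o lift ord0)).
Local Notation muS := (lebesgue_rV R n.+1).
Local Notation mun := (lebesgue_rV R n).

Let csqr (f : 'rV[R]_n.+1 -> R) : continuous f -> measurable_fun setT (fun x => f x ^+ 2).
Proof. by move=> cf; apply: measurable_funX; exact: continuous_measurable_rV. Qed.

Let slice_cont (f : 'rV[R]_n.+1 -> R) s : continuous f ->
  continuous (fun p : 'rV[R]_n => f (cons_rV (s, p))).
Proof.
move=> cf p; apply: (@continuous_comp _ _ _ (fun p => cons_rV (s, p)) f).
  exact: continuous_cons_r.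
exact: cf.
Qed.

Lemma ip_slice (f : 'rV[R]_n.+1 -> R) : continuous f -> ((iprod muS K f f)%:E =
  \int[mu]_(s in `[l ord0, r ord0])
    (iprod mun K' (fun p => f (cons_rV (s, p))) (fun p => f (cons_rV (s, p))))%:E)%E.
Proof.
move=> cf; rewrite (ip_integral (measurable_cbox _ _) (cbox_L2 _ _ cf)).
rewrite (ge0_integral_cbox l r (csqr cf)); last by move=> x; exact: sqr_ge0.
apply: eq_integral => s _.
by rewrite (ip_integral (measurable_cbox _ _) (cbox_L2 _ _ (@slice_cont f s cf))).
Qed.

Lemma ip_sliceC (f : 'rV[R]_n.+1 -> R) : continuous f -> ((iprod muS K f f)%:E =
  \int[mun]_(p in K') \int[mu]_(s in `[l ord0, r ord0])
    (f (cons_rV (s, p)) ^+ 2)%:E)%E.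
Proof.
move=> cf; rewrite (ip_integral (measurable_cbox _ _) (cbox_L2 _ _ cf)).
by rewrite (ge0_integral_cboxC l r (csqr cf))// => x; exact: sqr_ge0.
Qed.

Lemma measurable_ip_slice (f : 'rV[R]_n.+1 -> R) : continuous f ->
  measurable_fun `[l ord0, r ord0]%classic (fun s : R =>
    (iprod mun K' (fun p => f (cons_rV (s, p))) (fun p => f (cons_rV (s, p))))%:E).
Proof.
move=> cf; have := measurable_slice_integral (l := l) (r := r) (csqr cf) (fun x => sqr_ge0 _).
apply: eq_measurable_fun => s _.
by rewrite (ip_integral (measurable_cbox _ _) (cbox_L2 _ _ (@slice_cont f s cf))).
Qed.

(** The error of replacing the first coordinate by s0. On each line [sqr_increment_le] gives one
    factor L, the length of the side, and integration over that line gives the other. *)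
Lemma ip_freeze_le (g : 'rV[R]_n.+1 -> R) s0 : Ck 1 g -> l ord0 < r ord0 ->
  s0 \in `[l ord0, r ord0]%R ->
  iprod muS K (fun x => g x - g (cons_rV (s0, (uncons_rV x).2)))
           (fun x => g x - g (cons_rV (s0, (uncons_rV x).2))) <=
  (r ord0 - l ord0) ^+ 2 * iprod muS K (partial ord0 g) (partial ord0 g).
Proof.
move=> Cg lr s0I; have cg := Ck_continuous Cg.
have [dg /Ck_continuous cdg] := Ck_partial ord0 Cg.
set L := r ord0 - l ord0; have L0 : 0 <= L by rewrite subr_ge0 ltW.
have cfr := continuous_freeze (s := s0) cg.
have cd : continuous (fun x => g x - g (cons_rV (s0, (uncons_rV x).2))).
  by move=> x; apply: continuousB; [exact: cg|exact: cfr].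
rewrite -lee_fin EFinM !ip_sliceC//.
have mH := measurable_slice_integralC (l := l) (r := r) (csqr cdg) (fun x => sqr_ge0 _).
have H0 p : (0 <= \int[mu]_(s in `[l ord0, r ord0]) (partial ord0 g (cons_rV (s, p)) ^+ 2)%:E)%E.
  by apply: integral_ge0 => s _; rewrite lee_fin sqr_ge0.
rewrite -ge0_integralZl//; last 2 first.
- exact: measurable_cbox.
- by rewrite lee_fin sqr_ge0.
apply: ge0_le_integral => //.
- exact: measurable_cbox.
- by move=> p _; apply: integral_ge0 => s _; rewrite lee_fin sqr_ge0.
- exact: measurable_slice_integralC (csqr cd) (fun x => sqr_ge0 _).
- by apply: measurable_funeM.
move=> p _; rewrite expr2 EFinM -muleA.
apply: (@le_trans _ _ (\int[mu]_(s in `[l ord0, r ord0])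
  (L%:E * \int[mu]_(s in `[l ord0, r ord0]) (partial ord0 g (cons_rV (s, p)) ^+ 2)%:E))%E).
  apply: ge0_le_integral => //.
  - by move=> s _; rewrite lee_fin sqr_ge0.
  - apply/measurable_EFinP; apply: measurable_funX.
    apply: subspace_continuous_measurable_fun => //; apply: continuous_subspaceT => s.
    apply: (@continuous_comp _ _ _ (fun s => cons_rV (s, p))
      (fun x => g x - g (cons_rV (s0, (uncons_rV x).2)))); last exact: cd.
    exact: continuous_cons_l.
  - move=> s sI; rewrite cons_rVK/=.
    have dsl t : derivable (fun s => g (cons_rV (s, p))) t 1.
      by apply: derivable_cons_l; exact: dg.
    have := sqr_increment_le dsl _ (ltW lr) sI s0I; rewrite derive1_cons; apply => t.
    apply: (@continuous_comp _ _ _ (fun s => cons_rV (s, p)) (partial ord0 g)).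
      exact: continuous_cons_l.
    exact: cdg.
rewrite integral_cst//= lebesgue_measure_itv/= lte_fin lr -EFinB.
by rewrite muleC.
Qed.

End slice_ip.

(** By induction on the dimension: g is compared with its slice at a well chosen s0, and the slice
    with a constant. The constant 2 L^2 + 2 P' comes from the square of a sum of these two errors.
    The slack d, on which c may depend, is the price of choosing s0 by averaging. *)
Lemma poincare n (l r : 'I_n -> R) : (forall i, l i < r i) ->
  exists2 P, 0 <= P & forall g : 'rV[R]_n -> R, Ck 1 g -> forall d, 0 < d -> exists c,
    iprod (lebesgue_rV R n) (cbox l r) (fun x => g x - c) (fun x => g x - c) <=
    P * (\sum_i iprod (lebesgue_rV R n) (cbox l r) (partial i g) (partial i g)) + d.
Proof.
elim: n l r => [|n IHn] l r lr.
  exists 0 => // g _ d d0; exists (g 0); rewrite mul0r add0r ltW//.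
  rewrite (_ : (fun x => g x - g 0) = fun=> 0); last first.
    by apply/funext => x; rewrite (_ : x = 0) ?subrr//; apply/rowP => -[].
  rewrite /iprod; under eq_Rintegral do rewrite mul0r.
  by rewrite /Rintegral integral0.
have [P' P'0 IH] := IHn _ _ (fun i => lr (lift ord0 i)).
set L := r ord0 - l ord0; have L0 : 0 < L by rewrite subr_gt0.
exists (2 * L ^+ 2 + 2 * P').
  by apply: addr_ge0; apply: mulr_ge0 => //; exact: sqr_ge0.
move=> g Cg d d0.
set K := cbox l r; set K' := cbox (l \o lift ord0) (r \o lift ord0) in IH *.
have cg := Ck_continuous Cg.
have cdg i : continuous (partial i g) by have [_ /Ck_continuous] := Ck_partial i Cg.
(* [good_slice] and the induction hypothesis are each used with slack e = d / M; these enter the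
   final bound as 2 P' e and 2 L e, whose sum is d. *)
have [M ME] : {M | M = 2 * (P' + L)} by exists (2 * (P' + L)).
have M0 : 0 < M by rewrite ME; apply: mulr_gt0 => //; exact: ltr_wpDl.
have e0 : 0 < d / M by exact: divr_gt0.
pose S j s := iprod (lebesgue_rV R n) K' (fun p => partial (lift ord0 j) g (cons_rV (s, p)))
  (fun p => partial (lift ord0 j) g (cons_rV (s, p))).
pose T := \sum_j iprod (lebesgue_rV R n.+1) K (partial (lift ord0 j) g) (partial (lift ord0 j) g).
have FT : (\int[mu]_(s in `[l ord0, r ord0]) (\sum_j S j s)%:E = T%:E)%E.
  under eq_integral do rewrite -sumEFin.
  rewrite ge0_integral_sum//; last 2 first.
  - by move=> j; exact: measurable_ip_slice.
  - by move=> j s _; rewrite lee_fin ip_ge0.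
  by rewrite /T -sumEFin; apply: eq_bigr => j _; rewrite -ip_slice.
have mS : measurable_fun `[l ord0, r ord0]%classic (fun s : R => (\sum_j S j s)%:E).
  rewrite (_ : (fun s => _) = fun s => (\sum_j (S j s)%:E)%E); last first.
    by apply/funext => s; rewrite sumEFin.
  by apply: emeasurable_sum => j; exact: measurable_ip_slice.
have S0 s : (0 <= (\sum_j S j s)%:E)%E.
  by rewrite lee_fin; apply: sumr_ge0 => j _; exact: ip_ge0.
have Sfin : (\int[mu]_(s in `[l ord0, r ord0]) (\sum_j S j s)%:E < +oo)%E.
  by rewrite FT ltry.
have [s0 s0I] := good_slice (lr ord0) e0 mS S0 Sfin.
rewrite FT -EFinM -EFinD lee_fin -/L => Hs0.
have [c Hc] := IH _ (Ck_slice s0 Cg) _ e0.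
have cfr := continuous_freeze (s := s0) cg.
have LK f : continuous f -> L2fun (lebesgue_rV R n.+1) K f by exact: cbox_L2.
exists c.
have L1 : L2fun (lebesgue_rV R n.+1) K (fun x => g x - g (cons_rV (s0, (uncons_rV x).2))).
  by apply: LK => x; apply: continuousB; [exact: cg|exact: cfr].
have L2' : L2fun (lebesgue_rV R n.+1) K (fun x => g (cons_rV (s0, (uncons_rV x).2)) - c).
  by apply: LK => x; apply: continuousB; [exact: cfr|exact: cst_continuous].
have := ip_sqrD_le (measurable_cbox _ _) L1 L2'.
rewrite (_ : (fun x => _ + _) = fun x => g x - c); last first.
  by apply/funext => x; rewrite addrA subrK.
move=> /le_trans; apply.
have H1 := ip_freeze_le Cg (lr ord0) s0I.
have H2 : iprod (lebesgue_rV R n.+1) K (fun x => g (cons_rV (s0, (uncons_rV x).2)) - c)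
    (fun x => g (cons_rV (s0, (uncons_rV x).2)) - c) =
    L * iprod (lebesgue_rV R n) K' (fun p => g (cons_rV (s0, p)) - c)
    (fun p => g (cons_rV (s0, p)) - c).
  apply: EFin_inj; rewrite ip_slice; last first.
    by move=> x; apply: continuousB; [exact: cfr|exact: cst_continuous].
  transitivity (\int[mu]_(s in `[l ord0, r ord0])
    (iprod (lebesgue_rV R n) K' (fun p => g (cons_rV (s0, p)) - c)
      (fun p => g (cons_rV (s0, p)) - c))%:E)%E.
    by apply: eq_integral => s _; congr (iprod _ _ _ _)%:E; apply/funext => p; rewrite cons_rVK.
  by rewrite integral_cst//= lebesgue_measure_itv/= lte_fin lr -EFinB muleC.
rewrite H2 big_ord_recl /=.
have ES : \sum_j iprod (lebesgue_rV R n) K' (partial j (fun p => g (cons_rV (s0, p))))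
    (partial j (fun p => g (cons_rV (s0, p)))) = \sum_j S j s0.
  by apply: eq_bigr => j _; rewrite partial_cons.
rewrite ES in Hc.
move: H1 Hc; rewrite -/L -/T.
set h := iprod _ _ (partial ord0 g) _; set a1 := iprod _ _ _ _; set a2 := iprod _ _ _ _.
have h0 : 0 <= h by exact: ip_ge0.
have T0 : 0 <= T by apply: sumr_ge0 => j _; exact: ip_ge0.
move=> H1 Hc.
have HH : L * a2 <= P' * (T + d / M) + L * (d / M).
  apply: (le_trans (ler_wpM2l (ltW L0) Hc)); rewrite mulrDr lerD2r mulrCA.
  by rewrite ler_wpM2l.
have M1 : M != 0 by rewrite gt_eqF.
have dM : d = M * (d / M).
  by rewrite mulrC divfK.
rewrite {}dM; move: (d / M) HH => e; rewrite ME => HH.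
have LT : 0 <= L ^+ 2 * T := mulr_ge0 (sqr_ge0 _) T0.
have Ph : 0 <= P' * h := mulr_ge0 P'0 h0.
clear -H1 HH LT Ph; clearbody L T h a1 a2; lra.
Qed.

End poincare.

(** * The equality case *)

Section uniqueness.
Context {R : realType} {n : nat} (k : nat).
Hypotheses (k_gt0 : (0 < k)%N) (kn : (k <= n)%N).
Local Notation Om := (@orthant R n k).
Local Notation mu := (lebesgue_rV R n).
Local Notation N := ((n + 2 * k)%:R : R).

Let mOm : measurable Om := measurable_orthant k.

(** The squared distance from v to a constant is a quadratic in the constant, minimal at the mean s
    / w. If it tends to 0 along c m, the minimum is 0; convergence of c m is not assumed. *)
Lemma ae_cst_of_approx (l r : 'I_n -> R) (v : 'rV[R]_n -> R) (c : nat -> R) :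
  (forall i, l i < r i) -> L2fun mu (cbox l r) v ->
  iprod mu (cbox l r) (fun x => v x - c m) (fun x => v x - c m) @[m --> \oo] --> 0 ->
  exists a, {ae mu, forall x, cbox l r x -> v x = a}.
Proof.
move=> lr Lv vc; set K := cbox l r; have mK : measurable K := measurable_cbox l r.
have L1 (a : R) : L2fun mu K (cst a) by apply: cbox_L2; exact: cst_continuous.
set w := iprod mu K (cst 1) (cst 1).
have w0 : 0 < w.
  rewrite -lte_fin ip_integral//; under eq_integral do rewrite expr1n.
  by rewrite integral_cst// mul1e; exact: cbox_gt0.
set s := iprod mu K v (cst 1).
have E a : iprod mu K (fun x => v x - a) (fun x => v x - a) =
    iprod mu K v v - 2 * a * s + a ^+ 2 * w.
  rewrite (@ip_sqrB _ _ _ _ _ mK v (cst a))//.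
  have aE : cst a = (fun x : 'rV[R]_n => a * (cst 1 : _ -> R) x) by apply/funext => x; rewrite mulr1.
  have E1 : iprod mu K v (cst a) = a * s by rewrite aE ipZr.
  have E2 : iprod mu K (cst a) (cst a) = a ^+ 2 * w.
    by rewrite [X in iprod _ _ X _]aE ipZl// [X in iprod _ _ _ X]aE ipZr// mulrA.
  by rewrite E1 E2; ring.
exists (s / w).
suff Z : iprod mu K (fun x => v x - s / w) (fun x => v x - s / w) = 0.
  have Lvs : L2fun mu K (fun x => v x - s / w) by exact: L2B (L1 (s / w)).
  have := ip_eq0 mK Lvs Z; apply: filterS => x H Kx.
  by apply/eqP; rewrite -subr_eq0; apply/eqP; exact: H.
apply/eqP; rewrite eq_le ip_ge0 andbT.
apply: (cvgr_to_ge vc); near=> m; rewrite !E -subr_ge0.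
rewrite (_ : _ - _ = w * (c m - s / w) ^+ 2); last by field; rewrite gt_eqF.
by apply: mulr_ge0; [exact: ltW|exact: sqr_ge0].
Unshelve. all: by end_near. Qed.

Lemma cbox_orthant (l r : 'I_n -> R) : (forall i : 'I_n, (n - k <= i)%N -> 0 < l i) ->
  cbox l r `<=` Om.
Proof.
move=> l0 x Kx i ki; have := Kx i; rewrite /= in_itv/= => /andP[+ _].
by apply: lt_le_trans; exact: l0.
Qed.

Section box.
Variables (u : 'rV[R]_n -> R) (Du : 'rV[R]_n -> 'rV[R]_n) (f_ : nat -> 'rV[R]_n -> R).
Hypothesis H : approx k u Du f_.
Variable b : R.
Hypothesis ground0 : ground_sq k b (f_ m) @[m --> \oo] --> 0.
Local Notation G := (extr k b : 'rV[R]_n -> R).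

(** On the box G >= D > 0, so restriction to the box and division by G cost at most a factor D^-2.
    This turns the remainder, which tends to 0, into a bound for the gradient of f_m / G, to which
    the Poincare inequality is applied with slack 1 / (m + 1). *)
Lemma ae_extr_box (l r : 'I_n -> R) : (forall i, l i < r i) ->
  (forall i : 'I_n, (n - k <= i)%N -> 0 < l i) ->
  exists a, {ae mu, forall x, cbox l r x -> u x = a * G x}.
Proof.
move=> lr l0; set K := cbox l r; have mK : measurable K := measurable_cbox l r.
have KO : K `<=` Om := cbox_orthant l0.
have cG : continuous (G : 'rV[R]_n -> R) := Ck_continuous (Ck_extr k 0 b).
have [D D0 GD] : exists2 D : R, 0 < D & forall x, K x -> D <= G x.
  have K0 : K !=set0.
    by exists (\row_i l i) => i; rewrite /= mxE in_itv/= lexx ltW.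
  have [x xK xG] := compact_EVT_min K0 (@compact_cbox R n l r) (continuous_subspaceT cG).
  exists (G x); first by apply: extr_gt0; apply: KO; rewrite inE in xK.
  by move=> y Ky; apply: xG; rewrite inE.
pose g m x := f_ m x / G x.
have tg m : test k (g m).
  have [K' sf Cf] := approx_test H m; have [cK' KO' f0] := sf.
  exists K'; first by split=> // x /f0; rewrite /g => ->; rewrite mul0r.
  move=> M; apply: (Ck_div (csupp_closed sf) f0) => //; last exact: Ck_extr.
  by move=> x /KO' /(extr_gt0 b) /gt_eqF ->.
have Cg m : Ck 1 (g m) by have [? _] := tg m.
have [P P0 HP] := poincare lr.
have /choice[c Hc] m : exists c, iprod mu K (fun x => g m x - c) (fun x => g m x - c) <=
    P * (\sum_i iprod mu K (partial i (g m)) (partial i (g m))) + m.+1%:R^-1.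
  by apply: HP => //; rewrite invr_gt0.
have LK f : continuous f -> L2fun mu K f by exact: cbox_L2.
have Lgm m : L2fun mu K (g m) by apply: LK; exact: Ck_continuous (Cg m).
have LuK : L2fun mu K u := L2S mOm mK KO (approx_L2 H).
have div_le (h : 'rV[R]_n -> R) : L2fun mu K h -> L2fun mu K (fun x => h x / G x) /\
   iprod mu K (fun x => h x / G x) (fun x => h x / G x) <= D ^- 2 * iprod mu K h h.
  move=> Lh.
  (* The maximum with D makes the reciprocal continuous on the whole space without changing it on K;
     this gives measurability. *)
  have cM : continuous (fun x : 'rV[R]_n => (Num.max (G x) D)^-1).
    have cm : continuous (fun x : 'rV[R]_n => Num.max (G x) D).
      by move=> x; apply: continuous_max; [exact: cG|exact: cst_continuous].
    move=> x; apply: (continuousV _ (cm x)).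
    by rewrite gt_eqF// lt_max D0 orbT.
  have mhG : measurable_fun K (fun x => h x / G x).
    apply: (@eq_measurable_fun _ _ _ _ _ (fun x => h x * (Num.max (G x) D)^-1)).
      by move=> x; rewrite inE => /GD DG; rewrite max_l.
    by apply: measurable_funM; [case: Lh|exact: continuous_measurable_rV].
  have le : (\int[mu]_(x in K) ((h x / G x) ^+ 2)%:E <= (D ^- 2 * iprod mu K h h)%:E)%E.
    rewrite EFinM ip_integral// -ge0_integralZl//; last 3 first.
    - by apply/measurable_EFinP; apply: measurable_funX; case: Lh.
    - by move=> x _; rewrite lee_fin sqr_ge0.
    - by rewrite lee_fin invr_ge0 sqr_ge0.
    apply: ge0_le_integral => //.
    - by move=> x _; rewrite lee_fin sqr_ge0.
    - by apply/measurable_EFinP; exact: measurable_funX.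
    - apply: measurable_funeM; apply/measurable_EFinP; apply: measurable_funX.
      by case: Lh.
    - move=> x /GD DG; rewrite -EFinM lee_fin expr_div_n mulrC.
      rewrite ler_wpM2r ?sqr_ge0// lef_pV2 ?posrE ?exprn_gt0//; last exact: lt_le_trans DG.
      by rewrite ler_pXn2r// nnegrE; [exact: ltW|exact: le_trans (ltW D0) DG].
  have LhG : L2fun mu K (fun x => h x / G x).
    by apply: L2_fin => //; apply: le_lt_trans le (ltry _).
  by split=> //; rewrite -lee_fin ip_integral.
have Lv := (div_le _ LuK).1.
have [a Ha] : exists a, {ae mu, forall x, cbox l r x -> u x / G x = a}.
  apply: (ae_cst_of_approx (c := c) lr Lv).
  (* The two halves bound the terms of u / G - c = - (f_m - u) / G + (f_m / G - c). *)
  pose e m := 2 * (D ^- 2 * iprod mu Om (fun x => f_ m x - u x) (fun x => f_ m x - u x)) +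
    2 * (P * (D ^- 2 * ground_sq k b (f_ m)) + m.+1%:R^-1).
  apply: (@cvg0_squeeze _ _ e) => [m|]; last first.
    rewrite [X in _ --> X](_ : _ = 2 * (D ^- 2 * 0) + 2 * (P * (D ^- 2 * 0) + 0)); last by ring.
    apply: cvgD; apply: cvgMl_tmp; first by apply: cvgMl_tmp; exact: approx_cvg H.
    apply: cvgD; last exact: cvg_harmonic.
    by do 2 apply: cvgMl_tmp.
  rewrite ip_ge0/=.
  have Lfu : L2fun mu K (fun x => f_ m x - u x).
    apply: (L2S mOm mK KO); apply: L2B => //; last exact: approx_L2 H.
    exact: test_L2 (approx_test H m).
  have [Ld led] := div_le _ Lfu.
  have Lgc : L2fun mu K (fun x => g m x - c m).
    by apply: L2B => //; apply: cbox_L2; exact: cst_continuous.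
  have -> : iprod mu K (fun x => u x / G x - c m) (fun x => u x / G x - c m) =
      iprod mu K (fun x => (-1) * ((f_ m x - u x) / G x) + (g m x - c m))
              (fun x => (-1) * ((f_ m x - u x) / G x) + (g m x - c m)).
    by congr iprod; apply/funext => x; rewrite /g; ring.
  apply: (le_trans (ip_sqrD_le mK (L2Z mK (-1) Ld) Lgc)).
  rewrite ipZl// ?ipZr//; last exact: L2Z.
  rewrite !mulN1r opprK /e; apply: lerD; rewrite ler_pM2l//.
    apply: (le_trans led); rewrite ler_pM2l ?exprn_gt0 ?invr_gt0 ?exprn_gt0//.
    by apply: ipS_le => //; apply: L2B => //; [exact: test_L2 (approx_test H m)|exact: approx_L2 H].
  apply: (le_trans (Hc m)); rewrite lerD2r ler_wpM2l//.
  rewrite mulr_sumr; apply: ler_sum => i _.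
  (* These are the functions whose squares make up [ground_sq]; dividing by G leaves the derivatives
     of g. *)
  have tgi : test k (fun x => G x * partial i (g m) x).
    have [K' sg Cdg] := test_partial i (tg m).
    exists K'; first exact: csuppMr.
    by move=> M; apply: CkM => //; exact: Ck_extr.
  have Lgi := L2S mOm mK KO (test_L2 tgi).
  have [_] := div_le _ Lgi.
  rewrite (_ : iprod mu K (fun x => _ / _) _ = iprod mu K (partial i (g m)) (partial i (g m))).
    move=> /le_trans; apply; rewrite ler_pM2l ?exprn_gt0 ?invr_gt0 ?exprn_gt0//.
    by apply: ipS_le => //; exact: test_L2.
  by apply: eq_ip => x; rewrite inE => /KO /(extr_gt0 b) G0; rewrite mulrC mulKf// gt_eqF.
exists a; apply: filterS Ha => x Hx Kx; rewrite -(Hx Kx) divfK//.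
by rewrite gt_eqF//; apply: extr_gt0; exact: KO.
Qed.

(** Boxes that exhaust the orthant and all contain the one of index 0. The lower bound 1 / (j + 2)
    keeps that box nondegenerate: its sides on positive coordinates are [1/2, 1]. *)
Let lo j (i : 'I_n) : R := if (n - k <= i)%N then j.+2%:R^-1 else - j.+1%:R.
Let hi j (i : 'I_n) : R := j.+1%:R.

Let lo_gt0 j (i : 'I_n) : (n - k <= i)%N -> 0 < lo j i.
Proof. by rewrite /lo => ->; rewrite invr_gt0. Qed.

Let lo_hi j i : lo j i < hi j i.
Proof.
rewrite /lo /hi; case: ifP => _.
  apply: (@lt_le_trans _ _ 1); last by rewrite ler1n.
  by rewrite invf_lt1 ?ltr1n ?ltr0n.
by apply: (@lt_trans _ _ 0); rewrite ?oppr_lt0 ltr0n.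
Qed.

Let box_nondecreasing j : cbox (lo 0) (hi 0) `<=` cbox (lo j) (hi j).
Proof.
move=> x Kx i; have := Kx i; rewrite /= !in_itv/= => /andP[lx xh].
apply/andP; split; last by rewrite (le_trans xh)// /hi ler_nat.
apply: le_trans lx; rewrite /lo; case: ifP => _.
  by rewrite lef_pV2 ?posrE// ler_nat.
by rewrite lerN2 ler_nat.
Qed.

Let bigcup_box x : Om x -> exists j, cbox (lo j) (hi j) x.
Proof.
(* M bounds the coordinates and their reciprocals at once; the inverse of 0 is 0, which is harmless
   for the full-line coordinates. *)
move=> Ox; pose M := \sum_i (`|x ord0 i| + `|x ord0 i|^-1).
have t0 i : 0 <= `|x ord0 i| + `|x ord0 i|^-1 by rewrite addr_ge0// invr_ge0.
have Mi i : `|x ord0 i| + `|x ord0 i|^-1 <= M.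
  by rewrite /M (bigD1 i)//= lerDl sumr_ge0.
have M0 : 0 <= M by exact: sumr_ge0.
have Mj := archi_boundP M0; set j := Num.bound M in Mj; exists j => i.
have jS : j%:R <= j.+1%:R :> R by rewrite ler_nat.
have : `|x ord0 i| <= j.+1%:R.
  apply: le_trans jS; apply: le_trans (ltW Mj); apply: le_trans (Mi i).
  by rewrite lerDl invr_ge0.
rewrite ler_norml /= in_itv/= /lo /hi => /andP[xl ->]; rewrite andbT.
case: ifP => // ki; have x0 := Ox i ki.
rewrite -[leRHS]invrK lef_pV2 ?posrE ?invr_gt0//.
rewrite -(gtr0_norm x0); apply: (@le_trans _ _ j%:R); last by rewrite ler_nat leqW.

by apply: le_trans (ltW Mj); apply: le_trans (Mi i); rewrite lerDr.
Qed.

(** The constants found on the boxes agree, since all boxes contain the one of index 0, which has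
    positive measure and on which G > 0. The exceptional null sets are countably many. *)
Lemma ae_extremizer : exists a, u = extremizer k a b %[ae mu in Om].
Proof.
have /choice[a Ha] j : exists a, {ae mu, forall x, cbox (lo j) (hi j) x -> u x = a * G x}.
  exact: ae_extr_box (lo_hi j) (@lo_gt0 j).
have aE j : a j = a 0%N.
  apply/eqP/negPn/negP => aj.
  have : mu.-negligible (cbox (lo 0%N) (hi 0%N)).
    apply: negligibleS (negligibleU (Ha 0%N) (Ha j)) => x K0x /=.
    apply/not_andP => -[/(_ K0x) ux /(_ (@box_nondecreasing j _ K0x))].
    rewrite ux => /mulIf e; case/eqP: aj; rewrite e//.
    by rewrite gt_eqF//; apply: extr_gt0; apply: (@cbox_orthant (lo 0%N)) K0x; exact: lo_gt0.
  move/(measure_negligible (measurable_cbox _ _)) => K0.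
  by have := cbox_gt0 (lo_hi 0%N); rewrite K0 ltxx.
exists (a 0%N); rewrite extremizerE.
have /ae_foralln H0 := Ha; apply: filterS H0 => x Hx Ox.
have [j Kjx] := bigcup_box Ox.
by rewrite (Hx j Kjx) aE.
Qed.

End box.

End uniqueness.

(** * Extremizers in the completion *)

Section expinv.
Context {R : realType}.
Implicit Types (t x : R) (m j : nat).

(** The functions t^-m exp(-1/t), extended by 0 to t <= 0, form a family whose derivatives are
    linear combinations of its members, so smoothness follows by induction. *)
Definition expinv m t : R := if 0 < t then t^-1 ^+ m * expR (- t^-1) else 0.

Lemma expinv_ge0 m t : 0 <= expinv m t.
Proof.
rewrite /expinv; case: ifP => // t0; rewrite mulr_ge0 ?expR_ge0//.
by rewrite exprn_ge0// invr_ge0 ltW.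
Qed.

Lemma exprn_le_expR m x : 0 <= x -> x ^+ m <= m`!%:R * expR x.
Proof.
case: m => [|m] x0; first by rewrite expr0 mul1r -expR0 ler_expR.
have := expR_ge1Dxn m x0; rewrite -ler_pdivrMl ?ltr0n ?fact_gt0//.
by rewrite mulrC => /(le_trans _); apply; rewrite lerDr.
Qed.

(** From x^p <= p! exp(x) at x = 1/t, p = m + j. The case j = 2 gives the derivative at 0, the case
    j = 0 a global bound. *)
Lemma expinv_le m j t : 0 <= t -> expinv m t <= (m + j)`!%:R * t ^+ j.
Proof.
rewrite /expinv le_eqVlt => /predU1P[<-|t0].
  by rewrite ltxx mulr_ge0// exprn_ge0.
rewrite t0 -ler_pdivrMr ?exprn_gt0// mulrAC -exprVn -exprD expRN.
rewrite ler_pdivrMr ?expR_gt0//; apply: exprn_le_expR.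
by rewrite invr_ge0 ltW.
Qed.

Lemma expinv_le_fact m t : expinv m t <= m`!%:R.
Proof.
have [t0|t0] := leP 0 t; first by have := expinv_le m 0 t0; rewrite addn0 mulr1.
by rewrite /expinv ltNge (ltW t0).
Qed.

Lemma is_derive0_quadratic (f : R -> R) C : f 0 = 0 ->
  (forall h, `|f h| <= C * h ^+ 2) -> is_derive (0 : R) 1 f (0 : R).
Proof.
move=> f0 fC.
have C0 : 0 <= C by have := le_trans (normr_ge0 _) (fC 1); rewrite expr1n mulr1.
have c : h^-1 *: ((f \o shift 0) (h *: (1 : R)) - f 0) @[h --> 0^'] --> (0 : R).
  apply/cvgrPdist_le => e e0; have C1 : 0 < C + 1 by exact: ltr_wpDl.
  near=> h; rewrite sub0r normrN /= addr0 f0 subr0 [h *: 1]mulr1 normrM normfV.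
  have h0 : h != 0 by near: h; exact: nbhs_dnbhs_neq.
  rewrite ler_pdivrMl ?normr_gt0//; apply: le_trans (fC h) _.
  rewrite -real_normK ?num_real// expr2 mulrA mulrC ler_wpM2l//.
  have : `|h| <= e / (C + 1) by near: h; apply: dnbhs0_le; exact: divr_gt0.
  rewrite ler_pdivlMr// => /(le_trans _); apply; rewrite mulrC ler_wpM2l//.
  by rewrite lerDl.
apply: DeriveDef; last exact: cvg_lim c.
by apply/cvg_ex; exists 0.
Unshelve. all: by end_near. Qed.

Lemma is_derive_expinv m t :
  is_derive t 1 (expinv m) (expinv m.+2 t - m%:R * expinv m.+1 t).
Proof.
have [t0|t0|->] := ltgtP t 0.
- rewrite {2 3}/expinv ltNge (ltW t0)/= mulr0 subr0.
  apply: (@near_eq_is_derive _ _ _ (cst 0)).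
  near=> s; rewrite /expinv ltNge ltW//=; near: s.
  by apply: open_nbhs_nbhs; split => //; exact: open_lt.
- apply: (@near_eq_is_derive _ _ _ (fun s : R => s^-1 ^+ m * expR (- s^-1))).
    near=> s; rewrite /expinv ifT//; near: s.
    by apply: open_nbhs_nbhs; split => //; exact: open_gt.
  have tn0 : t != 0 by rewrite gt_eqF.
  have dV : is_derive t 1 (fun s : R => s^-1) (- t ^- 2).
    apply: DeriveDef; first by apply: derivableV.
    by rewrite deriveV//= derive_id /GRing.scale/= mulr1.
  have d1 := is_deriveX m dV; rewrite exprfctE in d1.
  have d2 := @is_derive1_comp _ expR (fun s => - s^-1) t _ _
    (is_derive_expR (- t^-1)) (is_deriveN dV).
  have H := is_deriveM d1 d2.
  refine (eq_rect _ (is_derive t 1 _) H _ _).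
  have E2 : t ^- 2 = t^-1 ^+ 2 by rewrite exprVn.
  rewrite /expinv t0 /GRing.scale/= E2; case: m {d1 H} => [|m].
    by rewrite !mul0r mulr0 addr0 subr0 expr0 !mul1r opprK mulrC.
  by rewrite succnK opprK !exprS; ring.
- rewrite {2 3}/expinv ltxx mulr0 subr0.
  (* A quadratic bound at 0 forces a zero derivative; the constant is that of [expinv_le] with j =
     2. *)
  apply: (@is_derive0_quadratic _ (m + 2)`!%:R); first by rewrite /expinv ltxx.
  move=> h; rewrite ger0_norm ?expinv_ge0//; have [h0|h0] := leP 0 h.
    exact: expinv_le.
  by rewrite /expinv ltNge (ltW h0)/= mulr_ge0// sqr_ge0.
Unshelve. all: by end_near. Qed.

Lemma derive1_expinv m : derive1 (expinv m) = fun t => expinv m.+2 t + - m%:R * expinv m.+1 t.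
Proof.
apply/funext => t; rewrite derive1E; have [_ ->] := is_derive_expinv m t.
by rewrite mulNr.
Qed.

Lemma Ck1_expinv N m : Ck1 N (expinv m).
Proof.
have c j : continuous (expinv j).
  move=> t; apply/differentiable_continuous/derivable1_diffP.
  by have [] := is_derive_expinv j t.
elim: N m => [|N IHN] m; split => //.
split=> [t|]; first by have [] := is_derive_expinv m t.
by rewrite derive1_expinv; apply: Ck1D => //; apply: Ck1M => //; exact: Ck1_cst.
Qed.

End expinv.

(** * Smooth truncation of the one-dimensional factors *)

Section cutoff.
Context {R : realType} (c : bool) (b : R).
Implicit Types (t M : R).

Let gauss t : R := expR (- b * t ^+ 2).
Let sig t : R := if c then t else 1.

(** The flag c tells a half-line factor from a full-line one; for c = (n - k <= i) this is
    [extr1 b i]. *)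
Definition profile t : R := sig t * gauss t.

Definition profile_deriv t : R := (c%:R - 2 * b * t * sig t) * gauss t.

(* The left cutoff vanishes for t <= M^-1 on a half-line factor and for
   t <= - M on a full-line factor; [slope] is its derivative in t. *)
Definition slope M : R := if c then M else 1.

Definition left_arg M t : R := if c then M * t - 1 else M + t.

(** The window has no plateau: exp(-1/y) tends to 1 as y tends to infinity, so both of its factors
    tend to 1 at each fixed t as M grows (with t > 0 on a half-line). *)
Definition cutoff M t : R := profile t * (expinv 0 (left_arg M t) * expinv 0 (M - t)).

Definition cutoff_deriv M t : R :=
  profile_deriv t * (expinv 0 (left_arg M t) * expinv 0 (M - t)) +
  profile t * (slope M * expinv 2 (left_arg M t) * expinv 0 (M - t) -
               expinv 0 (left_arg M t) * expinv 2 (M - t)).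

Lemma is_derive_affine (x y t : R) : is_derive t 1 (fun s : R => x * s + y) x.
Proof.
have := is_deriveD (is_deriveZ x (is_derive_id t (1 : R))) (is_derive_cst y t (1 : R)).
by rewrite addr0 [x *: 1]mulr1.
Qed.

Lemma is_derive_profile t : is_derive t 1 profile (profile_deriv t).
Proof.
rewrite /profile /profile_deriv /sig.
have dg := is_derive_gauss b t.
case: c.
  have H := is_deriveM (is_derive_id t (1 : R)) dg.
  refine (eq_rect _ (is_derive t 1 _) H _ _).
  by rewrite /GRing.scale/= /gauss; ring.
have H := is_deriveM (is_derive_cst (1 : R) t (1 : R)) dg.
refine (eq_rect _ (is_derive t 1 _) H _ _).
by rewrite /GRing.scale/= /gauss; ring.
Qed.

Lemma left_argE M t : left_arg M t = slope M * t + (if c then -1 else M).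
Proof. by rewrite /left_arg /slope; case: c; ring. Qed.

Lemma is_derive_cutoff M t : is_derive t 1 (cutoff M) (cutoff_deriv M t).
Proof.
have d1 : is_derive t 1 (fun s => expinv 0 (left_arg M s)) (slope M * expinv 2 (left_arg M t)).
  under eq_fun do rewrite left_argE; rewrite left_argE.
  have H := @is_derive1_comp _ (expinv 0) (fun s => slope M * s + (if c then -1 else M)) t _ _
    (is_derive_expinv 0 _) (is_derive_affine _ _ t).
  refine (eq_rect _ (is_derive t 1 _) H _ _).
  by rewrite mul0r subr0 mulrC.
have d2 : is_derive t 1 (fun s => expinv 0 (M - s)) (- expinv 2 (M - t)).
  have E s : M - s = - 1 * s + M by ring.
  rewrite (_ : (fun s => _) = fun s => expinv 0 (- 1 * s + M)); last first.
    by apply/funext => s; rewrite E.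
  rewrite E; have H := @is_derive1_comp _ (expinv 0) (fun s => - 1 * s + M) t _ _
    (is_derive_expinv 0 _) (is_derive_affine _ _ t).
  refine (eq_rect _ (is_derive t 1 _) H _ _).
  by rewrite mul0r subr0 mulrN1.
have H := is_deriveM (is_derive_profile t) (is_deriveM d1 d2).
refine (eq_rect _ (is_derive t 1 _) H _ _).
by rewrite /cutoff_deriv /GRing.scale/= mulrfctE; ring.
Qed.

Lemma derive1_cutoff M : derive1 (cutoff M) = cutoff_deriv M.
Proof. by apply/funext => t; rewrite derive1E; have [] := is_derive_cutoff M t. Qed.

Lemma derive1_profile : derive1 profile = profile_deriv.
Proof. by apply/funext => t; rewrite derive1E; have [] := is_derive_profile t. Qed.

Lemma Ck1_cutoff N M : Ck1 N (cutoff M).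
Proof.
have Ca x y : Ck1 N (fun t : R => x * t + y).
  exact: (Ck1D (Ck1M (Ck1_cst _ _) (Ck1_id _)) (Ck1_cst _ _)).
apply: Ck1M.
  apply: Ck1M; last exact: Ck1_gauss.
  by rewrite /sig; case: c; [exact: Ck1_id|exact: Ck1_cst].
apply: Ck1M; apply: (Ck1_comp (Ck1_expinv _ _)).
  by rewrite (funext (left_argE M)); exact: Ca.
rewrite (_ : (fun t => _) = fun t => - 1 * t + M); first exact: Ca.
by apply/funext => t; ring.
Qed.

Lemma cutoff_supp M t : 0 < M -> cutoff M t != 0 ->
  (if c then M^-1 else - M) <= t <= M.
Proof.
move=> M0; rewrite /cutoff !mulf_eq0 !negb_or => /and3P[_].
rewrite /expinv /left_arg; case: ifP => [l0 _|_]; last by rewrite eqxx.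
case: ifP => [r0 _|_]; last by rewrite eqxx.
rewrite subr_gt0 in r0; rewrite (ltW r0) andbT.
case: c l0; last by rewrite addrC -ltrBlDr sub0r => /ltW.
by rewrite subr_gt0 mulrC -ltr_pdivrMr// div1r => /ltW.
Qed.

(* On a half-line factor the slope M is absorbed by the factor t of the
   profile, as M t = (M t - 1) + 1: this bounds the derivative uniformly in M. *)
Lemma cutoff_derivE M t : (c -> 0 < t) -> cutoff_deriv M t =
  profile_deriv t * (expinv 0 (left_arg M t) * expinv 0 (M - t)) +
  gauss t * (c%:R * expinv 1 (left_arg M t) + expinv 2 (left_arg M t)) * expinv 0 (M - t)
  - profile t * expinv 0 (left_arg M t) * expinv 2 (M - t).
Proof.
move=> ct; rewrite /cutoff_deriv.
have -> : gauss t * (c%:R * expinv 1 (left_arg M t) + expinv 2 (left_arg M t)) =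
   profile t * (slope M * expinv 2 (left_arg M t)).
  rewrite /profile /slope /left_arg /sig; case: c ct => [/(_ isT)|] t0; last by rewrite mulr0n mul0r add0r !mul1r.
  rewrite mulr1n.
  have -> : t * gauss t * (M * expinv 2 (M * t - 1)) =
    gauss t * ((M * t - 1) * expinv 2 (M * t - 1) + expinv 2 (M * t - 1)) by ring.
  rewrite mul1r; congr (_ * (_ + _)); rewrite /expinv; case: ifP => [l0|_]; last by rewrite mulr0.
  by rewrite expr1 exprS expr1 !mulrA divff ?mul1r// gt_eqF.
ring.
Qed.

End cutoff.

Section gaussian.
Context {R : realType}.
Implicit Types (b t : R).

Lemma integrable_gauss b : 0 < b ->
  (@lebesgue_measure R).-integrable setT (fun t : R => (expR (- b * t ^+ 2))%:E).
Proof.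
(* exp(- b t^2) is a multiple of the centred normal density of variance 1 / (2 b). *)
move=> b0; pose s := Num.sqrt (2 * b)^-1.
have s2 : s ^+ 2 = (2 * b)^-1 by rewrite sqr_sqrtr// invr_ge0 mulr_ge0// ltW.
have s0 : s != 0 by rewrite sqrtr_eq0 -ltNge invr_gt0 mulr_gt0.
have p0 : normal_peak s != 0 by rewrite gt_eqF// normal_peak_gt0.
rewrite (_ : (fun t => _) =
    fun t => ((normal_peak s)^-1%:E * (normal_pdf 0 s t)%:E)%E).
  by apply: (integrableZl measurableT); exact: integrable_normal_pdf.
apply/funext => t; rewrite normal_pdfE// -EFinM mulKf// /normal_fun s2 subr0.
by congr (expR _)%:E; field; rewrite gt_eqF.
Qed.

Lemma expR_sqnorm n b (x : 'rV[R]_n) :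
  expR (- b * sqnorm x) = tensor (fun _ t => expR (- b * t ^+ 2)) x.
Proof. by rewrite /tensor -expR_sum -mulr_sumr. Qed.

Lemma continuous_expR_sqnorm n b : continuous (fun x : 'rV[R]_n => expR (- b * sqnorm x)).
Proof.
rewrite (funext (@expR_sqnorm n b)); apply: (@Ck_continuous _ _ 0).
by apply: Ck_tensor => i; exact: Ck1_gauss.
Qed.

Lemma integrable_expR_sqnorm n b : 0 < b ->
  (lebesgue_rV R n).-integrable setT (fun x => (expR (- b * sqnorm x))%:E).
Proof.
move=> b0; apply/integrableP; split.
  by apply/measurable_EFinP; exact: continuous_measurable_rV (@continuous_expR_sqnorm n b).
under eq_integral do rewrite gee0_abs ?lee_fin ?expR_ge0//.
elim: n => [|n IHn].
  rewrite [lebesgue_rV R 0]/= integral_dirac//; last first.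
    by apply/measurable_EFinP; exact: continuous_measurable_rV (@continuous_expR_sqnorm 0 b).
  by rewrite diracE in_setT mul1e ltry.
rewrite ge0_integral_rVS; last 2 first.
- by apply/measurable_EFinP; exact: continuous_measurable_rV (@continuous_expR_sqnorm n.+1 b).
- by move=> x; rewrite lee_fin expR_ge0.
set I := integral _ _ _ in IHn.
rewrite [X in (X < _)%E](_ : _ =
    (\int[@lebesgue_measure R]_s ((expR (- b * s ^+ 2))%:E * I))%E); last first.
  apply: eq_integral => s _; rewrite /I -ge0_integralZl//; last first.
    by apply/measurable_EFinP; exact: continuous_measurable_rV (@continuous_expR_sqnorm n b).
  apply: eq_integral => p _; rewrite -EFinM -expRD -mulrDr; congr (expR (_ * _))%:E.
  rewrite /sqnorm big_ord_recl !mxE unlift_none/=; congr (_ + _).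
  by apply: eq_bigr => i _; rewrite mxE liftK.
have I0 : (0 <= I)%E by apply: integral_ge0 => x _; rewrite lee_fin expR_ge0.
have If : I \is a fin_num by rewrite ge0_fin_numE.
rewrite -(fineK If) ge0_integralZr//; last 2 first.
- by have /integrableP[] := integrable_gauss b0.
- by rewrite lee_fin fine_ge0.
rewrite muleC; apply: lte_mul_pinfty; [by rewrite fineK|by []|].
have /integrableP[_] := integrable_gauss b0; apply: le_lt_trans.
rewrite le_eqVlt; apply/orP; left; apply/eqP; apply: eq_integral => t _.
by rewrite gee0_abs ?lee_fin ?expR_ge0.
Qed.

End gaussian.

(** * Bounds uniform in the truncation parameter, and pointwise limits *)

Section bounds.
Context {R : realType} (c : bool) (b : R).
Hypothesis b_gt0 : 0 < b.
Implicit Types (t M : R).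

(** The square root of the Gaussian. One copy absorbs polynomial factors, the other remains as an
    integrable majorant. *)
Let w t : R := expR (- (b / 2) * t ^+ 2).

Let w_ge0 t : 0 <= w t. Proof. exact: expR_ge0. Qed.

(** A common majorant of the constants below, the largest of which is (5 + 2 b) + 3 + 2 (1 + 2 / b),
    for the derivative of the cutoff. *)
Let K : R := 11 + 2 * b + 6 / b.

Lemma sqr_expR_le s : s * expR (- (b / 2) * s) <= 2 / b.
Proof.
rewrite mulNr expRN ler_pdivrMr ?expR_gt0//.
rewrite mulrC -ler_pdivrMr ?divr_gt0// invf_div.
(* The bound is y <= exp(y) at y = (b / 2) s. *)
apply: le_trans (expR_ge1Dx _); rewrite mulrC.
by rewrite lerDr.
Qed.

Let gaussE t : expR (- b * t ^+ 2) = w t * w t.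
Proof. by rewrite /w -expRD; congr expR; field. Qed.

Let w_le1 t : w t <= 1.
Proof.
rewrite /w -expR0 ler_expR mulNr oppr_le0 mulr_ge0 ?sqr_ge0//.
by rewrite divr_ge0// ltW.
Qed.

Let poly_gauss_le (x y z t : R) : 0 <= y -> 0 <= z -> `|x| <= y + z * t ^+ 2 ->
  `|x * expR (- b * t ^+ 2)| <= (y + z * (2 / b)) * w t.
Proof.
move=> y0 z0 xyz; rewrite gaussE normrM (@ger0_norm _ (w t * w t)) ?mulr_ge0//.
rewrite mulrA ler_wpM2r//; apply: le_trans (ler_wpM2r (w_ge0 t) xyz) _.
rewrite mulrDl; apply: lerD; first by rewrite ler_piMr.
by rewrite -mulrA ler_wpM2l// sqr_expR_le.
Qed.

Let abs_le_sqr (t : R) : `|t| <= 1 + 1 * t ^+ 2.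
Proof. by rewrite -real_normK ?num_real//; have := sqr_ge0 (`|t| - 1 / 2); nra. Qed.


Let gauss_le t : `|expR (- b * t ^+ 2)| <= 1 * w t.
Proof.
have := @poly_gauss_le 1 1 0 t ler01 (lexx _).
by rewrite normr1 !mul0r addr0 mul1r => /(_ (lexx _)).
Qed.

Let bound_ge0 : 0 < b^-1. Proof. by rewrite invr_gt0. Qed.

Let profile_le1 t : `|profile c b t| <= (1 + 1 * (2 / b)) * w t.
Proof.
apply: poly_gauss_le => //.
by case: c; rewrite ?abs_le_sqr// normr1 mul1r lerDl sqr_ge0.
Qed.

Let profile_deriv_le1 t : `|profile_deriv c b t| <= (5 + 2 * b) * w t.
Proof.
have -> : 5 + 2 * b = (1 + 2 * b) + (2 * b) * (2 / b).
  by field; rewrite gt_eqF.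
have b0 := ltW b_gt0; have b20 : 0 <= 2 * b by rewrite mulr_ge0.
apply: poly_gauss_le => //; first by rewrite addr_ge0.
apply: le_trans (ler_normB _ _) _; rewrite -addrA; apply: lerD.
  by case: c; rewrite ?normr1// normr0.
rewrite -mulrA normrM (ger0_norm b20) -[X in X + _]mulr1 -mulrDr ler_wpM2l//.
case: c; first by rewrite -expr2 ger0_norm ?sqr_ge0// lerDr.
by rewrite mulr1; apply: le_trans (abs_le_sqr t) _; rewrite mul1r.
Qed.

Let expinv_norm_le m (t : R) : `|expinv m t| <= m`!%:R.
Proof. by rewrite ger0_norm ?expinv_ge0// expinv_le_fact. Qed.

Let normM_le (x y p q : R) : 0 <= p -> `|x| <= p -> `|y| <= q -> `|x * y| <= p * q.
Proof. by move=> p0 xp yq; rewrite normrM ler_pM. Qed.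

Let cutoff_weight_le M t : `|expinv 0 (left_arg c M t) * expinv 0 (M - t)| <= 1.
Proof. by have := normM_le ler01 (expinv_norm_le 0 _) (expinv_norm_le 0 _); rewrite mulr1; apply. Qed.

Let le_K (d t : R) (x : R) : d <= K -> `|x| <= d * w t -> `|x| <= K * w t.
Proof. by move=> dK /le_trans; apply; rewrite ler_wpM2r. Qed.

(** C does not depend on M, as dominated convergence requires. For the derivative of the cutoff this
    rests on [cutoff_derivE], whence the condition t > 0 on a half-line factor. *)
Lemma profile_bound : exists2 C : R, 0 <= C & forall t, (c -> 0 < t) ->
  [/\ `|profile c b t| <= C * expR (- (b / 2) * t ^+ 2),
      `|profile_deriv c b t| <= C * expR (- (b / 2) * t ^+ 2),
      forall M, `|cutoff c b M t| <= C * expR (- (b / 2) * t ^+ 2) &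
      forall M, `|cutoff_deriv c b M t| <= C * expR (- (b / 2) * t ^+ 2)].
Proof.
have b0 := b_gt0; have c0 := bound_ge0.
exists K; first by rewrite /K; lra.
move=> t ct; split.
- by apply: le_K (profile_le1 t); rewrite /K; lra.
- by apply: le_K (profile_deriv_le1 t); rewrite /K; lra.
- move=> M; apply: (@le_K (1 + 1 * (2 / b))); first by rewrite /K; lra.
  rewrite -[leRHS]mulr1; apply: normM_le (profile_le1 t) (cutoff_weight_le M t).
  by apply: mulr_ge0 => //; lra.
- move=> M; rewrite cutoff_derivE//.
  apply: (@le_K ((5 + 2 * b) + 3 + 2 * (1 + 1 * (2 / b)))); first by rewrite /K; lra.
  have H1 : `|profile_deriv c b t * (expinv 0 (left_arg c M t) * expinv 0 (M - t))|
      <= (5 + 2 * b) * w t.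
    rewrite -[leRHS]mulr1; apply: normM_le (profile_deriv_le1 t) (cutoff_weight_le M t).
    by apply: mulr_ge0 => //; lra.
  have H2 : `|expR (- b * t ^+ 2) * (c%:R * expinv 1 (left_arg c M t) +
      expinv 2 (left_arg c M t)) * expinv 0 (M - t)| <= 3 * w t.
    rewrite -[leRHS]mulr1; apply: normM_le (expinv_norm_le 0 _); first by rewrite mulr_ge0.
    rewrite [leRHS]mulrC -[w t]mul1r; apply: normM_le (gauss_le t) _; first by rewrite mul1r.
    apply: le_trans (ler_normD _ _) _; rewrite (_ : 3 = 1 * 1 + 2 :> R); last by ring.
    apply: lerD (expinv_norm_le 2 _); apply: normM_le (expinv_norm_le 1 _) => //.
    by case: c; rewrite ?normr1 ?normr0.
  have H3 : `|profile c b t * expinv 0 (left_arg c M t) * expinv 2 (M - t)| <=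
      2 * (1 + 1 * (2 / b)) * w t.
    rewrite -mulrA mulrC -[leRHS]mulrA.
    apply: normM_le (profile_le1 t) => //.
    rewrite -[2]mul1r; exact: normM_le (expinv_norm_le 0 _) (expinv_norm_le 2 _).
  apply: le_trans (ler_normB _ _) _; rewrite mulrDl; apply: lerD H3.
  by apply: le_trans (ler_normD _ _) _; rewrite mulrDl; exact: lerD.
Qed.

(** Only m = 0 has a nonzero limit, so the terms of the derivative in which the window is
    differentiated disappear in the limit. *)
Lemma cvg_expinv m (f : nat -> R) : f x @[x --> \oo] --> +oo ->
  expinv m (f x) @[x --> \oo] --> ((m == 0%N)%:R : R).
Proof.
move=> foo; have f0 : \forall x \near \oo, 0 < f x by move/cvgryPgt : foo; apply.
have V0 : (f x)^-1 @[x --> \oo] --> (0 : R) by apply/gtr0_cvgV0.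
have -> : (m == 0%N)%:R = 0 ^+ m * expR (- 0) :> R by rewrite expr0n oppr0 expR0 mulr1.
apply: (@cvg_trans _ ((f x)^-1 ^+ m * expR (- (f x)^-1) @[x --> \oo])).
  by apply: near_eq_cvg; near=> x; rewrite /expinv ifT//; near: x.
apply: cvgM; first exact: (cvg_comp _ _ V0 (@exprn_continuous _ m 0)).
exact: (cvg_comp _ _ (cvgN V0) (@continuous_expR R (- 0))).
Unshelve. all: by end_near. Qed.

Lemma cvg_affine_pinfty (x y : R) : 0 < x -> x * m.+1%:R + y @[m --> \oo] --> +oo.
Proof.
move=> x0; apply/cvgryPge => A; near=> m.
rewrite -lerBlDr -ler_pdivrMl//.
rewrite (le_trans (y := m%:R))// ?ler_nat//; near: m; exact: nbhs_infty_ger.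
Unshelve. all: by end_near. Qed.

Lemma cvg_cutoff t : (c -> 0 < t) ->
  cutoff c b m.+1%:R t @[m --> \oo] --> profile c b t /\
  cutoff_deriv c b m.+1%:R t @[m --> \oo] --> profile_deriv c b t.
Proof.
move=> ct.
have Er : m.+1%:R - t @[m --> \oo] --> +oo.
  rewrite (_ : (fun m => _) = fun m => 1 * m.+1%:R + - t); first exact: cvg_affine_pinfty.
  by apply/funext => m; rewrite mul1r.
have El : left_arg c m.+1%:R t @[m --> \oo] --> +oo.
  case: c ct => [/(_ isT) t0|_].
    rewrite (_ : (fun m => _) = fun m => t * m.+1%:R + - 1); first exact: cvg_affine_pinfty.
    by apply/funext => m; rewrite mulrC.
  rewrite (_ : (fun m => _) = fun m => 1 * m.+1%:R + t); first exact: cvg_affine_pinfty.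
  by apply/funext => m; rewrite mul1r.
have W : expinv 0 (left_arg c m.+1%:R t) * expinv 0 (m.+1%:R - t) @[m --> \oo] --> (1 : R).
  have := cvgM (@cvg_expinv 0 _ El) (@cvg_expinv 0 _ Er); rewrite mulr1; exact.
split; first by have := cvgM (cvg_cst (profile c b t)) W; rewrite mulr1; exact.
rewrite (funext (fun m => @cutoff_derivE _ c b m.+1%:R t ct)).
rewrite [X in _ --> X](_ : _ = ( profile_deriv c b t * 1 +
  expR (- b * t ^+ 2) * (c%:R * 0 + 0) * 1 - profile c b t * 1 * 0)); last first.
  by ring.
have e m : expinv m (left_arg c x.+1%:R t) @[x --> \oo] --> ((m == 0%N)%:R : R) := @cvg_expinv m _ El.
have e' m : expinv m (x.+1%:R - t) @[x --> \oo] --> ((m == 0%N)%:R : R) := @cvg_expinv m _ Er.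
have E0 := e 0%N; have E1 := e 1%N; have E2 := e 2%N; have E2' := e' 2%N; have E0' := e' 0%N.
rewrite /= in E0 E1 E2 E2' E0'.
have P := cvg_cst (profile c b t); have D := cvg_cst (profile_deriv c b t).
have G := cvg_cst (expR (- b * t ^+ 2)); have C := cvg_cst (c%:R : R).
apply: cvgB; last exact: (cvgM (cvgM (P _ _ _) E0) E2').
apply: cvgD; first exact: (cvgM (D _ _ _) W).
exact: (cvgM (cvgM (G _ _ _) (cvgD (cvgM (C _ _ _) E1) E2)) E0').
Qed.

End bounds.

(** * Convergence of the truncated extremizers *)

Section extremizer_completion.
Context {R : realType} {n : nat} (k : nat) (b : R).
Hypothesis b_gt0 : 0 < b.
Local Notation Om := (@orthant R n k).
Local Notation mu := (lebesgue_rV R n).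
Implicit Types (x : 'rV[R]_n) (i : 'I_n).

Let mOm : measurable Om := measurable_orthant k.
Let E x : R := expR (- (b / 2) * sqnorm x).

Lemma int_orthant_dominated_cvg0 (F : nat -> 'rV[R]_n -> R) (C : R) :
  (forall m, measurable_fun Om (F m)) ->
  (forall m x, Om x -> `|F m x| <= C * E x) ->
  (forall x, Om x -> F m x @[m --> \oo] --> 0) ->
  (int_orthant k (F m) @[m --> \oo] --> 0%E).
Proof.
move=> mF FC F0.
have iE : mu.-integrable Om (fun x => (C%:E * (E x)%:E)%E).
  apply: (integrableZl mOm); apply: (@integrableS _ _ _ _ setT) => //.
  by apply: integrable_expR_sqnorm; rewrite divr_gt0.
have F0' x : Om x -> (F m x)%:E @[m --> \oo] --> 0%E.
  by move=> Ox; apply: cvg_EFin; [exact: nearW|exact: F0].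
have [|||||_ _] := @dominated_convergence _ _ _ mu Om mOm (fun m x => (F m x)%:E) (cst 0%E)
    (fun x => (C%:E * (E x)%:E)%E).
- by move=> m; apply/measurable_EFinP.
- exact: measurable_cst.
- exact: aeW.
- exact: iE.
- by apply: aeW => x m Ox; rewrite lee_fin; exact: FC.
- by rewrite integral0.
Qed.

Lemma tensor_norm_le (p : 'I_n -> R -> R) (C : R) x : 0 <= C ->
  (forall i, `|p i (x ord0 i)| <= C * expR (- (b / 2) * x ord0 i ^+ 2)) ->
  `|tensor p x| <= C ^+ n * E x.
Proof.
move=> C0 pC; rewrite /tensor normr_prod /E expR_sqnorm /tensor.
rewrite -[n in C ^+ n]card_ord -prodr_const -big_split/=.
by apply: ler_prod => i _; rewrite normr_ge0 pC.
Qed.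

Lemma cvg_tensor (p : nat -> 'I_n -> R -> R) (q : 'I_n -> R -> R) x :
  (forall i, p m i (x ord0 i) @[m --> \oo] --> q i (x ord0 i)) ->
  tensor (p m) x @[m --> \oo] --> tensor q x.
Proof.
move=> pq; rewrite /tensor; elim: (index_enum _) => [|i r IHr].
  by rewrite big_nil; under eq_fun do rewrite big_nil; exact: cvg_cst.
by rewrite big_cons; under eq_fun do rewrite big_cons; exact: cvgM.
Qed.

Let c i : bool := (n - k <= i)%N.
Let p (m : nat) i : R -> R := cutoff (c i) b m.+1%:R.
Let q i : R -> R := profile (c i) b.

Lemma test_function_cutoff al m : test_function k (fun x => al * tensor (p m) x).
Proof.
have M0 : (0 : R) < m.+1%:R by [].
pose K : set 'rV[R]_n := cbox (fun i => if c i then m.+1%:R^-1 else - m.+1%:R) (fun=> m.+1%:R).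
have cK : compact K by exact: compact_cbox.
have sK : closure [set x | al * tensor (p m) x != 0] `<=` K.
  have clK : closed K by apply: compact_closed => //; exact: norm_hausdorff.
  rewrite (iffLR (closure_id K) clK).
  apply: closure_subset => x /=; rewrite mulf_eq0 negb_or => /andP[_ px] i /=.
  rewrite in_itv/=; apply: (@cutoff_supp _ (c i) b _ _ M0).
  by apply: contra px => /eqP p0; rewrite /tensor (bigD1 i)//= /p p0 mul0r.
split.
- apply/smoothCk => N; apply: CkM; first exact: Ck_cst.
  by apply: Ck_tensor => i; exact: Ck1_cutoff.
- exact: (subclosed_compact (@closed_closure _ _) cK sK).
- move=> x /sK Kx i ki; have := Kx i; rewrite /= in_itv/= /c ki => /andP[+ _].
  by apply: lt_le_trans; rewrite invr_gt0.
Qed.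

(** Stated for general factors, so as to cover both the functions and, through [tensor_deriv], their
    partial derivatives. The square of E is kept because one factor E has to absorb the weight
    |x|^2. *)
Let tensor_sub_bound al (p' : nat -> 'I_n -> R -> R) (q' : 'I_n -> R -> R) (C : R) :
  0 <= C ->
  (forall i t, (c i -> 0 < t) -> `|q' i t| <= C * expR (- (b / 2) * t ^+ 2)) ->
  (forall m i t, (c i -> 0 < t) -> `|p' m i t| <= C * expR (- (b / 2) * t ^+ 2)) ->
  (forall i t, (c i -> 0 < t) -> p' m i t @[m --> \oo] --> q' i t) ->
  (forall m x, Om x -> (al * tensor (p' m) x - al * tensor q' x) ^+ 2 <=
     (2 * `|al| * C ^+ n) ^+ 2 * E x ^+ 2) /\
  (forall x, Om x -> al * tensor (p' m) x - al * tensor q' x @[m --> \oo] --> 0).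
Proof.
move=> C0 qC pC pq; split=> [m x Ox|x Ox].
  rewrite -exprMn -real_normK ?num_real//.
  rewrite ler_pXn2r ?nnegrE ?normr_ge0 ?mulr_ge0 ?exprn_ge0 ?expR_ge0//.
  rewrite -mulrBr normrM (_ : _ * E x = `|al| * (C ^+ n * E x + C ^+ n * E x)); last by ring.
  apply: ler_wpM2l => //; apply: le_trans (ler_normB _ _) _.
  by apply: lerD; apply: tensor_norm_le => // i; [apply: pC|apply: qC] => ci; exact: Ox.
rewrite -[X in _ --> X](subrr (al * tensor q' x)).
apply: cvgB; last exact: cvg_cst.
by apply: cvgM; [exact: cvg_cst|apply: cvg_tensor => i; apply: pq => ci; exact: Ox].
Qed.

Let E_le1 x : E x <= 1.
Proof.
rewrite /E -expR0 ler_expR mulNr oppr_le0 mulr_ge0 ?divr_ge0//; first exact: ltW.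
by apply: sumr_ge0 => i _; exact: sqr_ge0.
Qed.

Let E_sqr x : E x ^+ 2 <= E x.
Proof. by rewrite expr2 ler_piMr ?expR_ge0. Qed.

Lemma extremizer_in_completion al :
  exists Du : 'rV[R]_n -> 'rV[R]_n, in_completion k (extremizer k al b) Du.
Proof.
pose u x := al * tensor q x; pose f m x := al * tensor (p m) x.
have Eu : extremizer k al b = u by exact: extremizerE.
have Ck1q i N : Ck1 N (q i) by exact: Ck1_extr1.
have dq i : forall t, derivable (q i) t 1 by exact: Ck1_derivable (Ck1q i 1%N).
have dp m i : forall t, derivable (p m i) t 1 by exact: Ck1_derivable (Ck1_cutoff _ _ 1 _).
have Cu N : Ck N u by apply: CkM; [exact: Ck_cst|apply: Ck_tensor => i; exact: Ck1q].
have pu i : partial i u = fun x => al * tensor (tensor_deriv i q) x.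
  by rewrite partialZ ?partial_tensor//; exact: (Ck_partial i (Ck_tensor (fun j => Ck1q j 1%N))).1.
have pf i m : partial i (f m) = fun x => al * tensor (tensor_deriv i (p m)) x.
  rewrite partialZ ?partial_tensor//.
  exact: (Ck_partial i (Ck_tensor (fun j => Ck1_cutoff (c j) b 1 m.+1%:R))).1.
(* One constant for all coordinates: the sum of those for half-line and full-line factors. *)
have [C C0 CP] : exists2 C : R, 0 <= C & forall i t, (c i -> 0 < t) ->
  [/\ `|q i t| <= C * expR (- (b / 2) * t ^+ 2),
      `|derive1 (q i) t| <= C * expR (- (b / 2) * t ^+ 2),
      forall m, `|p m i t| <= C * expR (- (b / 2) * t ^+ 2) &
      forall m, `|derive1 (p m i) t| <= C * expR (- (b / 2) * t ^+ 2)].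
  have [C C0 HC] := @profile_bound _ true b b_gt0.
  have [C' C0' HC'] := @profile_bound _ false b b_gt0.
  have CC' : 0 <= C + C' by exact: addr_ge0.
  exists (C + C') => // i t ct; rewrite derive1_profile.
  have L (z y : R) : z \in [:: C; C'] -> y <= z * expR (- (b / 2) * t ^+ 2) ->
      y <= (C + C') * expR (- (b / 2) * t ^+ 2).
    rewrite !inE => /orP[]/eqP-> /le_trans; apply; rewrite ler_wpM2r ?expR_ge0//.
      by rewrite lerDl.
    by rewrite lerDr.
  rewrite /q /p; case: (c i) ct => ct.
    have [H1 H2 H3 H4] := HC t ct; split => [||m|m]; rewrite ?derive1_cutoff;
      by apply: (L C); rewrite ?inE ?eqxx.
  have [H1 H2 H3 H4] := HC' t ct; split => [||m|m]; rewrite ?derive1_cutoff;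
    by apply: (L C'); rewrite ?inE ?eqxx ?orbT.
rewrite Eu; exists (gradient u); split.
- exact: measurable_funS measurableT (@subsetT _ _) (continuous_measurable_rV (Ck_continuous (Cu 0%N))).
- apply: (measurable_funS measurableT (@subsetT _ _)); apply: measurable_fun_rVP => i.
  by rewrite gradientE; apply: continuous_measurable_rV; exact: Ck_continuous (Ck_partial i (Cu 1%N)).2.
have Cf m N : Ck N (f m) by have [/smoothCk] := test_function_cutoff al m.
exists f; split; first by move=> m; exact: test_function_cutoff.
  have HB i := @tensor_sub_bound al (fun m => tensor_deriv i (p m)) (tensor_deriv i q) C C0.
  have {}HB i : (forall m x, Om x -> (partial i (f m) x - partial i u x) ^+ 2 <=
      (2 * `|al| * C ^+ n) ^+ 2 * E x ^+ 2) /\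
      (forall x, Om x -> partial i (f m) x - partial i u x @[m --> \oo] --> 0).
    have [|||H1 H2] := HB i.
    - move=> j t ct; have [H1 H2 _ _] := CP j t ct.
      by rewrite /tensor_deriv; case: ifP.
    - move=> m j t ct; have [_ _ H1 H2] := CP j t ct.
      by rewrite /tensor_deriv; case: ifP.
    - move=> j t ct; have [H1 H2] := cvg_cutoff b ct.
      rewrite /tensor_deriv; case: ifP => _ //; rewrite derive1_profile.
      by rewrite (_ : (fun m => _) = fun m => cutoff_deriv (c j) b m.+1%:R t)//;
        apply/funext => m; rewrite derive1_cutoff.
    - split=> [m x Ox|x Ox]; first by rewrite pu pf; exact: H1.
      by rewrite pu (funext (fun m => congr1 (fun g => g x - _) (pf i m))); exact: H2.
  have SE m x : sqnorm (gradient (f m) x - gradient u x) =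
      \sum_i (partial i (f m) x - partial i u x) ^+ 2.
    by apply: eq_bigr => i _; rewrite !mxE.
  apply: (@int_orthant_dominated_cvg0 _ (\sum_(i < n) (2 * `|al| * C ^+ n) ^+ 2)).
  - move=> m; rewrite (funext (SE m)); apply: measurable_sum => i; apply: measurable_funX.
    apply: continuous_measurable_rV; apply: (@Ck_continuous _ _ 0).
    by apply: CkB; [exact: (Ck_partial i (Cf m 1%N)).2|exact: (Ck_partial i (Cu 1%N)).2].
  - move=> m x Ox; rewrite SE ger0_norm; last by apply: sumr_ge0 => i _; exact: sqr_ge0.
    rewrite mulr_suml; apply: ler_sum => i _; apply: le_trans ((HB i).1 m x Ox) _.
    by rewrite ler_wpM2l ?sqr_ge0 ?E_sqr.
  - move=> x Ox; rewrite (funext (fun m => SE m x)).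
    have := cvg_sum (a := fun (i : 'I_n) m => (partial i (f m) x - partial i u x) ^+ 2) (l := fun=> 0).
    rewrite big1//; apply => i; rewrite -[X in _ --> X](expr0n _ 2).
    exact: (cvg_comp _ _ ((HB i).2 x Ox) (@exprn_continuous _ 2 0)).
have [] := @tensor_sub_bound al p q C C0.
- by move=> i t ct; have [] := CP i t ct.
- by move=> m i t ct; have [_ _ H _] := CP i t ct; exact: H.
- by move=> i t ct; exact: (cvg_cutoff b ct).1.
rewrite -/u => H1 H2.
(* The factor 2 / b bounds |x|^2 E(x), by [sqr_expR_le]. *)
apply: (@int_orthant_dominated_cvg0 _ ((2 * `|al| * C ^+ n) ^+ 2 * (2 / b))).
- move=> m; apply: measurable_funM; first exact: measurable_sqnorm.
  apply: measurable_funX; apply: continuous_measurable_rV.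
  exact: Ck_continuous (CkB (Cf m 0%N) (Cu 0%N)).
- move=> m x Ox; have s0 : 0 <= sqnorm x by apply: sumr_ge0 => i _; exact: sqr_ge0.
  rewrite ger0_norm; last by rewrite mulr_ge0 ?sqr_ge0.
  apply: le_trans (ler_wpM2l s0 (H1 m x Ox)) _.
  rewrite mulrCA -[leRHS]mulrA ler_wpM2l ?sqr_ge0// expr2 mulrA.
  by rewrite ler_wpM2r ?expR_ge0// sqr_expR_le.
- move=> x Ox; rewrite -[X in _ --> X](mulr0 (sqnorm x)); apply: cvgM; first exact: cvg_cst.
  rewrite -[X in _ --> X](expr0n _ 2); exact: (cvg_comp _ _ (H2 x Ox) (@exprn_continuous _ 2 0)).
Qed.

End extremizer_completion.

(** * Sharpness *)

Section sharpness.
Context {R : realType} {n : nat} (k : nat).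
Hypotheses (k_gt0 : (0 < k)%N) (kn : (k <= n)%N).
Local Notation Om := (@orthant R n k).
Local Notation mu := (lebesgue_rV R n).
Local Notation ip := (iprod mu Om).
Local Notation N := ((n + 2 * k)%:R : R).

Let mOm : measurable Om := measurable_orthant k.

(** The box [1, 2]^n lies in the orthant, has positive measure, and the extremizer is positive on
    it. With zero mass the extremizer could not rule out larger constants. *)
Lemma extremizer_mass_gt0 u Du f_ b : approx k u Du f_ ->
  u = extremizer k 1 b %[ae mu in Om] -> 0 < ip u u.
Proof.
move=> H uE; rewrite lt_neqAle ip_ge0 andbT; apply/eqP => /esym /(ip_eq0 mOm (approx_L2 H)) u0.
have : mu.-negligible (cbox (fun=> 1) (fun=> 2)).
  apply: negligibleS (negligibleU uE u0) => x Kx /=.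
  have Ox : Om x by apply: (cbox_orthant (l := fun=> 1)) Kx.
  apply/not_andP => -[/(_ Ox) ux /(_ Ox)].
  by rewrite ux extremizerE mul1r => G0; have := extr_gt0 b Ox; rewrite /extr G0 ltxx.
have K0 : (0 < mu (cbox (fun=> 1%R : R) (fun=> 2%R : R)))%E.
  by apply: cbox_gt0 => _; rewrite ltr1n.
rewrite negligibleP; last exact: measurable_cbox.
by move=> Z; rewrite Z ltxx in K0.
Qed.

Lemma equality_extremizer u Du f_ : approx k u Du f_ ->
  4 * (grad_sq k Du * weight_sq k u) = (N * ip u u) ^+ 2 ->
  exists al b : R, 0 < b /\ u = extremizer k al b %[ae mu in Om].
Proof.
move=> H eq4; have N0 : 0 < N by rewrite ltr0n addn_gt0 muln_gt0 k_gt0 orbT.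
have [C0|C0] := eqVneq (ip u u) 0.
  (* Here u vanishes almost everywhere, so alpha = 0, with an arbitrary positive beta. *)
  exists 0, 1; split=> //; have := ip_eq0 mOm (approx_L2 H) C0.
  by apply: filterS => x u0 Ox; rewrite u0// extremizerE mul0r.
have {}C0 : 0 < ip u u by rewrite lt_neqAle eq_sym C0 ip_ge0.
have A0 := grad_sq_ge0 k Du; have B0 := weight_sq_ge0 k u.
have AB : 0 < grad_sq k Du * weight_sq k u.
  by rewrite -(pmulr_rgt0 _ (ltr0Sn R 3)) eq4 exprn_gt0// mulr_gt0.
have {B0}B0 : 0 < weight_sq k u.
  by rewrite lt_neqAle B0 andbT; apply: contraTneq AB => <-; rewrite mulr0 ltxx.
(* Half of the minimizer t = C / (2 B), as t = 2 b. For this b the limit of the remainder,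
   multiplied by 4 B, is 4 A B - C^2 = 0. *)
pose b := N * ip u u / (4 * weight_sq k u).
have b0 : 0 < b by rewrite divr_gt0 ?mulr_gt0.
have [a ua] : exists a, u = extremizer k a b %[ae mu in Om].
  apply: (ae_extremizer H).
  have := ground_sq_cvg kn H (b := b).
  rewrite (_ : _ - _ = 0)//; apply: (mulfI (x := 4 * weight_sq k u)).
    by rewrite gt_eqF// mulr_gt0.
  rewrite mulr0 [LHS](_ : _ = 4 * (grad_sq k Du * weight_sq k u) - (N * ip u u) ^+ 2).
    by rewrite eq4 subrr.
  by rewrite /b; field; rewrite gt_eqF.
by exists a, b.
Qed.

End sharpness.

Local Open Scope ereal_scope.

(** The equality clause speaks only of elements of the completion; the last clause adds that every
    extremizer is one. *)
Theorem theorem1p1 (R : realType) (n k : nat)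
    (hn : (1 <= n)%N) (hk : (1 <= k <= n)%N) :
  let c : R := ((n + 2 * k)%:R ^+ 2 / 4)%R in
  [/\ forall (u : 'rV[R]_n -> R) (Du : 'rV[R]_n -> 'rV[R]_n),
        in_completion k u Du ->
        gradient_term k Du * weight_term k u >= c%:E * mass_term k u ^+ 2,
      forall c' : R,
        (forall (u : 'rV[R]_n -> R) (Du : 'rV[R]_n -> 'rV[R]_n),
          in_completion k u Du ->
          gradient_term k Du * weight_term k u >= c'%:E * mass_term k u ^+ 2) ->
        (c' <= c)%R,
      forall (u : 'rV[R]_n -> R) (Du : 'rV[R]_n -> 'rV[R]_n),
        in_completion k u Du ->
        (gradient_term k Du * weight_term k u = c%:E * mass_term k u ^+ 2 <->
         exists alpha beta : R, (0 < beta)%R /\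
           u = extremizer k alpha beta %[ae lebesgue_rV R n in orthant k]) &
      forall alpha beta : R, (0 < beta)%R ->
        exists Du : 'rV[R]_n -> 'rV[R]_n,
          in_completion k (extremizer k alpha beta) Du].
Proof.
move=> c; have [k0 kn] := andP hk.
(* All three integrals are finite on the completion, so the extended-real statements reduce to real
   ones. *)
have H4 u Du f_ : approx k u Du f_ ->
    [/\ gradient_term k Du * weight_term k u = (grad_sq k Du * weight_sq k u)%:E &
        forall c', c'%:E * mass_term k u ^+ 2 =
          (c' * (iprod (lebesgue_rV R n) (orthant k) u u) ^+ 2)%:E].
  move=> H; rewrite (gradient_termE H) (weight_termE H) (mass_termE H).
  by split=> // c'; rewrite -EFin_expe -EFinM.
have cE x : (c * x ^+ 2 = ((n + 2 * k)%:R * x) ^+ 2 / 4 :> R)%R.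
  by rewrite /c exprMn mulrAC.
have four : (0 < 4 :> R)%R by [].
split.
- move=> u Du /(in_completion_approx k0 kn)[f_ H]; have [-> ->] := H4 _ _ _ H.
  rewrite lee_fin cE ler_pdivrMr// [leRHS]mulrC; exact: (mass_sq_le kn H).
(* Sharpness is tested on the extremizer with alpha = beta = 1, where equality holds and the
   positive mass can be cancelled. *)
- move=> c' Hc'; have [Du cD] := extremizer_in_completion (n := n) k (@ltr01 R) 1.
  have [f_ H] := in_completion_approx k0 kn cD.
  have [E1 E2] := H4 _ _ _ H.
  have ae1 : extremizer k 1%R 1%R = extremizer k 1%R 1%R %[ae lebesgue_rV R n in @orthant R n k].
    exact: aeW.
  have m0 := extremizer_mass_gt0 H ae1.
  have := Hc' _ _ cD; rewrite E1 E2 lee_fin.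
  rewrite -(ler_pM2l four) (extremizer_equality kn H ae1) exprMn mulrA ler_pM2r ?exprn_gt0//.
  by rewrite /c ler_pdivlMr// mulrC.
- move=> u Du /(in_completion_approx k0 kn)[f_ H]; have [-> ->] := H4 _ _ _ H.
  split=> [[]|[al [b [b0 uE]]]].
    rewrite cE => E; apply: (equality_extremizer k0 kn H).
    by rewrite E; field.
  by rewrite cE -(extremizer_equality kn H uE) mulrAC divff ?mul1r ?gt_eqF.
- by move=> al b b0; exact: extremizer_in_completion.
Qed.
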